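(* One has $(E_7^C)^{\sigma'_4,\mathfrak{so}(6,C)}\cong SL(2,C)\times\mathrm{Spin}(6,C)$, where $$(E_7^C)^{\sigma'_4,\mathfrak{so}(6,C)}=\{\alpha\in E_7^C\mid\sigma'_4\alpha=\alpha\sigma'_4,\ \varPhi_D\alpha=\alpha\varPhi_D\text{ for all }D\in\mathfrak{so}(6,C)\}.$$ In particular, the group $(E_7^C)^{\sigma'_4,\mathfrak{so}(6,C)}$ is connected.
   Context: Octonions and Jordan algebra. $\mathfrak C$ is the real division algebra of octonions with standard basis $e_0=1,e_1,\dots,e_7$, conjugation $x\mapsto\overline x$; $C=\mathbf R\oplus i\mathbf R$ is the field of complex numbers, and $\mathfrak C^C=\mathfrak C\otimes_{\mathbf R}C$ with $C$-linearly extended product and conjugation. $\mathfrak J^C$ is the space of $3\times3$ matrices $$X=\begin{pmatrix}\xi_1&x_3&\overline x_2\\ \overline x_3&\xi_2&x_1\\ x_2&\overline x_1&\xi_3\end{pmatrix},\quad \xi_k\in C,\ x_k\in\mathfrak C^C.$$ $E_k$ is the element with $\xi_k=1$ and all other entries $0$; $F_k(x)$ is the element with $x_k=x$ and all other entries $0$; $E$ is the unit matrix. Put $X\circ Y=\frac12(XY+YX)$, $(X,Y)=\mathrm{tr}(X\circ Y)$, $X\times Y=\frac12(2X\circ Y-\mathrm{tr}(X)Y-\mathrm{tr}(Y)X+(\mathrm{tr}(X)\mathrm{tr}(Y)-(X,Y))E)$, $\tilde T X=T\circ X$. $F_4^C$ is the group of $C$-linear automorphisms of $(\mathfrak J^C,\circ)$,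 with Lie algebra $\mathfrak f_4^C$ of derivations. $\mathfrak e_6^C=\{\delta+\tilde T\mid\delta\in\mathfrak f_4^C,\ T\in\mathfrak J^C,\ \mathrm{tr}(T)=0\}$. $E_7^C$. $\mathfrak P^C=\mathfrak J^C\oplus\mathfrak J^C\oplus C\oplus C$. For $\phi\in\mathfrak e_6^C$, $A,B\in\mathfrak J^C$, $\nu\in C$, $\varPhi(\phi,A,B,\nu)$ is the linear map of $\mathfrak P^C$ $$(X,Y,\xi,\eta)\mapsto(\phi X-\tfrac13\nu X+2B\times Y+\eta A,\ 2A\times X-{}^t\phi Y+\tfrac13\nu Y+\xi B,\ (A,Y)+\nu\xi,\ (B,X)-\nu\eta),$$ where ${}^t\phi$ is the transpose for $(\cdot,\cdot)$; these form the Lie algebra $\mathfrak e_7^C$. For $P=(X,Y,\xi,\eta)$, $Q=(Z,W,\zeta,\omega)$, $P\times Q=\varPhi(\phi,A,B,\nu)$ with $\phi=-\frac12(X\vee W+Z\vee Y)$, $A=-\frac14(2Y\times W-\xi Z-\zeta X)$, $B=\frac14(2X\times Z-\eta W-\omega Y)$, $\nu=\frac18((X,W)+(Z,Y)-3(\xi\omega+\zeta\eta))$, where $X\vee W=[\tilde X,\tilde W]+(X\circ W-\frac13(X,W)E)^{\sim}$. $E_7^C=\{\alpha\in\mathrm{Iso}_C(\mathfrak P^C)\mid\alpha(P\times Q)\alpha^{-1}=\alpha P\times\alpha Q\}$, and $F_4^C\subset E_7^C$ via $\alpha(X,Y,\xi,\eta)=(\alpha X,\alpha Y,\xi,\eta)$.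 The element $\sigma'_4\in F_4^C\subset E_7^C$: in terms of the entries of $X$, it fixes $\xi_1,\xi_2,\xi_3$ and maps $x_1\mapsto-e_1x_1e_1$, $x_2\mapsto e_1x_2$, $x_3\mapsto-x_3e_1$; on $\mathfrak P^C$, $\sigma'_4(X,Y,\xi,\eta)=(\sigma'_4X,\sigma'_4Y,\xi,\eta)$. Here $\mathfrak{so}(6,C)$ denotes $\{D\in\mathfrak f_4^C\mid DE_i=0\ (i=1,2,3),\ DF_1(e_k)=0\ (k=0,1)\}$ and $\varPhi_D=\varPhi(D,0,0,0)\in\mathfrak e_7^C$. $\mathrm{Spin}(6,C)$ is the complex spinor group, the universal (double) covering group of $SO(6,C)$. *)

(* Defs.v *)
From HB Require Import structures.
From mathcomp Require Import all_boot all_order all_algebra.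
From mathcomp Require Import all_classical all_reals all_analysis.
From mathcomp Require Import complex.

Set Implicit Arguments.
Unset Strict Implicit.
Unset Printing Implicit Defensive.

Import Order.TTheory GRing.Theory Num.Theory.
Import numFieldNormedType.Exports.

Local Open Scope classical_set_scope.
Local Open Scope ring_scope.

(* Isomorphism of the topological groups (G, mT) and (H, mU), each carrying
   the subspace topology of the ambient space. *)
Definition topgroup_iso (T U : topologicalType)
    (G : set T) (mT : T -> T -> T) (H : set U) (mU : U -> U -> U) : Prop :=
  exists (f : T -> U) (g : U -> T),
    [/\ (forall x, G x -> H (f x)) /\ (forall y, H y -> G (g y)),
        (forall x, G x -> g (f x) = x) /\ (forall y, H y -> f (g y) = y),
        forall x y, G x -> G y -> f (mT x y) = mU (f x) (f y),
        {within G, continuous f} & {within H, continuous g}].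

(* Oriented lines (i, j, k) of the Fano plane: e_i e_j = e_k = - e_j e_i, and
   cyclically; here e_5 = e_1 e_4, e_6 = e_4 e_2, e_7 = e_3 e_4. *)
Definition oct_lines : seq (nat * nat * nat) :=
  [:: (1, 2, 3); (1, 4, 5); (1, 6, 7); (2, 5, 7); (3, 4, 7); (3, 5, 6);
      (4, 2, 6)]%N.

Definition oct_oriented (i j k : nat) : bool :=
  [|| (i, j, k) \in oct_lines, (j, k, i) \in oct_lines
    | (k, i, j) \in oct_lines].

(* The coefficient of e_k in e_i e_j. *)
Definition oct_coef (i j k : nat) : int :=
  if i == 0%N then (j == k)%:Z
  else if j == 0%N then (i == k)%:Z
  else if i == j then - (k == 0%N)%:Z
  else (oct_oriented i j k)%:Z - (oct_oriented j i k)%:Z.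

(* The complex numbers, with the topology that every numClosedFieldType gets
   from its norm. *)
Definition Cplx (R : realType) : numClosedFieldType := R[i].

Section ComplexE7.
(* K stands for the field C of complex numbers. *)
Variable K : numClosedFieldType.

(* Coordinates in the basis e_0, ..., e_7. *)
Definition oct := 'rV[K]_8.

Definition octE (k : 'I_8) : oct := delta_mx 0 k.

Definition octmul (x y : oct) : oct :=
  \row_k \sum_(i < 8) \sum_(j < 8) (oct_coef i j k)%:~R * x 0 i * y 0 j.

Definition octconj (x : oct) : oct :=
  \row_(k < 8) (if k == 0 :> nat then x 0 k else - x 0 k).

(* The pair ((xi_1, xi_2, xi_3), x) where x_1, x_2, x_3 are the rows of x. *)
Definition jordan := ('rV[K]_3 * 'M[K]_(3, 8))%type.

Local Notation o1 := (@Ordinal 3 0 isT).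
Local Notation o2 := (@Ordinal 3 1 isT).
Local Notation o3 := (@Ordinal 3 2 isT).
Local Notation e0 := (@Ordinal 8 0 isT).
Local Notation e1 := (@Ordinal 8 1 isT).

Definition jmake (xi : 'rV[K]_3) (x1 x2 x3 : oct) : jordan :=
  (xi, \matrix_(i < 3) nth 0 [:: x1; x2; x3] i).

Definition jordan_mx (X : jordan) : 'M[oct]_3 :=
  let xi k := X.1 0 k *: octE e0 in
  let x k := row k X.2 in
  \matrix_(i < 3, j < 3) nth 0 (nth [::]
    [:: [:: xi o1; x o3; octconj (x o2)];
        [:: octconj (x o3); xi o2; x o1];
        [:: x o2; octconj (x o1); xi o3]] i) j.

Definition mx_jordan (M : 'M[oct]_3) : jordan :=
  jmake (\row_k M k k 0 e0) (M o2 o3) (M o3 o1) (M o1 o2).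

(* The matrix product over the (nonassociative) octonions. *)
Definition octmulmx (M N : 'M[oct]_3) : 'M[oct]_3 :=
  \matrix_(i, j) \sum_k octmul (M i k) (N k j).

Definition jordanE (k : 'I_3) : jordan := (delta_mx 0 k, 0).

Definition jordanF1 (x : oct) : jordan := jmake 0 x 0 0.

Definition jordan1 : jordan := (const_mx 1, 0).

Definition jmul (X Y : jordan) : jordan :=
  2^-1 *: mx_jordan (octmulmx (jordan_mx X) (jordan_mx Y)
                     + octmulmx (jordan_mx Y) (jordan_mx X)).

Definition jtrace (X : jordan) : K := \sum_k X.1 0 k.

Definition jform (X Y : jordan) : K := jtrace (jmul X Y).

Definition jcross (X Y : jordan) : jordan :=
  2^-1 *: (2 *: jmul X Y - jtrace X *: Y - jtrace Y *: X
           + (jtrace X * jtrace Y - jform X Y) *: jordan1).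

(* The transpose with respect to jform; junk value 0 if there is none. *)
Definition jtranspose (phi : jordan -> jordan) : jordan -> jordan :=
  xget (fun=> 0) [set psi : jordan -> jordan |
                   forall X Y, jform (phi X) Y = jform X (psi Y)].

Definition jvee (X W : jordan) : jordan -> jordan := fun Z =>
  (jmul X (jmul W Z) - jmul W (jmul X Z))
  + jmul (jmul X W - (3^-1 * jform X W) *: jordan1) Z.

Definition freudenthal := (jordan * jordan * K^o * K^o)%type.

Definition Phi (phi : jordan -> jordan) (A B : jordan) (nu : K) :
    freudenthal -> freudenthal :=
  fun P => let: (X, Y, xi, eta) := P in
  (phi X - (3^-1 * nu) *: X + 2 *: jcross B Y + eta *: A,
   2 *: jcross A X - jtranspose phi Y + (3^-1 * nu) *: Y + xi *: B,
   jform A Y + nu * xi,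
   jform B X - nu * eta).

Definition fcross (P Q : freudenthal) : freudenthal -> freudenthal :=
  let: (X, Y, xi, eta) := P in
  let: (Z, W, zeta, omega) := Q in
  Phi (fun V => - 2^-1 *: (jvee X W V + jvee Z Y V))
      (- 4^-1 *: (2 *: jcross Y W - xi *: Z - zeta *: X))
      (4^-1 *: (2 *: jcross X Z - eta *: W - omega *: Y))
      (8^-1 * (jform X W + jform Z Y - 3 * (xi * omega + zeta * eta))).

Definition E7 : set (freudenthal -> freudenthal) :=
  [set alpha | linear alpha /\
    exists beta, [/\ cancel alpha beta, cancel beta alpha &
      forall P Q,
        alpha \o fcross P Q \o beta = fcross (alpha P) (alpha Q)]].

Definition sigma'4_jordan (X : jordan) : jordan :=
  let i := octE e1 in
  jmake X.1 (- octmul (octmul i (row o1 X.2)) i) (octmul i (row o2 X.2))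
    (- octmul (row o3 X.2) i).

Definition sigma'4 : freudenthal -> freudenthal :=
  fun P => let: (X, Y, xi, eta) := P in
  (sigma'4_jordan X, sigma'4_jordan Y, xi, eta).

Definition f4 : set (jordan -> jordan) :=
  [set D | linear D /\
    forall X Y, D (jmul X Y) = jmul (D X) Y + jmul X (D Y)].

Definition so6 : set (jordan -> jordan) :=
  [set D | [/\ f4 D, forall k, D (jordanE k) = 0,
               D (jordanF1 (octE e0)) = 0 & D (jordanF1 (octE e1)) = 0]].

(* Topology of pointwise convergence, that is, the usual topology on linear
   endomorphisms of a finite-dimensional space. *)
Definition freudenthal_maps : topologicalType :=
  {ptws freudenthal -> freudenthal}.

Definition E7_sigma'4_so6 : set freudenthal_maps :=
  [set alpha : freudenthal -> freudenthal | [/\ E7 alpha, sigma'4 \o alpha = alpha \o sigma'4 &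
    forall D, so6 D -> Phi D 0 0 0 \o alpha = alpha \o Phi D 0 0 0]].

Definition SL2 : set 'M[K]_2 := [set A | \det A = 1].

(* The Clifford algebra of the quadratic form v_1^2 + ... + v_n^2 on K^n (with
   v v = v_1^2 + ... + v_n^2), in coordinates with respect to the basis e_A,
   the increasing product of the e_i, i in A. *)
Definition clifford (n : nat) : topologicalType := {ptws {set 'I_n} -> K}.

(* e_A e_B = cliff_sign A B * e_(A (+) B), where (+) is symmetric
   difference; the exponent counts the transpositions that sort e_A e_B. *)
Definition cliff_sign n (A B : {set 'I_n}) : K :=
  (-1) ^+ #|[pred ij : 'I_n * 'I_n | [&& ij.1 \in A, ij.2 \in B
                                       & (ij.2 < ij.1)%N]]|.

Definition cliff_mul n (x y : clifford n) : clifford n := fun C : {set 'I_n} =>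
  \sum_(A : {set 'I_n}) \sum_(B : {set 'I_n} | C == (A :\: B) :|: (B :\: A))
    cliff_sign A B * x A * y B.

Definition cliff_one n : clifford n := fun A : {set 'I_n} => (A == finset.set0)%:R.

Definition cliff_vec n (v : 'rV[K]_n) : clifford n := fun A : {set 'I_n} =>
  \sum_(i < n) v 0 i * (A == [set i]%SET)%:R.

(* Products of an even number of unit vectors. *)
Definition Spin n : set (clifford n) :=
  [set x | exists s : seq 'rV[K]_n,
    [/\ ~~ odd (size s),
        forall v, v \in s -> \sum_(i < n) v 0 i ^+ 2 = 1
      & x = foldr (@cliff_mul n) (@cliff_one n) [seq cliff_vec v | v <- s]]].

End ComplexE7.

Arguments E7_sigma'4_so6 K : clear implicits.
Arguments SL2 K : clear implicits.
Arguments Spin K n : clear implicits.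

(* Main.v *)
(* Under sigma'4 and so(6) the 56-dimensional representation splits into the
   pieces V (x) 4, V^* (x) 4^*, U (x) 6 and U (x) Lambda^2 V, with dim U = 2 and
   dim V = 4. An element of the group commutes with this decomposition, hence
   acts through matrices A on U, B on V and C on V^*; evaluating (P x P) S on
   suitable vectors gives det A = 1, B^T C = 1, the action of A (x) Lambda^2 B on
   the last piece, and det B = 1. Conversely, exponentials of root vectors of
   e_7 that commute with sigma'4 and so(6) realize elementary matrices, which
   generate SL(2) x SL(4); they also give paths to the identity, whence
   connectedness. Finally Spin(6) is SL(4): in the representation of the Clifford
   algebra by 8 x 8 matrices a unit vector v acts as the block matrix with
   off-diagonal blocks M_v^-1 and M_v, for a skew 4 x 4 matrix M_v of Pfaffian 1,
   so products of two unit vectors are diag(B, B^-T) with B = M_v^-1 M_w, and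
   these B generate SL(4). The polynomial identities needed in the 56 coordinates
   are decided by computation with normal forms over the Gaussian integers. *)

From Stdlib Require Import BinInt.
From Stdlib Require BinList Ring_polynom InitialRing.
Require Import Defs.
From mathcomp Require Import all_boot all_order all_algebra.
From mathcomp Require Import all_classical all_reals all_analysis.
From mathcomp Require Import complex ring.

Set Implicit Arguments.
Unset Strict Implicit.
Unset Printing Implicit Defensive.

Import Order.TTheory GRing.Theory Num.Theory.
Import numFieldNormedType.Exports.

Local Open Scope classical_set_scope.
Local Open Scope ring_scope.
Delimit Scope Z_scope with ZZ.


(** * Polynomial formulas for the Freudenthal product *)

(** Three choices turn the verifications into finite computations. Equivariance of a linear
    bijection is tested only on (P x P) S, a polynomial map in the coordinates of P and S;
    polarization does the rest. One-parameter groups are taken along elements A with A x A = 0: then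
    Phi(0, A, 0, 0) has square zero, its exponential is 1 + Phi(0, A, 0, 0), and the dependence on
    the parameter is affine, which serves both the identities and the paths. Schur's lemma is made
    explicit with root vectors of so(6): a vector killed by the raising operators is mapped to such
    a vector, and other root vectors carry the resulting block to the remaining copies of the same
    module. On the Spin side the Clifford algebra acts faithfully on K^8, with a left inverse given
    by traces; hence the isomorphism and its inverse are restrictions of maps that are defined and
    continuous on the whole ambient spaces. *)

(* The operations below are polymorphic in the coefficients, so that one text
   yields both formulas over the field and formulas over polynomials in
   normal form, which are compared by computation. *)
Section Formulas.
Variables (T : Type) (cst : Z * Z -> T) (add mul : T -> T -> T).

Definition intc (n : Z) : T := cst (n, Z0).
Let zero := intc Z0.
Definition sumT := foldr add zero.
Definition zipT (f : T -> T -> T) (s t : seq T) :=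
  [seq f p.1 p.2 | p <- zip s t].
Definition addv := zipT add.
Definition sclv (c : T) := map (mul c).
Definition scli (n : Z) := sclv (intc n).
Definition dotv (s t : seq T) := sumT (zipT mul s t).

Definition oct_terms (k : nat) : seq (nat * nat * bool) :=
  [seq (i, j, oct_coef i j k == 1) | i <- iota 0 8,
                                     j <- [seq j <- iota 0 8 | oct_coef i j k != 0]].
(** Only the 64 nonzero structure constants are kept, eight for each coefficient of a product, with
    their signs; the table is computed once. *)
Definition oct_table := Eval vm_compute in map oct_terms (iota 0 8).

Definition omul_coef (x y : seq T) (r : seq (nat * nat * bool)) : T :=
  sumT [seq mul (if p.2 then nth zero x p.1.1
                 else mul (intc (-1)%ZZ) (nth zero x p.1.1))
          (nth zero y p.1.2) | p <- r].
Definition omul (x y : seq T) : seq T := map (omul_coef x y) oct_table.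
Definition ocnj (x : seq T) : seq T := take 1 x ++ scli (-1)%ZZ (drop 1 x).

(* Elements of the Jordan algebra are lists of 27 coordinates: xi_1, xi_2, xi_3
   and the coordinates of x_1, x_2, x_3; the product is twice [jmul]. *)
Definition orow (V : seq T) (i : nat) := take 8 (drop (3 + 8 * i) V).
Definition jm2_diag (X Y : seq T) (i j k : nat) : T :=
  mul (intc 2%ZZ) (add (mul (nth zero X i) (nth zero Y i))
    (add (dotv (orow X j) (orow Y j)) (dotv (orow X k) (orow Y k)))).
Definition jm2_off (X Y : seq T) (i j k : nat) : seq T :=
  addv (addv (sclv (add (nth zero X j) (nth zero X k)) (orow Y i))
             (sclv (add (nth zero Y j) (nth zero Y k)) (orow X i)))
    (ocnj (addv (omul (orow X j) (orow Y k)) (omul (orow Y j) (orow X k)))).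
Definition jm2 (X Y : seq T) : seq T :=
  [:: jm2_diag X Y 0 1 2; jm2_diag X Y 1 2 0; jm2_diag X Y 2 0 1] ++
  (jm2_off X Y 0 1 2 ++ jm2_off X Y 1 2 0 ++ jm2_off X Y 2 0 1).

Definition tr3 (X : seq T) : T := sumT (take 3 X).
Definition frm (X Y : seq T) : T :=
  add (dotv (take 3 X) (take 3 Y)) (mul (intc 2%ZZ) (dotv (drop 3 X) (drop 3 Y))).
Definition unit27 (c : T) : seq T := nseq 3 c ++ nseq 24 zero.
Definition cross2 (X Y : seq T) : seq T :=
  addv (addv (jm2 X Y)
             (scli (-1)%ZZ (addv (sclv (tr3 X) Y) (sclv (tr3 Y) X))))
       (unit27 (add (mul (tr3 X) (tr3 Y)) (mul (intc (-1)%ZZ) (frm X Y)))).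

(* Twelve times X \/ W, from its definition and from the formula
   (X \/ W) Z = (W, Z) X / 2 + (X, W) Z / 6 - 2 W * (X * Z). *)
Definition vee12_def (X W Z : seq T) : seq T :=
  addv (scli 3%ZZ (addv (addv (jm2 X (jm2 W Z)) (scli (-1)%ZZ (jm2 W (jm2 X Z))))
                        (jm2 (jm2 X W) Z)))
       (sclv (mul (intc (-4)%ZZ) (frm X W)) Z).
Definition vee12 (X W Z : seq T) : seq T :=
  addv (addv (sclv (mul (intc 6%ZZ) (frm W Z)) X)
             (sclv (mul (intc 2%ZZ) (frm X W)) Z))
       (scli (-6)%ZZ (cross2 W (cross2 X Z))).

Definition fpX (P : seq T) := take 27 P.
Definition fpY (P : seq T) := take 27 (drop 27 P).
Definition fpxi (P : seq T) := nth zero P 54.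
Definition fpeta (P : seq T) := nth zero P 55.

(* (P x P) S, multiplied by 24 to make the coefficients integral. *)
Definition fsq24 (P S : seq T) : seq T :=
  let X := fpX P in let Y := fpY P in let xi := fpxi P in let eta := fpeta P in
  let U := fpX S in let V := fpY S in let s := fpxi S in let t := fpeta S in
  let A := addv (scli (-1)%ZZ (cross2 Y Y)) (sclv (mul (intc 2%ZZ) xi) X) in
  let B := addv (cross2 X X) (sclv (mul (intc (-2)%ZZ) eta) Y) in
  let nu := add (frm X Y) (mul (intc (-3)%ZZ) (mul xi eta)) in
  addv (scli (-2)%ZZ (addv (vee12 X Y U) (sclv nu U)))
       (scli 6%ZZ (addv (cross2 B V) (sclv t A)))
  ++ (addv (scli 2%ZZ (addv (vee12 Y X V) (sclv nu V)))
          (scli 6%ZZ (addv (cross2 A U) (sclv s B)))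
  ++ [:: mul (intc 6%ZZ) (add (frm A V) (mul nu s));
         mul (intc 6%ZZ) (add (frm B U) (mul (intc (-1)%ZZ) (mul nu t)))]).

(* The exponential of Phi 0 A 0 0 when A x A = 0. *)
Definition fexp (A P : seq T) : seq T :=
  addv (fpX P) (sclv (fpeta P) A)
  ++ (addv (fpY P) (cross2 A (fpX P))
  ++ [:: add (fpxi P) (frm A (fpY P)); fpeta P]).
Definition flam (P : seq T) : seq T :=
  fpY P ++ (scli (-1)%ZZ (fpX P) ++ [:: fpeta P; mul (intc (-1)%ZZ) (fpxi P)]).
End Formulas.

(** * Naturality of the formulas under ring morphisms *)

Section Morphism.
Variables (T U : Type) (cT : Z * Z -> T) (aT mT : T -> T -> T).
Variables (cU : Z * Z -> U) (aU mU : U -> U -> U) (h : T -> U).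
Hypothesis hc : forall c, h (cT c) = cU c.
Hypothesis ha : forall x y, h (aT x y) = aU (h x) (h y).
Hypothesis hm : forall x y, h (mT x y) = mU (h x) (h y).

Lemma h_intc n : h (intc cT n) = intc cU n. Proof. exact: hc. Qed.

Lemma h_sumT s : h (sumT cT aT s) = sumT cU aU (map h s).
Proof. by elim: s => [|x s IH] /=; rewrite ?h_intc // ha IH. Qed.

Lemma h_zipT fT fU s t : (forall x y, h (fT x y) = fU (h x) (h y)) ->
  map h (zipT fT s t) = zipT fU (map h s) (map h t).
Proof.
move=> hf; rewrite /zipT; elim: s t => [|x s IH] [|y t] //=.
by rewrite hf IH.
Qed.

Lemma h_addv s t : map h (addv aT s t) = addv aU (map h s) (map h t).
Proof. exact: h_zipT. Qed.

Lemma h_sclv c s : map h (sclv mT c s) = sclv mU (h c) (map h s).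
Proof. by rewrite /sclv -!map_comp; apply: eq_map => x /=. Qed.

Lemma h_scli n s : map h (scli cT mT n s) = scli cU mU n (map h s).
Proof. by rewrite /scli h_sclv h_intc. Qed.

Lemma h_dotv s t : h (dotv cT aT mT s t) = dotv cU aU mU (map h s) (map h t).
Proof. by rewrite /dotv h_sumT (h_zipT _ _ hm). Qed.

Lemma h_nth s i : h (nth (intc cT Z0) s i) = nth (intc cU Z0) (map h s) i.
Proof. by elim: s i => [|x s IH] [|i] //=; rewrite h_intc. Qed.

Lemma h_omul x y : map h (omul cT aT mT x y) = omul cU aU mU (map h x) (map h y).
Proof.
rewrite /omul -map_comp; apply: eq_map => r /=.
rewrite /omul_coef h_sumT -map_comp; congr sumT; apply: eq_map => p /=.
by rewrite hm h_nth; case: p.2; rewrite ?hm ?h_nth ?h_intc.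
Qed.

Lemma h_ocnj x : map h (ocnj cT mT x) = ocnj cU mU (map h x).
Proof. by rewrite /ocnj map_cat h_scli map_take map_drop. Qed.

Lemma h_orow V i : map h (orow V i) = orow (map h V) i.
Proof. by rewrite /orow map_take map_drop. Qed.

Lemma h_jm2 X Y : map h (jm2 cT aT mT X Y) = jm2 cU aU mU (map h X) (map h Y).
Proof.
rewrite /jm2 !map_cat; congr (_ ++ _); last first.
  by rewrite /jm2_off !(h_addv, h_ocnj, h_omul, h_sclv, h_orow, ha, h_nth).
by rewrite /= /jm2_diag !(hm, ha, h_dotv, h_orow, h_nth, h_intc).
Qed.

Lemma h_tr3 X : h (tr3 cT aT X) = tr3 cU aU (map h X).
Proof. by rewrite /tr3 h_sumT map_take. Qed.

Lemma h_frm X Y : h (frm cT aT mT X Y) = frm cU aU mU (map h X) (map h Y).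
Proof. by rewrite /frm ha hm h_intc !h_dotv !map_take !map_drop. Qed.

Lemma h_cross2 X Y :
  map h (cross2 cT aT mT X Y) = cross2 cU aU mU (map h X) (map h Y).
Proof.
rewrite /cross2 !(h_addv, h_jm2, h_sclv, h_scli, h_tr3) /unit27 map_cat.
by rewrite !map_nseq h_intc ha !hm h_intc h_frm !h_tr3.
Qed.

Lemma h_vee12_def X W Z : map h (vee12_def cT aT mT X W Z) =
  vee12_def cU aU mU (map h X) (map h W) (map h Z).
Proof. by rewrite /vee12_def !(h_addv, h_jm2, h_sclv, h_scli, hm, h_frm, h_intc). Qed.

Lemma h_vee12 X W Z : map h (vee12 cT aT mT X W Z) =
  vee12 cU aU mU (map h X) (map h W) (map h Z).
Proof. by rewrite /vee12 !(h_addv, h_cross2, h_sclv, h_scli, hm, h_frm, h_intc). Qed.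

Lemma h_fpX P : map h (fpX P) = fpX (map h P). Proof. exact: map_take. Qed.
Lemma h_fpY P : map h (fpY P) = fpY (map h P).
Proof. by rewrite /fpY map_take map_drop. Qed.

Lemma h_fsq24 P S :
  map h (fsq24 cT aT mT P S) = fsq24 cU aU mU (map h P) (map h S).
Proof.
rewrite /fsq24 /fpxi /fpeta !map_cat /=.
by rewrite !(h_addv, h_cross2, h_vee12, h_sclv, h_scli, hm, ha, h_frm, h_intc,
  h_fpX, h_fpY, h_nth).
Qed.

Lemma h_fexp A P : map h (fexp cT aT mT A P) = fexp cU aU mU (map h A) (map h P).
Proof.
rewrite /fexp /fpxi /fpeta !map_cat /=.
by rewrite !(h_addv, h_cross2, h_sclv, ha, h_frm, h_fpX, h_fpY, h_nth).
Qed.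

Lemma h_flam P : map h (flam cT mT P) = flam cU mU (map h P).
Proof.
rewrite /flam /fpxi /fpeta !map_cat /=.
by rewrite !(h_scli, hm, h_intc, h_fpX, h_fpY, h_nth).
Qed.
End Morphism.

(** * Polynomials over the Gaussian integers *)

Definition gadd (x y : Z * Z) := (BinInt.Z.add x.1 y.1, BinInt.Z.add x.2 y.2).
Definition gopp (x : Z * Z) := (BinInt.Z.opp x.1, BinInt.Z.opp x.2).
Definition gmul (x y : Z * Z) :=
  (BinInt.Z.sub (BinInt.Z.mul x.1 y.1) (BinInt.Z.mul x.2 y.2),
   BinInt.Z.add (BinInt.Z.mul x.1 y.2) (BinInt.Z.mul x.2 y.1)).
Definition geqb (x y : Z * Z) := BinInt.Z.eqb x.1 y.1 && BinInt.Z.eqb x.2 y.2.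
Definition gzero : Z * Z := (Z0, Z0).
Definition gone : Z * Z := (Zpos xH, Z0).

(** The normal forms behind the [ring] tactic, over pairs (a, b) standing for a + b i: besides
    integers, i is the only constant in the formulas and in the weight vectors. *)
Definition gpol := Ring_polynom.Pol (Z * Z).
Definition pcst : Z * Z -> gpol := @Ring_polynom.Pc (Z * Z).
Definition pzero (p : gpol) : bool :=
  if p is Ring_polynom.Pc (Z0, Z0) then true else false.
(** Root elements and weight vectors have few nonzero coordinates, so many operands are zero; they
    are dispatched before the general algorithm. *)
Definition padd (p q : gpol) : gpol :=
  if pzero p then q else if pzero q then p else
  Ring_polynom.Padd gzero gadd geqb p q.
Definition pmul (p q : gpol) : gpol :=
  if pzero p then p else if pzero q then q else
  Ring_polynom.Pmul gzero gone gadd gmul geqb p q.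
(** Indices start at 0 here, whereas [mk_X] numbers variables from 1. *)
Definition pvar (n : nat) : gpol :=
  Ring_polynom.mk_X gzero gone (BinPos.Pos.of_succ_nat n).
Definition pvars m n := map pvar (iota m n).
Definition peq := all2 (Ring_polynom.Peq geqb).

Section Eval.
Variable K : numClosedFieldType.

Definition zval : Z -> K :=
  InitialRing.gen_phiZ 0 1 (fun x y => x + y) (fun x y => x * y) (fun x => - x).
Definition gval (c : Z * Z) : K := zval c.1 + 'i * zval c.2.

Lemma K_ring_theory : Ring_theory.ring_theory 0 1 (fun x y : K => x + y)
  (fun x y => x * y) (fun x y => x - y) (fun x => - x) eq.
Proof.
split=> //; [exact: add0r|exact: addrC|exact: addrA|exact: mul1r|exact: mulrC|
  exact: mulrA|exact: mulrDl|exact: subrr].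
Qed.

Let zmorph := InitialRing.gen_phiZ_morph (Ring_theory.Eqsth K)
  (Ring_theory.Eq_ext _ _ _) K_ring_theory.

Lemma zvalD x y : zval (BinInt.Z.add x y) = zval x + zval y.
Proof. exact: (Ring_theory.morph_add zmorph). Qed.
Lemma zvalM x y : zval (BinInt.Z.mul x y) = zval x * zval y.
Proof. exact: (Ring_theory.morph_mul zmorph). Qed.
Lemma zvalN x : zval (BinInt.Z.opp x) = - zval x.
Proof. exact: (Ring_theory.morph_opp zmorph). Qed.
Lemma zvalB x y : zval (BinInt.Z.sub x y) = zval x - zval y.
Proof. exact: (Ring_theory.morph_sub zmorph). Qed.

Lemma gmorph : Ring_theory.ring_morph 0 1 (fun x y : K => x + y)
  (fun x y => x * y) (fun x y => x - y) (fun x => - x) eq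
  gzero gone gadd gmul (fun x y => gadd x (gopp y)) gopp geqb gval.
Proof.
have gD x y : gval (gadd x y) = gval x + gval y.
  by rewrite /gval /= !zvalD; ring.
have gN x : gval (gopp x) = - gval x by rewrite /gval /= !zvalN; ring.
split=> //.
- by rewrite /gval /= mulr0 addr0.
- by rewrite /gval /= mulr0 addr0.
- by move=> x y; rewrite gD gN.
- move=> x y; rewrite /gval /= zvalB !zvalD !zvalM.
  by have := sqrCi K; move=> h; ring: h.
- case=> a b [c d] /andP[/BinInt.Z.eqb_eq /= -> /BinInt.Z.eqb_eq /= ->].
  by [].
Qed.

Definition peval (env : seq K) : gpol -> K :=
  Ring_polynom.Pphi 0 (fun x y => x + y) (fun x y => x * y) gval env.

Let ext := Ring_theory.Eq_ext (fun x y : K => x + y) (fun x y => x * y) (fun x => - x).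
Let art := Ring_theory.Rth_ARth (Ring_theory.Eqsth K) ext K_ring_theory.

Lemma peval_cst env c : peval env (pcst c) = gval c. Proof. by []. Qed.

Lemma pzeroP env p : pzero p -> peval env p = 0.
Proof.
case: p => //= -[[|?|?] [|?|?]] //= _.
exact: (Ring_theory.morph0 gmorph).
Qed.

Lemma peval_add env p q : peval env (padd p q) = peval env p + peval env q.
Proof.
rewrite /padd; case: ifP => [/pzeroP->|_]; first by rewrite add0r.
case: ifP => [/pzeroP->|_]; first by rewrite addr0.
exact: (Ring_polynom.Padd_ok (Ring_theory.Eqsth K) ext art gmorph).
Qed.

Lemma peval_mul env p q : peval env (pmul p q) = peval env p * peval env q.
Proof.
rewrite /pmul; case: ifP => [/pzeroP->|_]; first by rewrite mul0r.
case: ifP => [/pzeroP->|_]; first by rewrite mulr0.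
exact: (Ring_polynom.Pmul_ok (Ring_theory.Eqsth K) ext art gmorph).
Qed.

Lemma BinList_jumpE (p : positive) (s : seq K) :
  BinList.jump p s = drop (BinPos.Pos.to_nat p) s.
Proof.
elim/BinPos.Pos.peano_ind: p s => [|p IH] s; first by case: s => //= x s; rewrite drop0.
rewrite BinList.jump_succ IH Pnat.Pos2Nat.inj_succ /=.
by rewrite -addn1 addnC -drop_drop; case: (drop _ _) => //= ? ?; rewrite drop0.
Qed.

Lemma peval_var env n : peval env (pvar n) = nth 0 env n.
Proof.
rewrite /peval /pvar.
rewrite -(Ring_polynom.mkX_ok (Ring_theory.Eqsth K) ext art gmorph).
(* [nth_jump] speaks of the tail of a list, so [env] is read as the tail of [0 :: env]; this absorbs
   the shift in the numbering. *)
rewrite (BinList.nth_jump 0 _ (0 :: env)) BinList_jumpE Pnat.SuccNat2Pos.id_succ /=.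
by rewrite -{2}[n]addn0 -nth_drop nth0.
Qed.

Lemma peq_eval env s t : peq s t -> map (peval env) s = map (peval env) t.
Proof.
elim: s t => [|p s IH] [|q t] //= /andP[pq /IH ->]; congr (_ :: _).
exact: (Ring_polynom.Peq_ok (Ring_theory.Eqsth K) ext gmorph).
Qed.

Lemma peq1_eval env p q : Ring_polynom.Peq geqb p q -> peval env p = peval env q.
Proof. by move=> pq; apply: (Ring_polynom.Peq_ok (Ring_theory.Eqsth K) ext gmorph). Qed.

Lemma peval_vars env m n : (m + n <= size env)%N ->
  map (peval env) (pvars m n) = take n (drop m env).
Proof.
move=> le_mn; apply: (@eq_from_nth _ 0) => [|i].
  by rewrite !size_map size_iota size_takel // size_drop leq_subRL ?(leq_trans _ le_mn) ?leq_addr.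
rewrite !size_map size_iota => lt_in.
rewrite (nth_map (pcst gzero)) ?size_map ?size_iota // (nth_map 0%N) ?size_iota //.
by rewrite nth_iota // peval_var nth_take // nth_drop.
Qed.
End Eval.

(** * Coordinates *)

Section Coordinates.
Variable K : numClosedFieldType.
Local Notation o1 := (@Ordinal 3 0 isT).
Local Notation o2 := (@Ordinal 3 1 isT).
Local Notation o3 := (@Ordinal 3 2 isT).
Definition ords3 : seq 'I_3 := [:: o1; o2; o3].
Definition ords8 : seq 'I_8 :=
  [:: @Ordinal 8 0 isT; @Ordinal 8 1 isT; @Ordinal 8 2 isT; @Ordinal 8 3 isT;
      @Ordinal 8 4 isT; @Ordinal 8 5 isT; @Ordinal 8 6 isT; @Ordinal 8 7 isT].

Definition oco (x : oct K) : seq K := [seq x 0 k | k <- ords8].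
Definition jco (X : jordan K) : seq K :=
  [seq X.1 0 k | k <- ords3] ++
  (oco (row o1 X.2) ++ oco (row o2 X.2) ++ oco (row o3 X.2)).
Definition fco (P : freudenthal K) : seq K :=
  let: (X, Y, xi, eta) := P in jco X ++ (jco Y ++ [:: xi; eta]).

Local Notation gv := (@gval K).
Local Notation "+%K" := (fun x y : K => x + y).
Local Notation "*%K" := (fun x y : K => x * y).

Lemma intcE (n : Z) : intc gv n = zval K n.
Proof. by rewrite /intc /gval /= mulr0 addr0. Qed.
Lemma zval_nat (p : positive) : zval K (Zpos p) = (BinPos.Pos.to_nat p)%:R.
Proof.
elim/BinPos.Pos.peano_ind: p => [//|p IH].
by rewrite Pnat.Pos2Nat.inj_succ -BinPos.Pos.add_1_l -[Zpos _]/(BinInt.Z.add (Zpos xH) (Zpos p)) zvalD IH mulrS.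
Qed.
Lemma zval_neg (p : positive) : zval K (Zneg p) = - (BinPos.Pos.to_nat p)%:R.
Proof. by rewrite -zval_nat -zvalN. Qed.

Lemma intcN1 : intc gv (-1)%ZZ = -1.
Proof. by rewrite intcE zval_neg. Qed.

Lemma enum_ords3 : enum 'I_3 = ords3.
Proof. by apply: (inj_map val_inj); rewrite val_enum_ord. Qed.
Lemma enum_ords8 : enum 'I_8 = ords8.
Proof. by apply: (inj_map val_inj); rewrite val_enum_ord. Qed.

Lemma oco_nth (x : oct K) (i : 'I_8) : nth 0 (oco x) i = x 0 i.
Proof. by rewrite /oco -enum_ords8 (nth_map i) ?nth_ord_enum ?size_enum_ord. Qed.

Lemma size_oco (x : oct K) : size (oco x) = 8. Proof. by []. Qed.

Lemma sumT_big s : sumT gv +%K s = \sum_(x <- s) x.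
Proof.
elim: s => [|x s IH] /=; first by rewrite big_nil intcE.
by rewrite big_cons IH.
Qed.

Lemma oct_coef_range i j k : (i < 8 -> j < 8 -> k < 8 ->
  ((oct_coef i j k == 0) || (oct_coef i j k == 1) || (oct_coef i j k == -1))%R)%N.
Proof.
have /allP h : all (fun i => all (fun j => all (fun k => (oct_coef i j k == 0) ||
  (oct_coef i j k == 1) || (oct_coef i j k == -1)) (iota 0 8)) (iota 0 8)) (iota 0 8).
  by [].
move=> li lj lk.
have /h/allP h1 : i \in iota 0 8 by rewrite mem_iota.
have /h1/allP h2 : j \in iota 0 8 by rewrite mem_iota.
by apply: h2; rewrite mem_iota.
Qed.

Lemma oco_mul (x y : oct K) : oco (octmul x y) = omul gv +%K *%K (oco x) (oco y).
Proof.
apply: (@eq_from_nth _ 0) => [//|i]; rewrite size_oco => lt_i8.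
rewrite (oco_nth (octmul x y) (Ordinal lt_i8)) /omul.
have -> : oct_table = map oct_terms (iota 0 8) by [].
rewrite -map_comp (nth_map 0%N) ?size_iota // nth_iota // add0n /= mxE.
under eq_bigr do under eq_bigr do rewrite -!oco_nth.
rewrite -(big_mkord xpredT (fun a => \sum_(b < 8) (oct_coef a b i)%:~R * (oco x)`_a * (oco y)`_b)).
under eq_bigr => a _ do
  rewrite -(big_mkord xpredT (fun b => (oct_coef a b i)%:~R * (oco x)`_a * (oco y)`_b)).
rewrite /omul_coef sumT_big big_map /oct_terms big_allpairs_dep.
rewrite /index_iota; apply: eq_big_seq => a; rewrite mem_iota => /andP[_ lt_a8].
rewrite big_filter [RHS]big_mkcond; apply: eq_big_seq => b.
rewrite mem_iota /= => lt_b8 /=.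
rewrite intcN1 intcE.
have /orP[/orP[]|] := oct_coef_range lt_a8 lt_b8 lt_i8 => /eqP -> //=.
  by rewrite !mul0r.
by rewrite mul1r.
Qed.

Lemma oco_inj : injective oco.
Proof.
move=> x y exy; apply/rowP => i.
by rewrite -!oco_nth exy.
Qed.

Lemma ocoD x y : oco (x + y) = addv +%K (oco x) (oco y).
Proof. by rewrite /oco /= !mxE. Qed.
Lemma ocoZ c x : oco (c *: x) = sclv *%K c (oco x).
Proof. by rewrite /oco /= !mxE. Qed.
Lemma oco_conj x : oco (octconj x) = ocnj gv *%K (oco x).
Proof. by rewrite /oco /ocnj /= !mxE /scli /sclv /= intcN1 !mulN1r. Qed.

Lemma vars_cat (s t : seq K) n : size s = n ->
  map (peval (s ++ t)) (pvars 0 n) = s.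
Proof.
by move=> <-; rewrite peval_vars ?drop0 ?take_size_cat // size_cat leq_addr.
Qed.
Lemma vars_cat2 (r s t : seq K) m n : size r = m -> size s = n ->
  map (peval (r ++ (s ++ t))) (pvars m n) = s.
Proof.
move=> <- <-; rewrite peval_vars ?drop_size_cat ?take_size_cat //.
by rewrite !size_cat leq_add2l leq_addr.
Qed.
Lemma vars_catl (r s : seq K) m n : size r = m -> size s = n ->
  map (peval (r ++ s)) (pvars m n) = s.
Proof. by move=> er es; rewrite -[in r ++ s](cats0 s); apply: vars_cat2. Qed.

(** The pattern of the computed identities: coordinates become values of variables in an
    environment, the evaluation is pulled outside by the morphism lemmas, and two normal forms are
    compared. *)
Lemma octmul_conj (x y : oct K) :
  octmul (octconj x) (octconj y) = octconj (octmul y x).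
Proof.
apply: oco_inj; rewrite oco_mul !oco_conj oco_mul.
pose env := oco x ++ oco y.
have ex : map (peval env) (pvars 0 8) = oco x by apply: vars_cat.
have ey : map (peval env) (pvars 8 8) = oco y by apply: vars_catl.
rewrite -ex -ey.
rewrite -!(h_ocnj (peval_cst env) (peval_mul env)).
rewrite -!(h_omul (peval_cst env) (peval_add env) (peval_mul env)).
rewrite -!(h_ocnj (peval_cst env) (peval_mul env)).
by apply: peq_eval; vm_compute.
Qed.

Lemma octmul_conj0 (x y : oct K) :
  octmul x (octconj y) 0 (@Ordinal 8 0 isT) = dotv gv +%K *%K (oco x) (oco y).
Proof.
rewrite -oco_nth oco_mul oco_conj.
pose env := oco x ++ oco y.
have ex : map (peval env) (pvars 0 8) = oco x by apply: vars_cat.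
have ey : map (peval env) (pvars 8 8) = oco y by apply: vars_catl.
rewrite -ex -ey.
rewrite -!(h_ocnj (peval_cst env) (peval_mul env)).
rewrite -!(h_omul (peval_cst env) (peval_add env) (peval_mul env)).
rewrite -!(h_dotv (peval_cst env) (peval_add env) (peval_mul env)).
rewrite (nth_map (pcst gzero)) //.
Qed.

Lemma octmulZl c (x y : oct K) : octmul (c *: x) y = c *: octmul x y.
Proof.
apply/rowP => k; rewrite !mxE mulr_sumr; apply: eq_bigr => i _.
by rewrite mulr_sumr; apply: eq_bigr => j _; rewrite /= mxE; ring.
Qed.
Lemma octmulZr c (x y : oct K) : octmul x (c *: y) = c *: octmul x y.
Proof.
apply/rowP => k; rewrite !mxE mulr_sumr; apply: eq_bigr => i _.
by rewrite mulr_sumr; apply: eq_bigr => j _; rewrite /= mxE; ring.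
Qed.
Lemma octmul1l (x : oct K) : octmul (octE _ (@Ordinal 8 0 isT)) x = x.
Proof.
apply/rowP => k; rewrite !mxE (bigD1 (@Ordinal 8 0 isT)) //= [X in _ + X]big1 ?addr0; last first.
  by move=> i i0; apply: big1 => j _; rewrite mxE (negPf i0) mulr0 mul0r.
rewrite (bigD1 k) //= big1 ?addr0 => [|j jk]; first by rewrite /oct_coef /= eqxx mxE !eqxx !mul1r.
by rewrite /oct_coef /= (negPf (jk : (j : nat) != k)) !mul0r.
Qed.
(** Conjugation reverses products and fixes e_0, so this is the conjugate of the left unit law. *)
Lemma octmul1r (x : oct K) : octmul x (octE _ (@Ordinal 8 0 isT)) = x.
Proof.
have conjK (y : oct K) : octconj (octconj y) = y.
  by apply/rowP => k; rewrite !mxE; case: eqP => // _; rewrite opprK.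
rewrite -[LHS]conjK -octmul_conj.
have -> : octconj (octE _ (@Ordinal 8 0 isT)) = octE K (@Ordinal 8 0 isT).
  apply/rowP => k; rewrite !mxE eqxx /=; case: eqP => // k0.
  by rewrite (_ : (k == _) = false) ?oppr0 //; apply/eqP => ek; case: k0; rewrite ek.
by rewrite octmul1l conjK.
Qed.
Lemma octconjD (x y : oct K) : octconj (x + y) = octconj x + octconj y.
Proof. by apply/rowP => k; rewrite !mxE; case: eqP => //; rewrite opprD. Qed.
Lemma octconjK (x : oct K) : octconj (octconj x) = x.
Proof. by apply/rowP => k; rewrite !mxE; case: eqP => // _; rewrite opprK. Qed.

Lemma jordan_mxE (X : jordan K) (i j : 'I_3) : jordan_mx X i j =
  let xi k := X.1 0 k *: octE K (@Ordinal 8 0 isT) in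
  let x k := row k X.2 in
  nth 0 (nth [::]
    [:: [:: xi o1; x o3; octconj (x o2)];
        [:: octconj (x o3); xi o2; x o1];
        [:: x o2; octconj (x o1); xi o3]] i) j.
Proof. by rewrite mxE. Qed.
Lemma big3E (V : nmodType) (F : 'I_3 -> V) : \sum_(k < 3) F k = F o1 + F o2 + F o3.
Proof.
by rewrite !big_ord_recl big_ord0 addr0 addrA; congr (F _ + F _ + F _); apply: val_inj.
Qed.

Lemma octmul_conj0' (x y : oct K) :
  octmul (octconj x) y 0 (@Ordinal 8 0 isT) = dotv gv +%K *%K (oco x) (oco y).
Proof.
rewrite -{1}[y]octconjK octmul_conj0 !oco_conj /ocnj /scli intcN1 /dotv /zipT /=.
by rewrite !mulN1r !mulrNN.
Qed.

(** The bridge from matrices over the octonions to the formula [jm2]. The entries of the symmetrized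
    matrix product are written out: diagonal ones reduce to scalar products, and [octmul_conj] turns
    a product of two conjugates into the conjugate that occurs in [jm2_off]. *)
Lemma jco_mul (X Y : jordan K) :
  jm2 gv +%K *%K (jco X) (jco Y) = map (fun x => 2 * x) (jco (jmul X Y)).
Proof.
have half2 c : 2 * (2^-1 * c) = c :> K by rewrite mulVKf ?pnatr_eq0.
pose M := octmulmx (jordan_mx X) (jordan_mx Y) + octmulmx (jordan_mx Y) (jordan_mx X).
have -> : map (fun x => 2 * x) (jco (jmul X Y)) = jco (mx_jordan M).
  rewrite /jco !map_cat -!map_comp; congr (_ ++ (_ ++ (_ ++ _)));
  by apply: eq_map => k /=; rewrite !mxE half2.
have aE (u v : oct K) k : (u + v) 0 k = u 0 k + v 0 k by rewrite mxE.
have zE c (u : oct K) k : (c *: u) 0 k = c * u 0 k by rewrite mxE.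
have ME i j : M i j = \sum_k octmul (jordan_mx X i k) (jordan_mx Y k j)
   + \sum_k octmul (jordan_mx Y i k) (jordan_mx X k j) by rewrite !mxE.
have r1 V : orow (jco V) 0 = oco (row o1 V.2) by [].
have r2 V : orow (jco V) 1 = oco (row o2 V.2) by [].
have r3 V : orow (jco V) 2 = oco (row o3 V.2) by [].
have n1 V : nth (intc gv Z0) (jco V) 0 = V.1 0 o1 by [].
have n2 V : nth (intc gv Z0) (jco V) 1 = V.1 0 o2 by [].
have n3 V : nth (intc gv Z0) (jco V) 2 = V.1 0 o3 by [].
have dC x y : dotv gv +%K *%K (oco x) (oco y) = dotv gv +%K *%K (oco y) (oco x).
  by rewrite /dotv /zipT /= ![x _ _ * _]mulrC.
have e00 : octE K (@Ordinal 8 0 isT) 0 (@Ordinal 8 0 isT) = 1 by rewrite mxE !eqxx.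
rewrite {1}/jco /jm2; congr (_ ++ _).
  have -> : [seq (mx_jordan M).1 0 k | k <- ords3] =
            [seq M k k 0 (@Ordinal 8 0 isT) | k <- ords3].
    by apply: eq_map => k; rewrite mxE.
  rewrite /jm2_diag !(r1, r2, r3, n1, n2, n3) [RHS]/=.
  rewrite !ME !big3E !jordan_mxE /=.
  rewrite !(aE, octmul_conj0, octmul_conj0', octmulZl, octmulZr, octmul1l, zE, e00).
  rewrite intcE zval_nat.
  rewrite (dC (row o1 Y.2)) (dC (row o2 Y.2)) (dC (row o3 Y.2)).
  rewrite (_ : BinPos.Pos.to_nat 2 = 2%N) //.
  congr [:: _; _; _]; ring.
have [rw1 rw2 rw3] : [/\ row o1 (mx_jordan M).2 = M o2 o3,
    row o2 (mx_jordan M).2 = M o3 o1 & row o3 (mx_jordan M).2 = M o1 o2].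
  by split; apply/rowP => k; rewrite !mxE.
pose one := octE K (@Ordinal 8 0 isT).
have e1 : M o2 o3 =
    octmul (octconj (row o3 X.2)) (octconj (row o2 Y.2)) + octmul (X.1 0 o2 *: one) (row o1 Y.2)
      + octmul (row o1 X.2) (Y.1 0 o3 *: one) +
    (octmul (octconj (row o3 Y.2)) (octconj (row o2 X.2)) + octmul (Y.1 0 o2 *: one) (row o1 X.2)
      + octmul (row o1 Y.2) (X.1 0 o3 *: one)).
  by rewrite ME !big3E !jordan_mxE.
have e2 : M o3 o1 =
    octmul (row o2 X.2) (Y.1 0 o1 *: one) + octmul (octconj (row o1 X.2)) (octconj (row o3 Y.2))
      + octmul (X.1 0 o3 *: one) (row o2 Y.2) +
    (octmul (row o2 Y.2) (X.1 0 o1 *: one) + octmul (octconj (row o1 Y.2)) (octconj (row o3 X.2))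
      + octmul (Y.1 0 o3 *: one) (row o2 X.2)).
  by rewrite ME !big3E !jordan_mxE.
have e3 : M o1 o2 =
    octmul (X.1 0 o1 *: one) (row o3 Y.2) + octmul (row o3 X.2) (Y.1 0 o2 *: one)
      + octmul (octconj (row o2 X.2)) (octconj (row o1 Y.2)) +
    (octmul (Y.1 0 o1 *: one) (row o3 X.2) + octmul (row o3 Y.2) (X.1 0 o2 *: one)
      + octmul (octconj (row o2 Y.2)) (octconj (row o1 X.2))).
  by rewrite ME !big3E !jordan_mxE.
rewrite /jm2_off !(r1, r2, r3, n1, n2, n3) rw1 rw2 rw3 e1 e2 e3.
rewrite !(octmulZl, octmulZr, octmul1l, octmul1r, octmul_conj).
rewrite -!(ocoD, ocoZ, oco_mul, oco_conj).
by congr (_ ++ (_ ++ _)); congr oco; apply/rowP => k; rewrite !octconjD !(aE, zE); ring.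
Qed.
End Coordinates.

Local Notation onP f := (f _ pcst padd pmul).

(** * Jordan product, trace form and cross product in coordinates *)

Section Products.
Variable K : numClosedFieldType.
Local Notation onK f := (f _ (@gval K) (fun x y : K => x + y) (fun x y : K => x * y)).
Local Notation gv := (@gval K).
Local Notation hPK lem env :=
  (lem _ _ _ _ _ _ _ _ (peval env) (@peval_cst K env) (@peval_add K env) (@peval_mul K env)).

Lemma size_jco (X : jordan K) : size (jco X) = 27. Proof. by []. Qed.

Lemma jco0 : jco (0 : jordan K) = nseq 27 0.
Proof. by rewrite /jco /oco /= !mxE. Qed.
Lemma jcoD (X Y : jordan K) : jco (X + Y) = addv (fun x y : K => x + y) (jco X) (jco Y).
Proof. by rewrite /jco /oco /= !mxE. Qed.
Lemma jcoZ c (X : jordan K) : jco (c *: X) = sclv (fun x y : K => x * y) c (jco X).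
Proof. by rewrite /jco /oco /= !mxE. Qed.
Lemma jco_inj : injective (@jco K).
Proof.
move=> [x x'] [y y'] exy.
move/eqP: exy; rewrite /jco !eqseq_cat //.
case/andP=> /eqP e1 /and3P[/eqP/oco_inj r1 /eqP/oco_inj r2 /eqP/oco_inj r3]; congr (_, _).
  by apply/rowP => k; move/eq_in_map: e1; apply; rewrite -enum_ords3 mem_enum.
apply/row_matrixP => k; have : k \in ords3 by rewrite -enum_ords3 mem_enum.
by rewrite !inE => /or3P[] /eqP ->.
Qed.

Lemma fcoD (P Q : freudenthal K) : fco (P + Q) = addv (fun x y : K => x + y) (fco P) (fco Q).
Proof.
case: P Q => [[[X Y] xi] eta] [[[Z W] ze] om].
by rewrite -[LHS]/(jco (X + Z) ++ (jco (Y + W) ++ [:: xi + ze; eta + om])) !jcoD.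
Qed.
Lemma fcoZ c (P : freudenthal K) : fco (c *: P) = sclv (fun x y : K => x * y) c (fco P).
Proof. by case: P => [[[X Y] xi] eta]; rewrite -[LHS]/(jco (c *: X) ++ (jco (c *: Y) ++ [:: c * xi; c * eta])) !jcoZ. Qed.
Lemma fco_inj : injective (@fco K).
Proof.
move=> [[[X Y] xi] eta] [[[Z W] ze] om] /eqP.
rewrite /fco eqseq_cat // => /andP[/eqP/jco_inj-> ].
by rewrite eqseq_cat // => /andP[/eqP/jco_inj-> /eqP[-> ->]].
Qed.
Lemma size_fco (P : freudenthal K) : size (fco P) = 56.
Proof. by case: P => [[[X Y] xi] eta]. Qed.

(** The index is shifted by one: [nat_unit 1] cancels a factor 2 and [nat_unit 23] a factor 24. *)
Lemma nat_unit n : (n.+1%:R : K) != 0. Proof. by rewrite pnatr_eq0. Qed.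

Lemma zvalE : [/\ zval K 1%ZZ = 1, zval K 2%ZZ = 2, zval K 3%ZZ = 3, zval K 6%ZZ = 6 &
  [/\ zval K (-1)%ZZ = -1, zval K (-2)%ZZ = -2, zval K (-3)%ZZ = -3, zval K (-4)%ZZ = -4 &
      zval K (-6)%ZZ = -6]].
Proof. by rewrite !zval_neg !zval_nat. Qed.

Lemma intc0 : intc gv Z0 = 0. Proof. exact: intcE. Qed.

Lemma jtraceE (X : jordan K) : jtrace X = tr3 gv (fun x y : K => x + y) (jco X).
Proof. by rewrite /jtrace big3E /tr3 /= intc0 addr0 addrA. Qed.

Lemma jformE (X Y : jordan K) : jform X Y = onK frm (jco X) (jco Y).
Proof.
pose env := jco X ++ jco Y.
have ex : map (peval env) (pvars 0 27) = jco X by apply: vars_cat.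
have ey : map (peval env) (pvars 27 27) = jco Y by apply: vars_catl.
(* Doubling replaces [jmul] by the integral formula [jm2]. *)
apply: (mulfI (nat_unit 1)); rewrite /jform jtraceE.
have -> : 2 * tr3 gv (fun x y : K => x + y) (jco (jmul X Y)) =
  tr3 gv (fun x y : K => x + y) (onK jm2 (jco X) (jco Y)).
  by rewrite jco_mul /tr3 /= !intc0; ring.
have [_ <- _ _ _] := zvalE; rewrite -intcE -ex -ey.
rewrite -(hPK h_jm2 env) -(h_tr3 (peval_cst env) (peval_add env)).
rewrite -(hPK h_frm env) -(h_intc (peval_cst env)) -peval_mul.
by apply: peq1_eval; vm_compute.
Qed.

Lemma scliE n s : scli gv (fun x y : K => x * y) n s = sclv (fun x y : K => x * y) (zval K n) s.
Proof. by rewrite /scli intcE. Qed.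
Lemma jco1 c : jco (c *: jordan1 K) = unit27 gv c.
Proof. by rewrite jcoZ /unit27 intc0 /jco /oco /= !mxE /= !mulr0 !mulr1. Qed.

Lemma jm2E (X Y : jordan K) : onK jm2 (jco X) (jco Y) = jco (2 *: jmul X Y).
Proof. by rewrite jco_mul jcoZ. Qed.

Lemma jco_cross (X Y : jordan K) :
  onK cross2 (jco X) (jco Y) = jco (2 *: jcross X Y).
Proof.
rewrite /jcross scalerA mulfV ?nat_unit // scale1r.
rewrite /cross2 jm2E -!jtraceE -!jcoZ -jcoD intcN1 mulN1r -jformE -jco1 scliE.
have [_ _ _ _ [-> _ _ _ _]] := zvalE; rewrite -jcoZ -!jcoD.
congr jco; rewrite scaleN1r opprD addrA.
by congr (_ + _); rewrite [LHS]addrAC.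
Qed.

Lemma env3 (X Y Z : jordan K) c (env := jco X ++ (jco Y ++ (jco Z ++ [:: c]))) :
  [/\ map (peval env) (pvars 0 27) = jco X, map (peval env) (pvars 27 27) = jco Y,
      map (peval env) (pvars 54 27) = jco Z & peval env (pvar 81) = c].
Proof.
split; [exact: vars_cat|exact: vars_cat2|rewrite /env catA; exact: vars_cat2|].
by rewrite peval_var /env !nth_cat !size_jco.
Qed.

Lemma jmulC (X Y : jordan K) : jmul X Y = jmul Y X.
Proof. by rewrite /jmul addrC. Qed.

Lemma jmul_linear (c : K) (X Y Z : jordan K) :
  jmul (c *: X + Y) Z = c *: jmul X Z + jmul Y Z.
Proof.
apply: (scalerI (nat_unit 1)); apply: jco_inj.
rewrite scalerDr (scalerA 2 c) (mulrC 2 c) -(scalerA c 2) -jm2E [RHS]jcoD (jcoZ c) -!jm2E jcoD jcoZ.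
have [ex ey ez ec] := env3 X Y Z c.
set env := jco X ++ _ in ex ey ez ec.
rewrite -[in LHS]ec -[in RHS]ec -ex -ey -ez -!(hPK h_jm2 env).
rewrite -!(h_sclv (peval_mul env)) -!(h_addv (peval_add env)) -(hPK h_jm2 env).
by apply: peq_eval; vm_compute.
Qed.

Lemma jmulDl (X Y Z : jordan K) : jmul (X + Y) Z = jmul X Z + jmul Y Z.
Proof. by rewrite -[X]scale1r jmul_linear !scale1r. Qed.
Lemma jmulDr (X Y Z : jordan K) : jmul X (Y + Z) = jmul X Y + jmul X Z.
Proof. by rewrite !(jmulC X) jmulDl. Qed.
Lemma jmul0l (X : jordan K) : jmul 0 X = 0.
Proof. by apply: (addrI (jmul 0 X)); rewrite -jmulDl !addr0. Qed.
Lemma jmulZl c (X Y : jordan K) : jmul (c *: X) Y = c *: jmul X Y.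
Proof. by rewrite -[c *: X]addr0 jmul_linear jmul0l addr0. Qed.
Lemma jmulZr c (X Y : jordan K) : jmul X (c *: Y) = c *: jmul X Y.
Proof. by rewrite !(jmulC X) jmulZl. Qed.

Lemma jmul1l (X : jordan K) : jmul (jordan1 K) X = X.
Proof.
apply: (scalerI (nat_unit 1)); apply: jco_inj; rewrite -jm2E.
rewrite jcoZ -(scale1r (jordan1 K)) jco1 /unit27.
have [_ <- _ _ _] := zvalE; rewrite -intcE.
have [ex _ _ _] := env3 X X X 0; set env := jco X ++ _ in ex.
have <- : map (peval env) (nseq 3 (intc pcst 1%ZZ) ++ nseq 24 (intc pcst Z0)) =
    nseq 3 1 ++ nseq 24 (intc gv Z0).
  rewrite map_cat !map_nseq !(h_intc (peval_cst env)) [intc gv 1%ZZ]intcE.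
  by have [-> _ _ _ _] := zvalE.
rewrite -ex -(hPK h_jm2 env) -(h_intc (peval_cst env)) -(h_sclv (peval_mul env)).
by apply: peq_eval; vm_compute.
Qed.

Lemma jco_vee (X W Z : jordan K) :
  onK vee12 (jco X) (jco W) (jco Z) = jco (12%:R *: jvee X W Z).
Proof.
have -> : onK vee12 (jco X) (jco W) (jco Z) = onK vee12_def (jco X) (jco W) (jco Z).
  have [ex ey ez _] := env3 X W Z 0; set env := jco X ++ _ in ex ey ez.
  rewrite -ex -ey -ez -(hPK h_vee12 env) -(hPK h_vee12_def env).
  by apply: peq_eval; vm_compute.
rewrite /vee12_def !jm2E -jformE !scliE intcE.
have [_ _ -> _ [-> _ _ -> _]] := zvalE; rewrite -!jcoZ -!jcoD -!jcoZ -!jcoD.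
congr jco; rewrite /jvee.
move: (jform X W) (jmul1l Z) jmulDl jmulZl jmulZr => f.
move: (@jmul K) => m m1 mD mZl mZr; rewrite -scaleNr mD !(mZl, mZr) m1.
move: (m X (m W Z)) (m W (m X Z)) (m (m X W) Z) => a b d.
rewrite !scalerDr scalerN !scalerA addrA -scaleNr.
have -> : 3 * -1 * 2 * 2 = -12 :> K by ring.
have -> : 3 * 2 * 2 = 12 :> K by ring.
by have -> : 12 * - (3^-1 * f) = -4 * f :> K by field.
Qed.

Lemma jformC (X Y : jordan K) : jform X Y = jform Y X.
Proof. by rewrite /jform jmulC. Qed.
Lemma jtraceD (X Y : jordan K) : jtrace (X + Y) = jtrace X + jtrace Y.
Proof. by rewrite /jtrace -big_split; apply: eq_bigr => k _; rewrite mxE. Qed.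
Lemma jtraceZ c (X : jordan K) : jtrace (c *: X) = c * jtrace X.
Proof. by rewrite /jtrace mulr_sumr; apply: eq_bigr => k _; rewrite mxE. Qed.
Lemma jformDl (X Y Z : jordan K) : jform (X + Y) Z = jform X Z + jform Y Z.
Proof. by rewrite /jform jmulDl jtraceD. Qed.
Lemma jformDr (X Y Z : jordan K) : jform X (Y + Z) = jform X Y + jform X Z.
Proof. by rewrite !(jformC X) jformDl. Qed.
Lemma jformZl c (X Y : jordan K) : jform (c *: X) Y = c * jform X Y.
Proof. by rewrite /jform jmulZl jtraceZ. Qed.
Lemma jformZr c (X Y : jordan K) : jform X (c *: Y) = c * jform X Y.
Proof. by rewrite !(jformC X) jformZl. Qed.

(** Associativity of the trace form: every Jordan multiplication is self-adjoint. *)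
Lemma jform_mulA (X Y Z : jordan K) : jform (jmul X Y) Z = jform Y (jmul X Z).
Proof.
apply: (mulfI (nat_unit 1)); rewrite -jformZl -jformZr !jformE -!jm2E.
have [ex ey ez _] := env3 X Y Z 0; set env := jco X ++ _ in ex ey ez.
rewrite -ex -ey -ez -!(hPK h_jm2 env) -!(hPK h_frm env).
by apply: peq1_eval; vm_compute.
Qed.

Lemma jform_sum (X Y : jordan K) : jform X Y =
  \sum_(k < 3) X.1 0 k * Y.1 0 k + 2 * \sum_(i < 3) \sum_(k < 8) X.2 i k * Y.2 i k.
Proof.
rewrite jformE /frm /dotv /zipT !sumT_big !big_map intcE; have [_ -> _ _ _] := zvalE.
congr (_ + 2 * _); first by rewrite big3E /= !big_cons big_nil /= addr0 addrA.
have big8E (F : 'I_8 -> K) : \sum_(k < 8) F k = foldr +%R 0 (map F ords8).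
  rewrite -enum_ords8 -big_enum /=.
  by elim: (enum 'I_8) => [|k s IH]; rewrite ?big_nil ?big_cons //= IH.
by rewrite big3E !big8E /= !big_cons big_nil /= !mxE !addr0 !addrA.
Qed.

Lemma jform_nondeg (X Y : jordan K) : (forall Z, jform Z X = jform Z Y) -> X = Y.
Proof.
move=> eXY; have {eXY} h Z : jform Z (X - Y) = 0.
  by rewrite jformDr -scaleN1r jformZr mulN1r eXY subrr.
apply/eqP; rewrite -subr_eq0; apply/eqP; move: (X - Y) h => {}X h.
case: X h => x x' h; congr (_, _).
  apply/rowP => k; move: (h (delta_mx 0 k, 0)); rewrite jform_sum /=.
  have -> : \sum_i (delta_mx 0 k : 'rV[K]_3) 0 i * x 0 i = x 0 k.
    rewrite (bigD1 k) //= big1 => [|i ik]; first by rewrite mxE !eqxx mul1r addr0.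
    by rewrite mxE (negPf ik) mul0r.
  rewrite [X in _ * X]big1 => [|i _]; last by apply: big1 => j _; rewrite mxE mul0r.
  by rewrite mulr0 addr0 mxE.
apply/matrixP => i k; move: (h (0, delta_mx i k)); rewrite jform_sum /=.
rewrite big1 => [|j _]; last by rewrite mxE mul0r.
have -> : \sum_j \sum_l (delta_mx i k : 'M[K]_(3, 8)) j l * x' j l = x' i k.
  rewrite (bigD1 i) //= [X in _ + X]big1 => [|j ji]; last first.
    by apply: big1 => l _; rewrite mxE (negPf ji) mul0r.
  rewrite (bigD1 k) //= big1 => [|j jk]; first by rewrite mxE !eqxx mul1r !addr0.
  by rewrite mxE (negPf jk) andbF mul0r.
by rewrite add0r mxE => /eqP; rewrite mulf_eq0 (negPf (nat_unit 1)) /= => /eqP.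
Qed.

(** Multiplications being self-adjoint, transposition reverses the commutator of those by X and W
    and keeps the remaining multiplication, which is symmetric in X and W. *)
Lemma jvee_adj (X W U V : jordan K) : jform (jvee X W U) V = jform U (jvee W X V).
Proof.
rewrite /jvee (jmulC W X) (jformC W X); move: (jform X W) => f.
have := jmul1l; move: jmulDl jmulZl jform_mulA jformDl jformDr jformZl jformZr.
move: (@jmul K) (@jform K) => m g mD mZl gA gDl gDr gZl gZr m1.
rewrite -scaleNr !mD !mZl !m1 -!(scaleN1r (m _ _)).
rewrite !(gDl, gDr, gZl, gZr) !gA; ring.
Qed.

(** Nondegeneracy of the trace form makes a transpose unique, so exhibiting one determines the value
    chosen by [xget]. *)
Lemma jtransposeE (phi psi : jordan K -> jordan K) :
  (forall X Y, jform (phi X) Y = jform X (psi Y)) -> jtranspose phi = psi.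
Proof.
move=> h; rewrite /jtranspose; case: xgetP => [psi' _ /= h'|/(_ psi) []//].
by apply/funext => Y; apply: jform_nondeg => X; rewrite -h -h'.
Qed.

End Products.

(** * The operator P x P in coordinates *)

Section Triple.
Variable K : numClosedFieldType.
Local Notation onK f := (f _ (@gval K) (fun x y : K => x + y) (fun x y : K => x * y)).
Local Notation gv := (@gval K).

Lemma jcrossZl c (X Y : jordan K) : jcross (c *: X) Y = c *: jcross X Y.
Proof.
rewrite /jcross [RHS]scalerA (mulrC c) -[RHS]scalerA; congr (_ *: _).
rewrite jmulZl jformZl jtraceZ; move: (jmul X Y) (jform X Y) (jtrace X) (jtrace Y) (jordan1 K) => m f x y e.
rewrite !scalerDr !scalerN !scalerA.
by rewrite (mulrC 2 c) (mulrC y c) -mulrA -mulrBr.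
Qed.
Lemma jcrossC (X Y : jordan K) : jcross X Y = jcross Y X.
Proof.
rewrite /jcross jmulC jformC (mulrC (jtrace X)); congr (_ *: (_ + _)).
by rewrite addrAC.
Qed.
Lemma PhiE (phi psi : jordan K -> jordan K) A B nu X Y xi eta :
  (forall X Y, jform (phi X) Y = jform X (psi Y)) ->
  Phi phi A B nu (X, Y, xi, eta) =
  (phi X - (3^-1 * nu) *: X + 2 *: jcross B Y + eta *: A,
   2 *: jcross A X - psi Y + (3^-1 * nu) *: Y + xi *: B,
   jform A Y + nu * xi, jform B X - nu * eta).
Proof. by move=> /jtransposeE; rewrite /Phi => ->. Qed.

Section Parts.
Variables (X Y : jordan K) (xi eta : K).
Lemma fpXE : fpX (fco (X, Y, xi, eta)) = jco X. Proof. by []. Qed.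
Lemma fpYE : fpY (fco (X, Y, xi, eta)) = jco Y. Proof. by []. Qed.
Lemma fpxiE : fpxi gv (fco (X, Y, xi, eta)) = xi. Proof. by []. Qed.
Lemma fpetaE : fpeta gv (fco (X, Y, xi, eta)) = eta. Proof. by []. Qed.
End Parts.

Section Square.
Variables (X Y U V : jordan K) (xi eta s t : K).
(** [A4], [B4] and [nu4] are four times the parameters A, B and nu of P x P. *)
Let A4 := (2 * xi) *: X - 2 *: jcross Y Y.
Let B4 := 2 *: jcross X X - (2 * eta) *: Y.
Let nu4 := jform X Y - 3 * (xi * eta).

Lemma fcross_sq : fcross (X, Y, xi, eta) (X, Y, xi, eta) (U, V, s, t) =
  (- jvee X Y U - (12%:R^-1 * nu4) *: U + 4^-1 *: (2 *: jcross B4 V) + (4^-1 * t) *: A4,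
   4^-1 *: (2 *: jcross A4 U) + jvee Y X V + (12%:R^-1 * nu4) *: V + (4^-1 * s) *: B4,
   4^-1 * (jform A4 V + nu4 * s), 4^-1 * (jform B4 U - nu4 * t)).
Proof.
have half2 (Z : jordan K) : 2^-1 *: (Z + Z) = Z.
  have -> : Z + Z = 2 *: Z by rewrite scaler_nat mulr2n.
  by rewrite scalerA mulVf ?nat_unit // scale1r.
have adj (f1 f2 : jordan K -> jordan K) c : (forall Z W, jform (f1 Z) W = jform Z (f2 W)) ->
    forall Z W, jform (c *: (f1 Z + f1 Z)) W = jform Z (c *: (f2 W + f2 W)).
  by move=> h Z W; rewrite jformZl jformZr jformDl jformDr !h.
have two c (Z : jordan K) : (2 * c) *: Z = c *: Z + c *: Z by rewrite mulr_natl mulr2n scalerDl.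
have eA : - 4^-1 *: (2 *: jcross Y Y - xi *: X - xi *: X) = 4^-1 *: A4.
  rewrite /A4; move: (jcross Y Y) => a.
  rewrite scaleNr -(scalerN 4^-1); congr (_ *: _).
  by rewrite two !opprD !opprK -addrA addrC.
have eB : 4^-1 *: (2 *: jcross X X - eta *: Y - eta *: Y) = 4^-1 *: B4.
  rewrite /B4; move: (jcross X X) => a; congr (_ *: _).
  by rewrite two !opprD addrA.
have en : 8^-1 * (jform X Y + jform X Y - 3 * (xi * eta + xi * eta)) = 4^-1 * nu4.
  by rewrite /nu4; field.
rewrite -[fcross _ _]/(Phi (fun V => - 2^-1 *: (jvee X Y V + jvee X Y V))
   (- 4^-1 *: (2 *: jcross Y Y - xi *: X - xi *: X))
   (4^-1 *: (2 *: jcross X X - eta *: Y - eta *: Y))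
   (8^-1 * (jform X Y + jform X Y - 3 * (xi * eta + xi * eta)))).
rewrite eA eB en (@PhiE _ (fun V => - 2^-1 *: (jvee Y X V + jvee Y X V))); last first.
  by apply: adj => Z W; apply: jvee_adj.
rewrite (jcrossZl 4^-1 B4 V) (jcrossZl 4^-1 A4 U) (jformZl 4^-1 A4 V) (jformZl 4^-1 B4 U).
have -> : 3^-1 * (4^-1 * nu4) = 12%:R^-1 * nu4 by field.
clear eA eB en; clearbody A4 B4 nu4.
move: (jvee X Y U) (jvee Y X V) (jcross B4 V) (jcross A4 U) => a b c d.
rewrite !scaleNr !half2 opprK !scalerA (mulrC 2 4^-1) (mulrC t) (mulrC s).
by rewrite (mulrDr 4^-1 (jform A4 V)) (mulrBr 4^-1 (jform B4 U)) !(mulrA 4^-1 nu4).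
Qed.
End Square.

Lemma fco_fcross (P S : freudenthal K) :
  onK fsq24 (fco P) (fco S) = fco (24%:R *: fcross P P S).
Proof.
case: P S => [[[X Y] xi] eta] [[[U V] s] t].
rewrite fcross_sq /fsq24 !(fpXE, fpYE, fpxiE, fpetaE).
set A4 := (2 * xi) *: X - 2 *: jcross Y Y; set B4 := 2 *: jcross X X - (2 * eta) *: Y.
set nu4 := jform X Y - _.
have [e1 e2 e3 e6 [em1 em2 em3 _ _]] := zvalE K.
rewrite !intcE !jco_cross !scliE !(e2, e3, e6, em1, em2, em3).
have -> : addv (fun x y : K => x + y) (sclv (fun x y : K => x * y) (-1) (jco (2 *: jcross Y Y)))
   (sclv (fun x y : K => x * y) (2 * xi) (jco X)) = jco A4.
  by rewrite -!jcoZ -jcoD /A4 scaleN1r addrC.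
have -> : addv (fun x y : K => x + y) (jco (2 *: jcross X X))
   (sclv (fun x y : K => x * y) (-2 * eta) (jco Y)) = jco B4.
  by rewrite -!jcoZ -jcoD /B4 mulNr scaleNr.
rewrite -!jformE -/nu4.
have -> : jform X Y + -3 * (xi * eta) = nu4 by rewrite /nu4 mulNr.
rewrite !jco_vee !jco_cross; clearbody A4 B4 nu4.
move: (jvee X Y U) (jvee Y X V) (jcross B4 V) (jcross A4 U) (jform A4 V) (jform B4 U).
move=> a b c d f g; rewrite -!jcoZ -!jcoD -!jcoZ -!jcoD.
have q12 : 24%:R * 12%:R^-1 = 2 :> K by field.
have q4 : 24%:R * 4^-1 = 6 :> K by field.
have p12 : 2 * 12%:R = 24%:R :> K by ring.
have -> : -2 *: (12%:R *: a + nu4 *: U) + 6 *: (2 *: c + t *: A4) =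
   24%:R *: (- a - (12%:R^-1 * nu4) *: U + 4^-1 *: (2 *: c) + (4^-1 * t) *: A4).
  rewrite scaleNr !(scalerDr, scalerN, scalerA) !mulrA q12 q4 p12 opprD.
  by rewrite addrA.
have -> : 2 *: (12%:R *: b + nu4 *: V) + 6 *: (2 *: d + s *: B4) =
   24%:R *: (4^-1 *: (2 *: d) + b + (12%:R^-1 * nu4) *: V + (4^-1 * s) *: B4).
  rewrite !(scalerDr, scalerA) !mulrA q12 q4 p12.
  by rewrite addrA [X in X + _ = _]addrC addrA.
rewrite -[RHS]/(jco (24%:R *: _) ++ (jco (24%:R *: _) ++ [:: 24%:R * _; 24%:R * _])).
by rewrite !mulN1r !mulrA q4.
Qed.
End Triple.

(** * Symmetry and additivity of the Freudenthal product *)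

Section Group.
Variable K : numClosedFieldType.
Local Notation hPK lem env :=
  (lem _ _ _ _ _ _ _ _ (peval env) (@peval_cst K env) (@peval_add K env) (@peval_mul K env)).

Lemma env4 (X Y Z W : jordan K) (env := jco X ++ (jco Y ++ (jco Z ++ jco W))) :
  [/\ map (peval env) (pvars 0 27) = jco X, map (peval env) (pvars 27 27) = jco Y,
      map (peval env) (pvars 54 27) = jco Z & map (peval env) (pvars 81 27) = jco W].
Proof.
split; [exact: vars_cat|exact: vars_cat2|rewrite /env catA; exact: vars_cat2|].
rewrite /env (catA (jco X)) (catA (jco X ++ jco Y)); exact: vars_catl.
Qed.

Lemma jcrossDl (X Y Z : jordan K) : jcross (X + Y) Z = jcross X Z + jcross Y Z.
Proof.
move: (@jcross K) (@jco_cross K) => c hc.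
apply: (scalerI (nat_unit K 1)); apply: jco_inj.
rewrite scalerDr -hc [RHS]jcoD -!hc jcoD.
have [ex ey ez _] := env4 X Y Z 0; set env := jco X ++ _ in ex ey ez.
rewrite -ex -ey -ez -!(hPK h_cross2 env) -!(h_addv (peval_add env)) -(hPK h_cross2 env).
by apply: peq_eval; vm_compute.
Qed.

Lemma jveeDl (X Y W U : jordan K) : jvee (X + Y) W U = jvee X W U + jvee Y W U.
Proof.
move: (@jvee K) (@jco_vee K) => v hv.
apply: (scalerI (nat_unit K 11)); apply: jco_inj.
rewrite scalerDr -hv [RHS]jcoD -!hv jcoD.
have [ex ey ez ew] := env4 X Y W U; set env := jco X ++ _ in ex ey ez ew.
rewrite -ex -ey -ez -ew -!(hPK h_vee12 env) -!(h_addv (peval_add env)) -(hPK h_vee12 env).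
by apply: peq_eval; vm_compute.
Qed.

Lemma jveeDm (X Y W U : jordan K) : jvee W (X + Y) U = jvee W X U + jvee W Y U.
Proof.
move: (@jvee K) (@jco_vee K) => v hv.
apply: (scalerI (nat_unit K 11)); apply: jco_inj.
rewrite scalerDr -hv [RHS]jcoD -!hv jcoD.
have [ex ey ez ew] := env4 X Y W U; set env := jco X ++ _ in ex ey ez ew.
rewrite -ex -ey -ez -ew -!(hPK h_vee12 env) -!(h_addv (peval_add env)) -(hPK h_vee12 env).
by apply: peq_eval; vm_compute.
Qed.

Lemma fcrossE (X Y Z W U V : jordan K) (xi eta ze om s t : K) :
  fcross (X, Y, xi, eta) (Z, W, ze, om) (U, V, s, t) =
  let A := - 4^-1 *: (2 *: jcross Y W - xi *: Z - ze *: X) in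
  let B := 4^-1 *: (2 *: jcross X Z - eta *: W - om *: Y) in
  let nu := 8^-1 * (jform X W + jform Z Y - 3 * (xi * om + ze * eta)) in
  (- 2^-1 *: (jvee X W U + jvee Z Y U) - (3^-1 * nu) *: U + 2 *: jcross B V + t *: A,
   2 *: jcross A U - - 2^-1 *: (jvee W X V + jvee Y Z V) + (3^-1 * nu) *: V + s *: B,
   jform A V + nu * s, jform B U - nu * t).
Proof.
rewrite -[fcross _ _]/(Phi (fun V => - 2^-1 *: (jvee X W V + jvee Z Y V))
   (- 4^-1 *: (2 *: jcross Y W - xi *: Z - ze *: X))
   (4^-1 *: (2 *: jcross X Z - eta *: W - om *: Y))
   (8^-1 * (jform X W + jform Z Y - 3 * (xi * om + ze * eta)))).
rewrite (@PhiE _ _ (fun V => - 2^-1 *: (jvee W X V + jvee Y Z V))) //.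
have adj (f1 f2 g1 g2 : jordan K -> jordan K) c :
    (forall Z W, jform (f1 Z) W = jform Z (f2 W)) ->
    (forall Z W, jform (g1 Z) W = jform Z (g2 W)) ->
    forall Z W, jform (c *: (f1 Z + g1 Z)) W = jform Z (c *: (f2 W + g2 W)).
  by move=> hf hg A B; rewrite jformZl jformZr jformDl jformDr hf hg.
by apply: adj => A B; apply: jvee_adj.
Qed.

Lemma fcrossC (P Q : freudenthal K) : fcross P Q = fcross Q P.
Proof.
case: P Q => [[[X Y] xi] eta] [[[Z W] ze] om].
rewrite -[fcross (X, _, _, _) _]/(Phi (fun V => - 2^-1 *: (jvee X W V + jvee Z Y V))
   (- 4^-1 *: (2 *: jcross Y W - xi *: Z - ze *: X))
   (4^-1 *: (2 *: jcross X Z - eta *: W - om *: Y))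
   (8^-1 * (jform X W + jform Z Y - 3 * (xi * om + ze * eta)))).
rewrite -[fcross (Z, _, _, _) _]/(Phi (fun V => - 2^-1 *: (jvee Z Y V + jvee X W V))
   (- 4^-1 *: (2 *: jcross W Y - ze *: X - xi *: Z))
   (4^-1 *: (2 *: jcross Z X - om *: Y - eta *: W))
   (8^-1 * (jform Z Y + jform X W - 3 * (ze * eta + xi * om)))).
move: (@Phi K) (@jcross K) (@jcrossC K) (@jform K) (@jvee K) => F c cC f v.
rewrite [f X W + _]addrC [xi * om + _]addrC (cC W) (cC Z).
rewrite -(addrA (2 *: c Y W)) [- (xi *: Z) + _]addrC addrA.
rewrite -(addrA (2 *: c X Z)) [- (eta *: W) + _]addrC addrA.
by congr (F _ _ _ _); apply/funext => V; rewrite [v X W V + _]addrC.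
Qed.

Lemma fcrossDl (P P' Q S : freudenthal K) :
  fcross (P + P') Q S = fcross P Q S + fcross P' Q S.
Proof.
case: P P' Q S => [[[X Y] xi] eta] [[[X' Y'] xi'] eta'] [[[Z W] ze] om] [[[U V] s] t].
rewrite -[_ + (X', _, _, _)]/(X + X', Y + Y', (xi + xi' : K), (eta + eta' : K)).
rewrite !fcrossE /=.
set A := - 4^-1 *: (2 *: jcross Y W - _ - _); set A' := - 4^-1 *: (2 *: jcross Y' W - _ - _).
set B := 4^-1 *: (2 *: jcross X Z - _ - _); set B' := 4^-1 *: (2 *: jcross X' Z - _ - _).
set nu := 8^-1 * (jform X W + _ - _); set nu' := 8^-1 * (jform X' W + _ - _).
have -> : - 4^-1 *: (2 *: jcross (Y + Y') W - (xi + xi') *: Z - ze *: (X + X')) = A + A'.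
  rewrite /A /A' jcrossDl; move: (jcross Y W) (jcross Y' W) => a a'.
  by rewrite -scalerDr (scalerDr 2) (scalerDl Z) (scalerDr ze) !opprD (addrACA (2 *: a)) (addrACA (2 *: a - _)).
have -> : 4^-1 *: (2 *: jcross (X + X') Z - (eta + eta') *: W - om *: (Y + Y')) = B + B'.
  rewrite /B /B' jcrossDl; move: (jcross X Z) (jcross X' Z) => a a'.
  by rewrite -scalerDr (scalerDr 2) (scalerDl W) (scalerDr om) !opprD (addrACA (2 *: a)) (addrACA (2 *: a - _)).
have -> : 8^-1 * (jform (X + X') W + jform Z (Y + Y') - 3 * ((xi + xi') * om + ze * (eta + eta'))) = nu + nu'.
  rewrite /nu /nu' jformDl jformDr.
  by move: (jform X W) (jform X' W) (jform Z Y) (jform Z Y') => f f' g g'; ring.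
clearbody A A' B B' nu nu'.
rewrite !jveeDl !jveeDm !jcrossDl !jformDl.
move: (jvee X W U) (jvee X' W U) (jvee Z Y U) (jvee Z Y' U) => a a' b b'.
move: (jvee W X V) (jvee W X' V) (jvee Y Z V) (jvee Y' Z V) => c c' d d'.
move: (jcross A U) (jcross A' U) (jcross B V) (jcross B' V) => e e' f f'.
rewrite !scalerDr !mulrDr !mulrDl (scalerDl U) (scalerDl V).
have s5 (p p' q q' r r' u u' v v' : jordan K) :
    p + p' + (q + q') - (r + r') + (u + u') + (v + v') =
    p + q - r + u + v + (p' + q' - r' + u' + v').
  by rewrite opprD (addrACA p) (addrACA (p + q)) (addrACA (p + q - r)) (addrACA _ (p' + q' - r' + u')).
have s4 (p p' q q' r r' u u' v v' : jordan K) :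
    u + u' - (p + p' + (q + q')) + (r + r') + (v + v') =
    u - (p + q) + r + v + (u' - (p' + q') + r' + v').
  by rewrite (addrACA p) opprD (addrACA u) (addrACA (u - _)) (addrACA _ (u' - (p' + q') + r')).
move: (jform A V) (jform A' V) (jform B U) (jform B' U) => g g' h h'.
rewrite (s5 (- 2^-1 *: a)) (s4 (- 2^-1 *: c)) (addrACA g) (opprD (nu * t)) (addrACA h).
by [].
Qed.
End Group.

(** * One-parameter subgroups *)

Section Elements.
Variable K : numClosedFieldType.
Local Notation onK f := (f _ (@gval K) (fun x y : K => x + y) (fun x y : K => x * y)).
Local Notation gv := (@gval K).
Local Notation hPK lem env :=
  (lem _ _ _ _ _ _ _ _ (peval env) (@peval_cst K env) (@peval_add K env) (@peval_mul K env)).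

Section Linear.
Variables (U V : lmodType K) (f : U -> V).
Hypothesis lin_f : linear f.
Lemma lfD x y : f (x + y) = f x + f y.
Proof. by have := lin_f 1 x y; rewrite !scale1r. Qed.
Lemma lf0 : f 0 = 0.
Proof. by apply: (addrI (f 0)); rewrite -lfD !addr0. Qed.
Lemma lfZ c x : f (c *: x) = c *: f x.
Proof. by have := lin_f c x 0; rewrite lf0 !addr0. Qed.
Lemma lfN x : f (- x) = - f x.
Proof. by rewrite -scaleN1r lfZ scaleN1r. Qed.
End Linear.

(** Cancellation in a polarized square: x and y are the pure terms, a and b the two candidates for
    the mixed term, which occurs twice. *)
Lemma addr_double_inj (V : lmodType K) (x y a b : V) :
  x + a + (a + y) = x + b + (b + y) -> a = b.
Proof.
rewrite -!addrA => /addrI; rewrite !addrA => /addIr.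
by move=> e; apply: (scalerI (nat_unit K 1)); rewrite (scaler_nat 2 a) (scaler_nat 2 b) (mulr2n a) (mulr2n b).
Qed.

(** Expanding (P + Q) x (P + Q) isolates twice P x Q, and 2 is invertible. This reduces membership
    to an identity in two vectors P and S. *)
Lemma E7_intro (alpha beta : freudenthal K -> freudenthal K) :
  linear alpha -> cancel alpha beta -> cancel beta alpha ->
  (forall P S, alpha (fcross P P S) = fcross (alpha P) (alpha P) (alpha S)) ->
  E7 alpha.
Proof.
move=> lin_a ab ba sq; split=> //; exists beta; split=> // P Q.
have aD x y : alpha (x + y) = alpha x + alpha y.
  by have := lin_a 1 x y; rewrite !scale1r.
have fC := @fcrossC K; have fDl := @fcrossDl K.
apply/funext => S; rewrite /= -[in RHS](ba S); move: (beta S) => {ba ab}S.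
move: (@fcross K) sq fC fDl => f sq fC fDl.
have fDr P1 Q1 Q2 T : f P1 (Q1 + Q2) T = f P1 Q1 T + f P1 Q2 T by rewrite !(fC P1) fDl.
have := sq (P + Q) S; have := sq P S; have := sq Q S.
rewrite aD !fDl !fDr (fC Q P) (fC (alpha Q)) !aD => -> ->.
exact: addr_double_inj.
Qed.

Definition expA (A : jordan K) (P : freudenthal K) : freudenthal K :=
  let: (X, Y, xi, eta) := P in
  (X + eta *: A, Y + 2 *: jcross A X, xi + jform A Y, eta).
(** An element of the group with square -1. Conjugation by it turns Phi(0, A, 0, 0) into Phi(0, 0,
    -A, 0), so it supplies the opposite root vectors. *)
Definition flip (P : freudenthal K) : freudenthal K :=
  let: (X, Y, xi, eta) := P in (Y, - X, eta, - xi).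

Lemma fco_expA A P : fco (expA A P) = onK fexp (jco A) (fco P).
Proof.
case: P => [[[X Y] xi] eta].
rewrite /fexp !(fpXE, fpYE, fpxiE, fpetaE) jco_cross -jformE -jcoZ -!jcoD.
by [].
Qed.

Lemma fco_flip P : fco (flip P) = flam gv (fun x y : K => x * y) (fco P).
Proof.
case: P => [[[X Y] xi] eta].
rewrite /flam !(fpXE, fpYE, fpxiE, fpetaE) intcN1 /scli intcN1 -jcoZ scaleN1r mulN1r.
by [].
Qed.

Lemma env56 (P S : freudenthal K) t (env := fco P ++ (fco S ++ [:: t])) :
  [/\ map (peval env) (pvars 0 56) = fco P, map (peval env) (pvars 56 56) = fco S &
      peval env (pvar 112) = t].
Proof.
split; [exact: vars_cat (size_fco P)|exact: vars_cat2 (size_fco P) (size_fco S)|].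
by rewrite peval_var /env !nth_cat !size_fco.
Qed.

Lemma fcross_flip P S : flip (fcross P P S) = fcross (flip P) (flip P) (flip S).
Proof.
have flipZ c Q : flip (c *: Q) = c *: flip Q.
  by case: Q => [[[X Y] xi] eta]; rewrite -[RHS]/(c *: Y, c *: - X, c * eta, c * - xi) scalerN mulrN.
apply: (scalerI (nat_unit K 23)); rewrite -flipZ; apply: fco_inj.
rewrite -fco_fcross !fco_flip -fco_fcross.
have [eP eS _] := env56 P S 0; set env := fco P ++ _ in eP eS.
rewrite -eP -eS -!(h_flam (peval_cst env) (peval_mul env)) -!(hPK h_fsq24 env).
rewrite -!(h_flam (peval_cst env) (peval_mul env)).
by apply: peq_eval; vm_compute.
Qed.

Lemma expA_linear A : linear (expA A).
Proof.
move=> c [[[X Y] xi] eta] [[[Z W] ze] om].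
have e1 (x z a : jordan K) (e o : K) :
    c *: x + z + (c * e + o) *: a = c *: (x + e *: a) + (z + o *: a).
  by rewrite scalerDl -scalerA scalerDr addrACA.
have e2 (x z y w : jordan K) : c *: x + z + 2 *: (c *: y + w) = c *: (x + 2 *: y) + (z + 2 *: w).
  by rewrite !scalerDr !(scalerA 2) (mulrC 2) -!(scalerA c 2) addrACA.
have e3 (x z f g : K) : c * x + z + (c * f + g) = c * (x + f) + (z + g) by ring.
rewrite -[c *: _ + _]/(c *: X + Z, c *: Y + W, (c * xi + ze : K), (c * eta + om : K)) /expA.
rewrite (jcrossC A (c *: X + Z)) jcrossDl (jcrossZl c X) (jcrossC X) (jcrossC Z).
by rewrite jformDr jformZr e1 e2 e3.
Qed.

Lemma flip_linear : linear flip.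
Proof.
move=> c [[[X Y] xi] eta] [[[Z W] ze] om].
rewrite -[c *: _ + _]/(c *: X + Z, c *: Y + W, (c * xi + ze : K), (c * eta + om : K)) /flip.
by rewrite !opprD -mulrN -scalerN.
Qed.

Lemma flipK P : flip (flip P) = - P.
Proof. by case: P => [[[X Y] xi] eta]. Qed.

Lemma jform_crossA (X Y Z : jordan K) : jform X (jcross Y Z) = jform (jcross X Y) Z.
Proof.
move: (@jcross K) (@jco_cross K) => c hc.
apply: (mulfI (nat_unit K 1)); rewrite -[LHS]jformZr -[RHS]jformZl !jformE -!hc.
have [ex ey ez _] := env3 X Y Z 0; set env := jco X ++ _ in ex ey ez.
rewrite -ex -ey -ez -!(hPK h_cross2 env) -!(hPK h_frm env).
by apply: peq1_eval; vm_compute.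
Qed.

(** All second-order terms contain A x A: directly in A x (eta A), and through (A, A x X) = (A x A,
    X). *)
Lemma expA_add A s t P : jcross A A = 0 ->
  expA (s *: A) (expA (t *: A) P) = expA ((s + t) *: A) P.
Proof.
move=> AA0; case: P => [[[X Y] xi] eta] /=.
have AX : jform A (jcross A X) = 0.
  by rewrite jform_crossA AA0 -(scale0r A) jformZl mul0r.
have c1 : jcross A (X + eta *: (t *: A)) = jcross A X.
  by rewrite jcrossC jcrossDl (jcrossZl eta) (jcrossZl t) AA0 !scaler0 addr0 jcrossC.
have f1 : jform A (Y + 2 *: (t *: jcross A X)) = jform A Y.
  by rewrite jformDr (jformZr 2) (jformZr t) AX !mulr0 addr0.
rewrite !jcrossZl c1 (jformZl t) (jformZl s) (jformZl (s + t)) f1; move: (jcross A X) (jform A Y) => c f.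
have e (x a : jordan K) (u : K) :
    x + u *: (t *: a) + u *: (s *: a) = x + u *: ((s + t) *: a).
  by rewrite (addrC s) scalerDl (scalerDr u) addrA.
have e3 (x : K) : x + t * f + s * f = x + (s + t) * f by ring.
by rewrite (e X A) (e Y c) e3.
Qed.

Definition exp_check (A : seq gpol) := peq
  (onP fexp A (onP fsq24 (pvars 0 56) (pvars 56 56)))
  (onP fsq24 (onP fexp A (pvars 0 56)) (onP fexp A (pvars 56 56))).

Lemma fcross_expA (p : seq gpol) t A P S : exp_check p ->
  map (peval (fco P ++ (fco S ++ [:: t]))) p = jco A ->
  expA A (fcross P P S) = fcross (expA A P) (expA A P) (expA A S).
Proof.
move=> chk; have [eP eS _] := env56 P S t; set env := fco P ++ _ in eP eS * => eA.
apply: (scalerI (nat_unit K 23)); rewrite -(lfZ (expA_linear A)); apply: fco_inj.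
rewrite -fco_fcross !fco_expA -fco_fcross -eP -eS -eA.
rewrite -!(hPK h_fexp env) -!(hPK h_fsq24 env) -!(hPK h_fexp env).
exact: peq_eval.
Qed.
Definition e1F (c : K) : jordan K :=
  jordanF1 (octE K (@Ordinal 8 0 isT) + c *: octE K (@Ordinal 8 1 isT)).

Definition gcoef (s : seq (nat * (Z * Z))) (k : nat) : Z * Z :=
  if [seq q.2 | q <- s & q.1 == k] is c :: _ then c else gzero.
(** Variable 112 is the parameter t: it follows the 112 coordinates of P and S in the
    environment. *)
Definition pvec (s : seq (nat * (Z * Z))) : seq gpol :=
  [seq pmul (pcst (gcoef s k)) (pvar 112) | k <- iota 0 27].

Lemma peval_pvec P S t s :
  map (peval (fco P ++ (fco S ++ [:: t]))) (pvec s) =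
  sclv (fun x y : K => x * y) t [seq gval K (gcoef s k) | k <- iota 0 27].
Proof.
have [_ _ et] := env56 P S t; rewrite /pvec /sclv -!map_comp; apply: eq_map => k.
by rewrite /comp peval_mul et mulrC.
Qed.

Lemma jco_E k : jco (jordanE K k) = [seq gval K (gcoef [:: (k : nat, gone)] j) | j <- iota 0 27].
Proof.
have g0 : gval K gzero = 0 by exact: intc0.
have g1 : gval K gone = 1 by rewrite -[LHS]/(intc gv 1%ZZ) intcE.
rewrite /jco /oco /= !mxE /=.
by case: k => [[|[|[|k]]] lk] //=; rewrite g0 g1.
Qed.

Lemma jco_e1F c : jco (e1F (gval K c)) = [seq gval K (gcoef [:: (3%N, gone); (4%N, c)] j) | j <- iota 0 27].
Proof.
have g0 : gval K gzero = 0 by exact: intc0.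
have g1 : gval K gone = 1 by rewrite -[LHS]/(intc gv 1%ZZ) intcE.
rewrite /jco /oco /= !mxE /=.
rewrite ?mulr0 ?mulr1 ?addr0 ?add0r g0 g1.
by [].
Qed.

(** E_k, F_1(e_0) and F_1(e_1) are killed by so(6) and fixed by [sigma'4]. The last two are replaced
    by F_1(e_0 + i e_1) and F_1(e_0 - i e_1), whose octonion entries are isotropic, so that A x A =
    0. *)
Inductive root_elt : jordan K -> Prop :=
  | root_E k : root_elt (jordanE K k)
  | root_Fi : root_elt (e1F 'i)
  | root_FNi : root_elt (e1F (- 'i)).

Lemma gval_i : gval K (Z0, 1%ZZ) = 'i.
Proof. by rewrite -[LHS]/(0 + 'i * 1) add0r mulr1. Qed.
Lemma gval_Ni : gval K (Z0, (-1)%ZZ) = - 'i.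
Proof. by rewrite -[LHS]/(0 + 'i * (-1)) add0r mulrN1. Qed.

Definition sq_check (s : seq (Z * Z)) :=
  peq (onP cross2 (map pcst s) (map pcst s)) (nseq 27 (pcst gzero)).

Lemma root_eltP A : root_elt A -> exists2 s,
    exp_check (pvec s) && sq_check [seq gcoef s k | k <- iota 0 27] &
  jco A = [seq gval K (gcoef s k) | k <- iota 0 27].
Proof.
case=> [k||].
- exists [:: (k : nat, gone)]; last exact: jco_E.
  by case: k => [[|[|[|k]]] lk]; [vm_compute|vm_compute|vm_compute|].
- by rewrite -gval_i; exists [:: (3%N, gone); (4%N, (Z0, 1%ZZ))]; [vm_compute|exact: jco_e1F].
- by rewrite -gval_Ni; exists [:: (3%N, gone); (4%N, (Z0, (-1)%ZZ))]; [vm_compute|exact: jco_e1F].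
Qed.

Lemma root_sq A : root_elt A -> jcross A A = 0.
Proof.
move=> rA; apply: (scalerI (nat_unit K 1)); rewrite scaler0; apply: jco_inj.
rewrite -jco_cross jco0.
have [s /andP[_ chk] ->] := root_eltP rA.
rewrite (map_comp gv) -(eq_map (peval_cst (K := K) [::])) (map_comp (peval _)).
rewrite -(hPK h_cross2 [::]) (peq_eval _ chk) map_nseq; congr nseq; exact: intc0.
Qed.

Lemma fcross_root A t P S : root_elt A ->
  expA (t *: A) (fcross P P S) =
  fcross (expA (t *: A) P) (expA (t *: A) P) (expA (t *: A) S).
Proof.
case/root_eltP=> s /andP[chk _] eA; apply: (fcross_expA (t := t) chk).
by rewrite peval_pvec jcoZ eA.
Qed.
End Elements.

(** * Exponentials commute with so(6) *)

Section Membership.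
Variable K : numClosedFieldType.
Local Notation onK f := (f _ (@gval K) (fun x y : K => x + y) (fun x y : K => x * y)).
Local Notation gv := (@gval K).
Local Notation hPK lem env :=
  (lem _ _ _ _ _ _ _ _ (peval env) (@peval_cst K env) (@peval_add K env) (@peval_mul K env)).

Lemma map_gval env (s : seq (Z * Z)) : map gv s = map (peval env) (map pcst s).
Proof. by rewrite -map_comp. Qed.

Lemma expA0 (A : jordan K) P : expA (0 *: A) P = P.
Proof.
case: P => [[[X Y] xi] eta].
by rewrite /expA jcrossZl jformZl !scale0r !scaler0 mul0r !addr0.
Qed.

Lemma expAK (A : jordan K) t : root_elt A -> cancel (expA (t *: A)) (expA (- t *: A)).
Proof. by move=> /root_sq sqA P; rewrite expA_add // addNr expA0. Qed.

Lemma E7_expA (A : jordan K) t : root_elt A -> E7 (expA (t *: A)).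
Proof.
move=> rA; apply: (@E7_intro _ _ (expA (- t *: A))).
- exact: expA_linear.
- exact: expAK.
- by move=> P; rewrite -{1}[t]opprK expAK.
- by move=> P S; apply: fcross_root.
Qed.

Definition unflip (P : freudenthal K) : freudenthal K := - flip P.
Lemma flipK' : cancel (@flip K) unflip.
Proof. by move=> P; rewrite /unflip flipK opprK. Qed.
Lemma unflipK : cancel unflip (@flip K).
Proof. by move=> P; rewrite /unflip -scaleN1r (lfZ (@flip_linear K)) flipK scaleN1r opprK. Qed.

Lemma E7_flip : E7 (@flip K).
Proof.
apply: (@E7_intro _ _ unflip); [exact: flip_linear|exact: flipK'|exact: unflipK|].
exact: fcross_flip.
Qed.

(** A Peirce identity for the idempotent E_k. For a derivation D that kills E_k, comparing D of this
    identity with the identity at D X shows that D X has zero diagonal. *)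
Lemma peirce_diag (k : 'I_3) (X : jordan K) :
  jmul (jordanE K k) (2 *: jmul (jordanE K k) X) =
  jmul (jordanE K k) X + X.1 0 k *: jordanE K k.
Proof.
pose e : seq (Z * Z) := [seq gcoef [:: (k : nat, gone)] j | j <- iota 0 27].
have ee : jco (jordanE K k) = map gv e by rewrite jco_E -map_comp.
have ek : X.1 0 k = nth 0 (jco X) k by case: k {e ee} => [[|[|[|k]]] lk] //=; congr (X.1 0 _); apply: val_inj.
apply: (scalerI (nat_unit K 1)); apply: jco_inj.
have hm := @jm2E K; move: (@jmul K) hm => m hm.
rewrite scalerDr jcoD -!hm (scalerA 2) jcoZ ee ek.
have [ex _ _ _] := env3 X X X 0; set env := jco X ++ _ in ex.
have [_ <- _ _ _] := zvalE K.
rewrite -intcE -ex (map_gval env) -!(hPK h_jm2 env) -(h_intc (peval_cst env)).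
rewrite -[0](intc0 K) -(h_nth (peval_cst env)) -(peval_mul env) -(h_sclv (peval_mul env)).
rewrite -(h_addv (peval_add env)); apply: peq_eval; rewrite /e.
by case: k {e ee ek} => [[|[|[|k]]] lk]; [vm_compute|vm_compute|vm_compute|].
Qed.

Section Derivation.
Variable D : jordan K -> jordan K.
Hypothesis so6D : so6 D.
Lemma so6_linear : linear D. Proof. by case: so6D => -[]. Qed.
Lemma so6_mul X Y : D (jmul X Y) = jmul (D X) Y + jmul X (D Y).
Proof. by case: so6D => -[]. Qed.
Lemma so6_root A : root_elt A -> D A = 0.
Proof.
case: so6D => _ DE D0 D1.
have lF c : D (e1F c) = 0.
  have -> : e1F c = jordanF1 (octE K (@Ordinal 8 0 isT)) + c *: jordanF1 (octE K (@Ordinal 8 1 isT)).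
    congr (_, _); first by rewrite /= scaler0 addr0.
    apply/matrixP => i j; rewrite !mxE.
    by case: i => [[|[|[|i]]] li] //=; rewrite !mxE ?mulr0 ?addr0.
  by rewrite (lfD so6_linear) (lfZ so6_linear) D0 D1 scaler0 addr0.
by case=> [k||] //; apply: DE.
Qed.

Lemma so6_diag X k : (D X).1 0 k = 0.
Proof.
have [_ DE _ _] := so6D.
have hm := so6_mul; have m0 := @jmul0l K; have p := peirce_diag k.
move: (@jmul K) hm m0 p => m hm m0 p.
have := congr1 D (p X).
rewrite hm DE m0 add0r (lfZ so6_linear) hm DE m0 add0r (lfD so6_linear) (lfZ so6_linear) hm.
rewrite DE m0 add0r scaler0 addr0 p => /(congr1 (fun Z : jordan K => Z.1 0 k)) /=.
by rewrite !mxE !eqxx /= mulr1 => /(canRL (addKr _)); rewrite addNr.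
Qed.

(** By the Leibniz rule (D X, Y) + (X, D Y) is the trace of D applied to the product of X and Y, and
    values of D have zero diagonal. *)
Lemma so6_skew X Y : jform (D X) Y = jform X (- D Y).
Proof.
have tr0 Z : jtrace (D Z) = 0 by rewrite /jtrace big1 // => k _; apply: so6_diag.
rewrite -scaleN1r jformZr mulN1r; apply/eqP; rewrite -addr_eq0; apply/eqP.
by rewrite /jform -jtraceD -so6_mul tr0.
Qed.

Lemma Phi_so6 X Y xi eta : Phi D 0 0 0 (X, Y, xi, eta) = (D X, D Y, 0, 0).
Proof.
have cz Z : jcross 0 Z = 0 :> jordan K by rewrite -(scale0r Z) jcrossZl !scale0r.
have fz Z : jform 0 Z = 0 :> K by rewrite -(scale0r Z) jformZl mul0r.
rewrite (PhiE _ _ _ _ _ _ _ so6_skew) !cz !fz !mulr0 !mul0r !scale0r !scaler0 opprK.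
by rewrite subr0 !addr0 add0r subr0.
Qed.

Lemma so6_expA A t : root_elt A -> Phi D 0 0 0 \o expA (t *: A) = expA (t *: A) \o Phi D 0 0 0.
Proof.
move=> rA; have DA := so6_root rA; apply/funext => -[[[X Y] xi] eta].
rewrite /comp Phi_so6 /expA Phi_so6.
have hD := lfD so6_linear; have hZ := lfZ so6_linear.
have fA Z : jform A (D Z) = 0.
  have := so6_skew A Z; rewrite DA -(scale0r Z) jformZl mul0r -scaleN1r jformZr mulN1r.
  by move/esym/eqP; rewrite oppr_eq0 => /eqP.
(* A derivation kills the unit, so D passes through each term of the cross product; the terms with D
   A, with (A, D X) or with the trace of D X vanish. *)
have cA : D (jcross A X) = jcross A (D X).
  have trD Z : jtrace (D Z) = 0 by rewrite /jtrace big1 // => k _; apply: so6_diag.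
  have D1 : D (jordan1 K) = 0.
    have := so6_mul (jordan1 K) (jordan1 K).
    by rewrite (jmulC (D _)) !jmul1l => /esym/(canRL (addKr _)); rewrite addNr.
  move: so6_mul (@jmul0l K) => hm m0; rewrite /jcross hZ.
  move: (@jmul K) hm m0 => m hm m0.
  rewrite !hD !(lfN so6_linear) !hZ D1 hm DA m0 add0r fA trD.
  by rewrite mulr0 subr0 !scale0r !scaler0 oppr0 !addr0.
rewrite !jcrossZl jformZl fA mulr0 addr0 scale0r addr0.
move: (@jcross K) cA => c cA.
by rewrite !hD !hZ DA cA !scaler0 addr0.
Qed.

Lemma so6_flip : Phi D 0 0 0 \o @flip K = @flip K \o Phi D 0 0 0.
Proof.
apply/funext => -[[[X Y] xi] eta]; rewrite /comp Phi_so6 /flip Phi_so6.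
by rewrite (lfN so6_linear) oppr0.
Qed.
End Derivation.

Definition jsig (T : Type) (c : Z * Z -> T) (a m : T -> T -> T) (X : seq T) : seq T :=
  let i := intc c Z0 :: intc c 1%ZZ :: nseq 6 (intc c Z0) in
  take 3 X ++ (scli c m (-1)%ZZ (omul c a m (omul c a m i (orow X 0)) i) ++
    (omul c a m i (orow X 1) ++ scli c m (-1)%ZZ (omul c a m (orow X 2) i))).

Lemma h_jsig (T U : Type) (cT : Z * Z -> T) (aT mT : T -> T -> T) (cU : Z * Z -> U)
   (aU mU : U -> U -> U) (h : T -> U) (hc : forall c, h (cT c) = cU c)
   (ha : forall x y, h (aT x y) = aU (h x) (h y))
   (hm : forall x y, h (mT x y) = mU (h x) (h y)) X :
  map h (jsig cT aT mT X) = jsig cU aU mU (map h X).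
Proof.
by rewrite /jsig !map_cat !(h_scli hc hm, h_omul hc ha hm, h_orow) map_take /= !(h_intc hc).
Qed.

Lemma jco_sig (X : jordan K) : jco (sigma'4_jordan X) = onK jsig (jco X).
Proof.
have ei : oco (octE K (@Ordinal 8 1 isT)) = intc gv Z0 :: intc gv 1%ZZ :: nseq 6 (intc gv Z0).
  by rewrite /oco /= !mxE /= intc0 intcE; have [-> _ _ _ _] := zvalE K.
have [_ _ _ _ [em1 _ _ _ _]] := zvalE K.
rewrite /jsig -ei !(scliE, em1) -[orow (jco X) 0]/(oco (row (@Ordinal 3 0 isT) X.2))
  -[orow (jco X) 1]/(oco (row (@Ordinal 3 1 isT) X.2))
  -[orow (jco X) 2]/(oco (row (@Ordinal 3 2 isT) X.2)).
rewrite -!oco_mul -!ocoZ !scaleN1r; congr (_ ++ (_ ++ (_ ++ _)));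
by congr oco; apply/rowP => k; rewrite !mxE.
Qed.

Definition fsig (T : Type) (c : Z * Z -> T) (a m : T -> T -> T) (P : seq T) : seq T :=
  jsig c a m (fpX P) ++ (jsig c a m (fpY P) ++ [:: fpxi c P; fpeta c P]).
Lemma fco_sig (P : freudenthal K) : fco (sigma'4 P) = onK fsig (fco P).
Proof. by case: P => [[[X Y] xi] eta]; rewrite /fsig fpXE fpYE -!jco_sig. Qed.
End Membership.

(** * The subgroup generated by exponentials, and inner derivations *)

Section Words.
Variable K : numClosedFieldType.
Local Notation onK f := (f _ (@gval K) (fun x y : K => x + y) (fun x y : K => x * y)).
Local Notation gv := (@gval K).
Local Notation hPK lem env :=
  (lem _ _ _ _ _ _ _ _ (peval env) (@peval_cst K env) (@peval_add K env) (@peval_mul K env)).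

Lemma h_fsig (T U : Type) (cT : Z * Z -> T) (aT mT : T -> T -> T) (cU : Z * Z -> U)
   (aU mU : U -> U -> U) (h : T -> U) (hc : forall c, h (cT c) = cU c)
   (ha : forall x y, h (aT x y) = aU (h x) (h y))
   (hm : forall x y, h (mT x y) = mU (h x) (h y)) P :
  map h (fsig cT aT mT P) = fsig cU aU mU (map h P).
Proof.
rewrite /fsig (map_cat h (jsig _ _ _ _)) (map_cat h (jsig _ _ _ (fpY P))) !(h_jsig hc ha hm).
by rewrite h_fpX h_fpY /= /fpxi /fpeta !(h_nth hc).
Qed.

Definition jmk (s : seq K) : jordan K :=
  (\row_k s`_k, \matrix_(i < 3, k < 8) s`_(3 + 8 * i + k)).
Definition fmk (s : seq K) : freudenthal K :=
  (jmk (take 27 s), jmk (take 27 (drop 27 s)), s`_54, s`_55).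

Lemma jco_mk s : size s = 27 -> jco (jmk s) = s.
Proof.
move=> ss; rewrite /jco /oco /= !mxE /=.
by do 28! (case: s ss => [|? s] //= ss).
Qed.
Lemma fco_mk s : size s = 56 -> fco (fmk s) = s.
Proof.
move=> ss; rewrite -[fco _]/(jco (jmk (take 27 s)) ++
  (jco (jmk (take 27 (drop 27 s))) ++ [:: s`_54; s`_55])).
rewrite !jco_mk ?size_take ?size_drop ?ss //.
rewrite -[RHS](cat_take_drop 27); congr (_ ++ _).
rewrite -[RHS](cat_take_drop 27); congr (_ ++ _).
apply: (@eq_from_nth _ 0); first by rewrite !size_drop ss.
by case=> [|[|i]] //= _; rewrite !nth_drop.
Qed.

Definition sig_check (p : seq gpol) :=
  peq (onP fsig (onP fexp p (pvars 0 56))) (onP fexp p (onP fsig (pvars 0 56))).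

Lemma sig_root A t : root_elt A ->
  @sigma'4 K \o expA (t *: A) = expA (t *: A) \o @sigma'4 K.
Proof.
move=> rA; apply/funext => P; rewrite /comp; apply: fco_inj.
rewrite fco_sig !fco_expA fco_sig.
have [s chk eA] : exists2 s, sig_check (pvec s) & jco A = [seq gval K (gcoef s k) | k <- iota 0 27].
  case: {t P} A / rA => [k||].
  - exists [:: (k : nat, gone)]; last exact: jco_E.
    by case: k => [[|[|[|k]]] lk]; [vm_compute|vm_compute|vm_compute|].
  - by rewrite -gval_i; exists [:: (3%N, gone); (4%N, (Z0, 1%ZZ))]; [vm_compute|exact: jco_e1F].
  - by rewrite -gval_Ni; exists [:: (3%N, gone); (4%N, (Z0, (-1)%ZZ))]; [vm_compute|exact: jco_e1F].
have [eP _ _] := env56 P P t; have := peval_pvec P P t s.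
set env := fco P ++ _ in eP * => ep.
rewrite jcoZ eA -ep -eP -(hPK h_fexp env) -!(hPK h_fsig env) -(hPK h_fexp env).
exact: peq_eval.
Qed.

Lemma sig_flip : @sigma'4 K \o @flip K = @flip K \o @sigma'4 K.
Proof.
apply/funext => P; rewrite /comp; apply: fco_inj; rewrite fco_sig !fco_flip fco_sig.
have [eP _ _] := env56 P P 0; set env := fco P ++ _ in eP.
rewrite -eP -(h_flam (peval_cst env) (peval_mul env)) -!(hPK h_fsig env).
rewrite -(h_flam (peval_cst env) (peval_mul env)).
by apply: peq_eval; vm_compute.
Qed.

Local Notation G := (E7_sigma'4_so6 K).

Lemma G_linear a : G a -> linear a. Proof. by case=> -[]. Qed.

Lemma G_expA A t : root_elt A -> G (expA (t *: A)).
Proof.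
move=> rA; split; [exact: E7_expA|exact: sig_root|].
by move=> D so6D; apply: so6_expA.
Qed.

Lemma G_flip : G (@flip K).
Proof.
split; [exact: E7_flip|exact: sig_flip|].
by move=> D so6D; apply: so6_flip.
Qed.

Lemma G_comp a b : G a -> G b -> G (a \o b).
Proof.
move=> [[la [a' [aa' a'a ha]]] sa da] [[lb [b' [bb' b'b hb]]] sb db]; split.
- split; first by move=> c x y; rewrite /= lb la.
  exists (b' \o a'); split; [exact: can_comp|exact: can_comp|].
  move=> P Q; rewrite /= -ha -hb; apply/funext => S; by [].
- by rewrite compA sa -compA sb compA.
- by move=> D sD; rewrite compA da // -compA db // compA.
Qed.

Lemma G_id : G id.
Proof.
by split=> //; split=> //; exists id; split.
Qed.

(** Each generator carries a parameter t that can be moved to 0, so words serve both to realize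
    given matrices and to join elements by paths. The second constructor gives the exponential of
    Phi(0, 0, -t A, 0). *)
Inductive word : (freudenthal K -> freudenthal K) -> Prop :=
  | word_exp A t : root_elt A -> word (expA (t *: A))
  | word_flip A t : root_elt A -> word (@flip K \o (expA (t *: A) \o @unflip K))
  | word_comp a b : word a -> word b -> word (a \o b).

(** [flip] has order four, so its inverse is a power of it and belongs to the group by closure under
    composition. *)
Lemma unflipE : @unflip K = @flip K \o (@flip K \o @flip K).
Proof.
apply/funext => P; rewrite /unflip /= -scaleN1r -(lfZ (@flip_linear K)); congr flip.
by rewrite flipK scaleN1r.
Qed.

Lemma word_G a : word a -> G a.
Proof.
elim=> {a} [A t rA|A t rA|a b _ Ga _ Gb]; [exact: G_expA| |exact: G_comp].
apply: G_comp G_flip (G_comp (G_expA t rA) _).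
by rewrite unflipE; apply: G_comp G_flip (G_comp G_flip G_flip).
Qed.

(* Inner derivations [L_A, L_B], scaled by 4. *)
Definition inner4 (T : Type) (c : Z * Z -> T) (a m : T -> T -> T) (A B X : seq T) :=
  addv a (jm2 c a m A (jm2 c a m B X)) (scli c m (-1)%ZZ (jm2 c a m B (jm2 c a m A X))).

Lemma h_inner4 (T U : Type) (cT : Z * Z -> T) (aT mT : T -> T -> T) (cU : Z * Z -> U)
   (aU mU : U -> U -> U) (h : T -> U) (hc : forall c, h (cT c) = cU c)
   (ha : forall x y, h (aT x y) = aU (h x) (h y))
   (hm : forall x y, h (mT x y) = mU (h x) (h y)) A B X :
  map h (inner4 cT aT mT A B X) = inner4 cU aU mU (map h A) (map h B) (map h X).
Proof. by rewrite /inner4 (h_addv ha) (h_scli hc hm) !(h_jm2 hc ha hm). Qed.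

Definition inner (A B X : jordan K) : jordan K := jmul A (jmul B X) - jmul B (jmul A X).

Lemma jco_inner A B X : onK inner4 (jco A) (jco B) (jco X) = jco (4 *: inner A B X).
Proof.
have [_ _ _ _ [em1 _ _ _ _]] := zvalE K; have Zr := @jmulZr K.
have hm := @jm2E K; rewrite /inner; move: (@jmul K) hm Zr => m hm Zr.
rewrite /inner4 !hm scliE em1 -jcoZ -jcoD !Zr !(scalerA 2 2) scaleN1r -scalerBr.
by have -> : 2 * 2 = 4 :> K by rewrite -natrM.
Qed.

Definition unit_at (k : nat) : seq (Z * Z) := [seq gcoef [:: (k, gone)] j | j <- iota 0 27].
Lemma jco_F1 (k : 'I_8) : (k < 2)%N -> jco (jordanF1 (octE K k)) = map gv (unit_at (3 + k)).
Proof.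
have g0 : gval K gzero = 0 by exact: intc0.
have g1 : gval K gone = 1 by rewrite -[LHS]/(intc gv 1%ZZ) intcE.
move=> k2; rewrite /jco /oco /= !mxE /=.
by case: k k2 => [[|[|k]] lk] //= _; rewrite g0 g1.
Qed.

(** Coordinates 0 to 4 are those of E_1, E_2, E_3, F_1(e_0) and F_1(e_1), the elements that [so6]
    requires to be killed. *)
Definition der_check (a b : seq (Z * Z)) :=
  let A := map pcst a in let B := map pcst b in
  let D := onP inner4 A B in
  let x := pvars 0 27 in let y := pvars 27 27 in
  peq (D (onP jm2 x y)) (addv padd (onP jm2 (D x) y) (onP jm2 x (D y)))
  && all (fun k => peq (D (map pcst (unit_at k))) (nseq 27 (pcst gzero))) (iota 0 5).

Lemma so6_inner (a b : seq (Z * Z)) c (A B : jordan K) :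
  jco A = map gv a -> jco B = map gv b -> der_check a b ->
  so6 (fun X => c *: inner A B X).
Proof.
move=> eA eB /andP[chkD /allP chk0].
have lin : linear (inner A B).
  move=> d X Y; rewrite /inner; move: (@jmulDr K) (@jmulZr K) => mD mZ.
  move: (@jmul K) mD mZ => m mD mZ; rewrite !mD !mZ scalerBr opprD.
  by rewrite addrACA.
have iD X Y : inner A B (jmul X Y) = jmul (inner A B X) Y + jmul X (inner A B Y).
  (* The factor 2 turns [jmul] into [jm2], and the factor 4 turns [inner] into [inner4]. *)
  apply: (scalerI (nat_unit K 1)); apply: (scalerI (nat_unit K 3)); apply: jco_inj.
  have hm := @jm2E K; have Zl := @jmulZl K; have Zr := @jmulZr K.
  have hi := jco_inner A B; move: (inner A B) hi lin => i hi lin.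
  move: (@jmul K) hm Zl Zr => m hm Zl Zr.
  rewrite -(lfZ lin) -hi -hm scalerDr scalerDr jcoD.
  rewrite (scalerA 4 2 (m (i X) Y)) (scalerA 4 2 (m X (i Y))) (mulrC 4 2) -!(scalerA 2 4).
  rewrite -(Zl 4) -(Zr 4) -!hm -!hi eA eB.
  have [ex ey _ _] := env3 X Y X 0; set env := jco X ++ _ in ex ey.
  rewrite -ex -ey !(map_gval env) -!(hPK h_jm2 env) -!(hPK h_inner4 env) -!(hPK h_jm2 env).
  by rewrite -(h_addv (peval_add env)); apply: peq_eval.
have i0 k X : (k < 5)%N -> jco X = map gv (unit_at k) -> inner A B X = 0.
  move=> k5 eX; apply: (scalerI (nat_unit K 3)); rewrite scaler0; apply: jco_inj.
  rewrite -jco_inner eA eB eX !(map_gval [::]) -(hPK h_inner4 [::]) jco0.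
  rewrite (peq_eval _ (chk0 k _)) ?mem_iota // map_nseq; congr nseq; exact: intc0.
split.
- split; first by move=> d X Y; rewrite lin scalerDr !scalerA mulrC.
  move=> X Y; rewrite iD; have Zl := @jmulZl K; have Zr := @jmulZr K.
  by rewrite Zl Zr scalerDr.
- by move=> k; rewrite (i0 k) ?scaler0 ?(leq_trans (ltn_ord k)) // jco_E /unit_at -map_comp.
- by rewrite (i0 3) ?scaler0 // (jco_F1 (k := Ordinal _)).
- by rewrite (i0 4) ?scaler0 // (jco_F1 (k := Ordinal _)).
Qed.
End Words.

(** * A weight basis *)

Definition wt3 (o : nat) (s c : Z) : nat * (Z * Z) := (o, (s, c)).
Arguments wt3 o%_N s%_ZZ c%_ZZ.
Definition wsel (a : nat) (s t : Z) : Z := if a is 0%N then s else t.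
Arguments wsel a%_N s%_ZZ t%_ZZ.

Definition wtab : seq (nat * (Z * Z)) := Eval vm_compute in
  flatten [seq [:: wt3 (11 + 2 * a) 1 1; wt3 (19 + 2 * a) (wsel a (-1) 1) (wsel a 1 (-1));
                   wt3 (38 + 2 * a) 1 (-1); wt3 (46 + 2 * a) (wsel a (-1) 1) (wsel a (-1) 1)]
          | a <- iota 0 4] ++
  flatten [seq [:: wt3 (38 + 2 * a) (-1) 1; wt3 (46 + 2 * a) (wsel a 1 (-1)) (wsel a 1 (-1));
                   wt3 (11 + 2 * a) (-1) 1; wt3 (19 + 2 * a) (wsel a 1 (-1)) (wsel a 1 (-1))]
          | a <- iota 0 4] ++
  flatten [seq [:: w; wt3 (27 + w.1) w.2.1 (BinInt.Z.opp w.2.2)]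
          | w <- [:: wt3 5 1 (-1); wt3 7 1 (-1); wt3 9 1 1; wt3 9 (-1) 1; wt3 7 (-1) 1;
                     wt3 5 (-1) (-1)]] ++
  [:: wt3 55 0 1; wt3 0 0 1; wt3 3 (-1) (-1); wt3 30 (-1) 1; wt3 2 0 1; wt3 28 0 1;
      wt3 1 0 (-1); wt3 29 0 (-1); wt3 3 1 1; wt3 30 1 (-1); wt3 27 0 1; wt3 54 0 1].

Definition wget (n : nat) := nth (wt3 0 0 0) wtab n.
(* Vectors and coordinate forms of the weight basis: the entry (o, s, c) stands
   for c (e_o - s i e_(o+1)) with form (c / 2) (x_o + s i x_(o+1)), or for
   2 c e_o with form (c / 2) x_o when s = 0. *)
Definition wvec (n : nat) : seq (Z * Z) :=
  let: (o, (s, c)) := wget n in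
  [seq (if j == o then (if s is Z0 then BinInt.Z.mul 2%ZZ c else c, Z0)
        else if j == o.+1 then (Z0, BinInt.Z.opp (BinInt.Z.mul s c)) else gzero) | j <- iota 0 56].
Definition wform (n : nat) : seq (Z * Z) :=
  let: (o, (s, c)) := wget n in
  [seq (if j == o then (c, Z0)
        else if j == o.+1 then (Z0, BinInt.Z.mul s c) else gzero) | j <- iota 0 56].

(* As a module over SL(2) x SL(4), with natural modules U and V, the space splits
   into four copies of V (bv (wM a k)), four of its dual (wN), six of U (wS) and
   one of U (x) Lambda^2 V (wT, where p numbers the pairs 01, 02, 03, 12, 13, 23).
   The first index is that of an so(6)-module. *)
Definition wM (a k : nat) := (4 * a + k)%N.
Definition wN (a k : nat) := (16 + 4 * a + k)%N.
Definition wS (p m : nat) := (32 + 2 * p + m)%N.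
Definition wT (p m : nat) := (44 + 2 * p + m)%N.

Section WeightBasis.
Variable K : numClosedFieldType.
Local Notation onK f := (f _ (@gval K) (fun x y : K => x + y) (fun x y : K => x * y)).
Local Notation gv := (@gval K).
Local Notation "+%K" := (fun x y : K => x + y).
Local Notation "*%K" := (fun x y : K => x * y).
Local Notation hPK lem env :=
  (lem _ _ _ _ _ _ _ _ (peval env) (@peval_cst K env) (@peval_add K env) (@peval_mul K env)).

Definition bv (n : nat) : freudenthal K := fmk (map gv (wvec n)).
Definition cf (n : nat) (P : freudenthal K) : K := 2^-1 * onK dotv (map gv (wform n)) (fco P).

Definition pform n (z : seq gpol) := onP dotv (map pcst (wform n)) z.

Lemma size_wvec n : size (wvec n) = 56.
Proof. by rewrite /wvec; case: (wget n) => o [s c]; rewrite size_map size_iota. Qed.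
Lemma fco_bv n : fco (bv n) = map gv (wvec n).
Proof. by rewrite /bv fco_mk // size_map size_wvec. Qed.

Definition dual_check := all (fun n => all (fun m =>
  Ring_polynom.Peq geqb (pform n (map pcst (wvec m)))
     (pcst (if n == m then (2%ZZ, Z0) else gzero))) (iota 0 56)) (iota 0 56).

(* 8 Phi_D for the four root vectors D of so(6) acting on the 4-dimensional
   spin representation as E_01, E_12, E_23, E_30. *)
Definition rvec (a : nat) (s : Z) : seq (Z * Z) :=
  [seq gcoef [:: (3 + 2 * a, gone); (4 + 2 * a, (Z0, BinInt.Z.opp s))]%N j | j <- iota 0 27].
Definition rpair (d : nat) : seq (Z * Z) * seq (Z * Z) :=
  nth ([::], [::]) [:: (rvec 3 1%ZZ, rvec 2 1%ZZ); (rvec 1 1%ZZ, rvec 2 (-1)%ZZ);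
    (rvec 2 1%ZZ, rvec 3 (-1)%ZZ); (rvec 1 (-1)%ZZ, rvec 2 (-1)%ZZ)] d.
Definition f8D T (c : Z * Z -> T) a m (d : nat) (P : seq T) : seq T :=
  let A := map c (rpair d).1 in let B := map c (rpair d).2 in
  inner4 c a m A B (fpX P) ++ (inner4 c a m A B (fpY P) ++ nseq 2 (intc c Z0)).

(* The eigenvalues of sigma'4. *)
Definition lam (n : nat) : Z * Z :=
  if (n < 16)%N then (Z0, 1%ZZ) else if (n < 32)%N then (Z0, (-1)%ZZ)
  else if (n < 44)%N then ((-1)%ZZ, Z0) else gone.
Definition lam_check := all (fun n =>
    Ring_polynom.Peq geqb (pform n (onP fsig (pvars 0 56))) (pmul (pcst (lam n)) (pform n (pvars 0 56)))
    && peq (onP fsig (map pcst (wvec n))) (sclv pmul (pcst (lam n)) (map pcst (wvec n)))) (iota 0 56).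

Definition sgn8 (e : bool) : Z := if e then (-8)%ZZ else 8%ZZ.
(* (d, n, e, m) in certs: coordinate n of D_d P is (-1)^e times coordinate m of P;
   in moves: D_d maps the n-th vector to (-1)^e times the m-th one. *)
Definition certs : seq (nat * nat * bool * nat) :=
  flatten [seq [:: (0, wM 0 k, false, wM 1 k); (1, wM 1 k, false, wM 2 k); (2, wM 2 k, false, wM 3 k);
     (0, wN 1 k, true, wN 0 k); (1, wN 2 k, true, wN 1 k); (2, wN 3 k, true, wN 2 k)]%N | k <- iota 0 4]
  ++ flatten [seq [:: (1, wS 0 m, false, wS 1 m); (1, wS 4 m, false, wS 5 m); (0, wS 1 m, false, wS 3 m);
     (0, wS 2 m, false, wS 4 m); (2, wS 1 m, true, wS 2 m)]%N | m <- iota 0 2].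
Definition cert_check := all (fun q => let: (d, n, e, m) := q in
   Ring_polynom.Peq geqb (pform n (onP f8D d (pvars 0 56)))
     (pmul (intc pcst (sgn8 e)) (pform m (pvars 0 56)))) certs.
Definition moves : seq (nat * nat * bool * nat) :=
  flatten [seq [:: (3, wM 0 k, false, wM 3 k); (2, wM 3 k, false, wM 2 k); (1, wM 2 k, false, wM 1 k);
     (3, wN 3 k, true, wN 0 k); (0, wN 0 k, true, wN 1 k); (1, wN 1 k, true, wN 2 k)]%N | k <- iota 0 4]
  ++ flatten [seq [:: (3, wS 0 m, false, wS 4 m); (2, wS 4 m, true, wS 3 m); (0, wS 3 m, false, wS 1 m);
     (0, wS 4 m, false, wS 2 m); (3, wS 1 m, false, wS 5 m)]%N | m <- iota 0 2].
Definition move_check := all (fun q => let: (d, n, e, m) := q in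
   peq (onP f8D d (map pcst (wvec n)))
     (scli pcst pmul (sgn8 e) (map pcst (wvec m)))) moves.
(** Operators 0, 1 and 2 are the raising operators of so(6). The vectors listed are the extremal
    ones of the modules 4, its dual and 6. *)
Definition kills :=
  [seq (d, n) | d <- iota 0 3, n <- [seq wM 0 k | k <- iota 0 4] ++ [seq wN 3 k | k <- iota 0 4] ++ [seq wS 0 m | m <- iota 0 2]].
Definition kill_check := all (fun q => peq (onP f8D q.1 (map pcst (wvec q.2))) (nseq 56 (pcst gzero))) kills.

Definition plin (l : seq (gpol * nat)) : seq gpol :=
  foldr (fun q => addv padd (sclv pmul q.1 (map pcst (wvec q.2)))) (nseq 56 (pcst gzero)) l.
Definition sq_id_check (l1 l2 l3 : seq (gpol * nat)) :=
  peq (onP fsq24 (plin l1) (plin l2)) (scli pcst pmul 24%ZZ (plin l3)).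
Definition pneg (p : gpol) := pmul (intc pcst (-1)%ZZ) p.
Definition vars_at (o : nat) (w : nat -> nat) n : seq (gpol * nat) :=
  [seq (pvar (o + j), w j) | j <- iota 0 n].
Definition eps_poly := padd (pmul (pvar 0) (pvar 3)) (pneg (pmul (pvar 1) (pvar 2))).
Definition dot_poly := foldr padd (pcst gzero) [seq pmul (pvar j) (pvar (4 + j)) | j <- iota 0 4].
Definition pairs4 : seq (nat * nat) := [:: (0, 1); (0, 2); (0, 3); (1, 2); (1, 3); (2, 3)]%N.
Definition pl (p : nat) := nth (0, 0)%N pairs4 p.
Definition minor2 (b c : nat) (kl : nat * nat) :=
  padd (pmul (pvar (b + kl.1)) (pvar (c + kl.2))) (pneg (pmul (pvar (b + kl.2)) (pvar (c + kl.1)))).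
Definition minor3 (k l m : nat) :=
  padd (pmul (pvar k) (minor2 4 8 (l, m))) (padd (pneg (pmul (pvar l) (minor2 4 8 (k, m))))
    (pmul (pvar m) (minor2 4 8 (k, l)))).

Lemma fco0 : fco (0 : freudenthal K) = nseq 56 0.
Proof. by rewrite -[LHS]/(jco 0 ++ (jco 0 ++ [:: 0; 0])) jco0. Qed.

Lemma fco_sum (c : nat -> K) s :
  fco (\sum_(n <- s) c n *: bv n) =
  foldr (fun n => addv +%K (sclv *%K (c n) (map gv (wvec n)))) (nseq 56 0) s.
Proof.
elim: s => [|n s IH]; first by rewrite big_nil fco0.
by rewrite big_cons fcoD fcoZ IH fco_bv.
Qed.

Lemma foldr_vecs env (f : nat -> gpol) s :
  map (peval env) (foldr (fun n => addv padd (sclv pmul (f n) (map pcst (wvec n))))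
     (nseq 56 (pcst gzero)) s) =
  foldr (fun n => addv +%K (sclv *%K (peval env (f n)) (map gv (wvec n)))) (nseq 56 0) s.
Proof.
elim: s => [|n s IH]; first by rewrite map_nseq; congr nseq; exact: intc0.
rewrite /= (h_addv (peval_add env)) (h_sclv (peval_mul env)) IH.
by rewrite -map_gval.
Qed.

Lemma envP (P : freudenthal K) : map (peval (fco P)) (pvars 0 56) = fco P.
Proof. by rewrite -[X in peval X]cats0 vars_cat ?size_fco. Qed.

Lemma peval_form P n : peval (fco P) (pform n (pvars 0 56)) = 2 * cf n P.
Proof.
rewrite /pform (h_dotv (peval_cst _) (peval_add _) (peval_mul _)) envP -map_gval.
by rewrite /cf mulVKf ?nat_unit.
Qed.

Lemma cf_sum P : P = \sum_(n <- iota 0 56) cf n P *: bv n.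
Proof.
apply: (scalerI (nat_unit K 1)); apply: fco_inj; rewrite scaler_sumr.
under eq_bigr do rewrite scalerA -peval_form.
rewrite fco_sum -foldr_vecs fcoZ.
have [_ <- _ _ _] := zvalE K; rewrite -scliE -{1}(envP P).
rewrite -(h_scli (peval_cst _) (peval_mul _)); apply/esym/peq_eval.
by vm_compute.
Qed.

Lemma dotv_lin (s x y : seq K) c : size x = size y ->
  onK dotv s (addv +%K (sclv *%K c x) y) = c * onK dotv s x + onK dotv s y.
Proof.
rewrite /dotv /zipT !sumT_big !big_map.
elim: x y s => [|a x IH] [|b y] // [|d s] => [_|_|_|[/IH e]];
  try by rewrite /= !big_nil mulr0 addr0.
by rewrite /= !big_cons /= -[X in zip s X]/(addv +%K (sclv *%K c x) y) e; ring.
Qed.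

Lemma cf_linear n c P Q : cf n (c *: P + Q) = c * cf n P + cf n Q.
Proof. by rewrite /cf fcoD fcoZ dotv_lin ?size_fco // mulrDr mulrCA. Qed.
Lemma cf0 n : cf n 0 = 0.
Proof.
have := cf_linear n 1 0 0; rewrite scaler0 addr0 mul1r => /esym/(canRL (addKr _)).
by rewrite addNr.
Qed.
Lemma cfZ n c P : cf n (c *: P) = c * cf n P.
Proof. by rewrite -[c *: P]addr0 cf_linear cf0 addr0. Qed.
Lemma cfD n P Q : cf n (P + Q) = cf n P + cf n Q.
Proof. by rewrite -[P in LHS]scale1r cf_linear mul1r. Qed.
Lemma cf_bigsum n (I : Type) (s : seq I) (F : I -> freudenthal K) :
  cf n (\sum_(i <- s) F i) = \sum_(i <- s) cf n (F i).
Proof. by elim: s => [|i s IH]; rewrite ?big_nil ?cf0 // !big_cons cfD IH. Qed.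

Lemma cf_bv n m : (n < 56)%N -> (m < 56)%N -> cf n (bv m) = (n == m)%:R.
Proof.
move=> ln lm; have /allP chk : dual_check by vm_compute.
have /chk/allP chk1 : n \in iota 0 56 by rewrite mem_iota.
have /chk1 chk2 : m \in iota 0 56 by rewrite mem_iota.
apply: (mulfI (nat_unit K 1)); rewrite /cf mulVKf ?nat_unit // fco_bv !(map_gval [::]).
rewrite -(h_dotv (peval_cst _) (peval_add _) (peval_mul _)) -/(pform n _).
rewrite (peq1_eval _ chk2) peval_cst; case: eqP => _.
  by rewrite -[LHS]/(intc gv 2%ZZ) intcE mulr1; have [_ -> _ _ _] := zvalE K.
by rewrite mulr0; exact: intc0.
Qed.

Lemma cf_sig n P : (n < 56)%N -> cf n (sigma'4 P) = gv (lam n) * cf n P.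
Proof.
move=> ln; have /allP/(_ n) : lam_check by vm_compute.
rewrite mem_iota => /(_ ln) /andP[chk _].
apply: (mulfI (nat_unit K 1)); rewrite [RHS]mulrCA -(peval_form P).
rewrite /cf mulVKf ?nat_unit // fco_sig -{1}(envP P) (map_gval (fco P)) -(hPK h_fsig (fco P)).
rewrite -(h_dotv (peval_cst _) (peval_add _) (peval_mul _)) -/(pform n _).
by rewrite (peq1_eval _ chk) peval_mul.
Qed.

Lemma bv_sig n : (n < 56)%N -> sigma'4 (bv n) = gv (lam n) *: bv n.
Proof.
move=> ln; have /allP/(_ n) : lam_check by vm_compute.
rewrite mem_iota => /(_ ln) /andP[_ chk].
apply: fco_inj; rewrite fco_sig fcoZ fco_bv (map_gval [::]) -(hPK h_fsig [::]).
by rewrite (peq_eval _ chk) (h_sclv (peval_mul _)).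
Qed.

(** The factor 1/2 makes the operator permute weight vectors up to signs, as [certs] and [moves]
    record. *)
Definition Dd (d : nat) : jordan K -> jordan K :=
  fun X => 2^-1 *: inner (jmk (map gv (rpair d).1)) (jmk (map gv (rpair d).2)) X.

Lemma size_rpair d : (d < 4)%N -> size (rpair d).1 = 27 /\ size (rpair d).2 = 27.
Proof. by case: d => [|[|[|[|]]]]. Qed.

Lemma so6_Dd d : (d < 4)%N -> so6 (Dd d).
Proof.
move=> ld; have [s1 s2] := size_rpair ld.
apply: (@so6_inner K (rpair d).1 (rpair d).2); rewrite ?jco_mk ?size_map //.
have /allP/(_ d) : all (fun d => der_check (rpair d).1 (rpair d).2) (iota 0 4) by vm_compute.
by rewrite mem_iota; apply.
Qed.

Lemma fco_PhiD d P : (d < 4)%N ->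
  fco (8%:R *: Phi (Dd d) 0 0 0 P) = onK f8D d (fco P).
Proof.
move=> ld; have [s1 s2] := size_rpair ld.
have h X : jco (8%:R *: Dd d X) = onK inner4 (map gv (rpair d).1) (map gv (rpair d).2) (jco X).
  rewrite -[in RHS](jco_mk (s := map gv (rpair d).1)) ?size_map //.
  rewrite -[in RHS](jco_mk (s := map gv (rpair d).2)) ?size_map //.
  by rewrite jco_inner /Dd scalerA; congr (jco (_ *: _)); field.
case: P => [[[X Y] xi] eta]; rewrite (Phi_so6 (so6_Dd ld)).
rewrite -[LHS]/(jco (8%:R *: Dd d X) ++ (jco (8%:R *: Dd d Y) ++ [:: 8%:R * 0; 8%:R * 0])).
move: (Dd d X) (Dd d Y) (h X) (h Y) => u v -> ->.
by rewrite /f8D fpXE fpYE mulr0 intc0.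
Qed.

Lemma h_f8D (T U : Type) (cT : Z * Z -> T) (aT mT : T -> T -> T) (cU : Z * Z -> U)
   (aU mU : U -> U -> U) (h : T -> U) (hc : forall c, h (cT c) = cU c)
   (ha : forall x y, h (aT x y) = aU (h x) (h y))
   (hm : forall x y, h (mT x y) = mU (h x) (h y)) d P :
  map h (f8D cT aT mT d P) = f8D cU aU mU d (map h P).
Proof.
rewrite /f8D (map_cat h (inner4 _ _ _ _ _ _)) (map_cat h (inner4 _ _ _ _ _ (fpY P))).
rewrite !(h_inner4 hc ha hm) h_fpX h_fpY map_nseq (h_intc hc) -!map_comp.
by rewrite !(eq_map hc).
Qed.

Lemma intc8 e : intc gv (sgn8 e) = 8%:R * (-1) ^+ e.
Proof.
by rewrite intcE; case: e; rewrite /sgn8 ?zval_neg ?zval_nat ?mulr1 // expr1 mulrN1.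
Qed.

Lemma certs_lt d n e m : (d, n, e, m) \in certs ++ moves -> (d < 4)%N.
Proof.
have /allP h : all (fun q : nat * nat * bool * nat => q.1.1.1 < 4)%N (certs ++ moves) by vm_compute.
by move=> /h.
Qed.

Lemma cf_D d n e m P : (d, n, e, m) \in certs ->
  cf n (Phi (Dd d) 0 0 0 P) = (-1) ^+ e * cf m P.
Proof.
move=> inq; have ld : (d < 4)%N by apply: (@certs_lt d n e m); rewrite mem_cat inq.
have /allP/(_ _ inq) chk : cert_check by vm_compute.
apply: (mulfI (nat_unit K 7)); apply: (mulfI (nat_unit K 1)).
rewrite -(cfZ n 8%:R) [in LHS]/cf mulVKf ?nat_unit // fco_PhiD //.
rewrite -{1}(envP P) (map_gval (fco P)) -(hPK h_f8D (fco P)).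
rewrite -(h_dotv (peval_cst _) (peval_add _) (peval_mul _)) -/(pform n _).
rewrite (peq1_eval _ chk) peval_mul peval_form (h_intc (peval_cst _)) intc8.
by move: (cf m P) ((-1) ^+ e) => x y; ring.
Qed.

Lemma move_D d n e m : (d, n, e, m) \in moves ->
  Phi (Dd d) 0 0 0 (bv n) = (-1) ^+ e *: bv m.
Proof.
move=> inq; have ld : (d < 4)%N by apply: (@certs_lt d n e m); rewrite mem_cat inq orbT.
have /allP/(_ _ inq) chk : move_check by vm_compute.
apply: (scalerI (nat_unit K 7)); apply: fco_inj; rewrite fco_PhiD // scalerA -intc8.
rewrite fcoZ !fco_bv !(map_gval [::]) -(hPK h_f8D [::]) (peq_eval _ chk).
by rewrite (h_scli (peval_cst _) (peval_mul _)).
Qed.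

Lemma kill_D d n : (d, n) \in kills -> Phi (Dd d) 0 0 0 (bv n) = 0.
Proof.
move=> inq; have ld : (d < 4)%N.
  have /allP h : all (fun q : nat * nat => q.1 < 4)%N kills by vm_compute.
  exact: h inq.
have /allP/(_ _ inq) chk : kill_check by vm_compute.
apply: (scalerI (nat_unit K 7)); rewrite scaler0; apply: fco_inj; rewrite fco_PhiD // fco0.
rewrite fco_bv (map_gval [::]) -(hPK h_f8D [::]) (peq_eval _ chk) map_nseq.
by congr nseq; exact: intc0.
Qed.

Definition lcb env (l : seq (gpol * nat)) : freudenthal K :=
  \sum_(q <- l) peval env q.1 *: bv q.2.

Lemma fco_lcb env l : fco (lcb env l) = map (peval env) (plin l).
Proof.
rewrite /lcb; elim: l => [|q l IH].
  by rewrite big_nil fco0 map_nseq; congr nseq; exact: (esym (intc0 K)).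
rewrite big_cons fcoD fcoZ IH fco_bv /= (h_addv (peval_add env)) (h_sclv (peval_mul env)).
by rewrite -map_gval.
Qed.

Lemma sq_id env l1 l2 l3 : sq_id_check l1 l2 l3 ->
  fcross (lcb env l1) (lcb env l1) (lcb env l2) = lcb env l3.
Proof.
move=> chk; apply: (scalerI (nat_unit K 23)); apply: fco_inj.
rewrite -fco_fcross !fco_lcb -(hPK h_fsq24 env) (peq_eval _ chk) fcoZ fco_lcb.
by rewrite (h_scli (peval_cst _) (peval_mul _)) scliE zval_nat.
Qed.

(** Copies 0 and 5 of U have opposite so(6)-weights, which lets (P x P) S return to the copy of S.
    The factor is the area form of the two vectors of U, so preserving it means determinant 1. *)
Lemma sq_S env : fcross (lcb env (vars_at 0 (wS 0) 2 ++ vars_at 0 (wS 5) 2))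
    (lcb env (vars_at 0 (wS 0) 2 ++ vars_at 0 (wS 5) 2)) (lcb env (vars_at 2 (wS 0) 2)) =
  lcb env [seq (pmul (intc pcst (-2)%ZZ) (pmul eps_poly (pvar m)), wS 0 m) | m <- iota 0 2].
Proof. by apply: sq_id; vm_compute. Qed.

Lemma sq_MN env : fcross (lcb env (vars_at 0 (wM 0) 4 ++ vars_at 4 (wN 0) 4))
    (lcb env (vars_at 0 (wM 0) 4 ++ vars_at 4 (wN 0) 4)) (lcb env (vars_at 8 (wS 0) 2)) =
  lcb env [seq (pneg (pmul dot_poly (pvar (8 + m))), wS 0 m) | m <- iota 0 2].
Proof. by apply: sq_id; vm_compute. Qed.

Lemma sq_MM env : fcross (lcb env (vars_at 0 (wM 0) 4 ++ vars_at 4 (wM 1) 4))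
    (lcb env (vars_at 0 (wM 0) 4 ++ vars_at 4 (wM 1) 4)) (lcb env (vars_at 8 (wS 5) 2)) =
  lcb env [seq (pmul (intc pcst (-2)%ZZ) (pmul (minor2 0 4 (pl p)) (pvar (8 + m))), wT p m)
          | p <- iota 0 6, m <- iota 0 2].
Proof. by apply: sq_id; vm_compute. Qed.

(** Vectors of V in three of its four copies give their wedge product, an element of the dual of V,
    in the copy with the missing index. *)
Lemma sq_MMM env : fcross (lcb env (vars_at 0 (wM 0) 4 ++ vars_at 4 (wM 1) 4))
    (lcb env (vars_at 0 (wM 0) 4 ++ vars_at 4 (wM 1) 4)) (lcb env (vars_at 8 (wM 2) 4)) =
  lcb env [:: (pmul (intc pcst (-2)%ZZ) (minor3 1 2 3), wN 3 0);
              (pmul (intc pcst 2%ZZ) (minor3 0 2 3), wN 3 1);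
              (pmul (intc pcst (-2)%ZZ) (minor3 0 1 3), wN 3 2);
              (pmul (intc pcst 2%ZZ) (minor3 0 1 2), wN 3 3)].
Proof. by apply: sq_id; vm_compute. Qed.
End WeightBasis.

(** * The product identities on blocks *)

Section Slices.
Variable K : numClosedFieldType.
Local Notation bv := (@bv K).
Local Notation cf := (@cf K).

Definition slice (s l : nat) (x : 'I_l -> K) : freudenthal K := \sum_(i < l) x i *: bv (s + i).

Lemma sliceE s l (x : 'I_l -> K) : slice s x = \sum_(i < l) x i *: bv (s + i).
Proof. by []. Qed.

Lemma sum_iota (V : nmodType) s l (F : nat -> V) :
  \sum_(n <- iota s l) F n = \sum_(i < l) F (s + i)%N.
Proof. rewrite -{1}[s]addn0 iotaDl big_map.
by rewrite (_ : iota 0 l = index_iota 0 l) ?big_mkord // /index_iota subn0. Qed.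

Lemma eq_slice s l (x y : 'I_l -> K) : x =1 y -> slice s x = slice s y.
Proof. by move=> xy; apply: eq_bigr => i _; rewrite xy. Qed.

Lemma lcb_slice env s l (f : nat -> gpol) :
  lcb env [seq (f i, (s + i)%N) | i <- iota 0 l] = slice s (fun i : 'I_l => peval env (f i)).
Proof. by rewrite /lcb big_map sum_iota. Qed.

Lemma lcb_vars env o s l :
  lcb env (vars_at o (fun i => (s + i)%N) l) = slice s (fun i : 'I_l => env`_(o + i)).
Proof. by rewrite /vars_at lcb_slice; apply: eq_slice => i; rewrite peval_var. Qed.

Lemma lcb_cat (env : seq K) l1 l2 : lcb env (l1 ++ l2) = lcb env l1 + lcb env l2.
Proof. exact: big_cat. Qed.

Lemma cf_slice s l (x : 'I_l -> K) (i : 'I_l) : (s + l <= 56)%N -> cf (s + i) (slice s x) = x i.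
Proof.
move=> sl; have lt (j : 'I_l) : (s + j < 56)%N by rewrite (leq_trans _ sl) // ltn_add2l.
rewrite cf_bigsum (bigD1 i) //= big1 => [|j ji]; first by rewrite cfZ cf_bv // eqxx mulr1 addr0.
by rewrite cfZ cf_bv // eqn_add2l eq_sym (negPf (ji : (j : nat) != i)) mulr0.
Qed.

Lemma sliceP s l Q : (s + l <= 56)%N ->
  (forall n, (n < 56)%N -> ~~ (s <= n < s + l)%N -> cf n Q = 0) ->
  Q = slice s (fun i : 'I_l => cf (s + i) Q).
Proof.
move=> sl Q0; rewrite {1}[Q]cf_sum -(subnKC sl) -addnA iotaD iotaD !big_cat /= add0n.
rewrite [X in X + _]big_seq [X in X + _]big1 => [|n]; last first.
  rewrite mem_iota /= => lt_ns; rewrite Q0 ?scale0r //.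
    by rewrite (leq_trans lt_ns) // (leq_trans (leq_addr l s)).
  by rewrite leqNgt lt_ns.
rewrite [X in _ + (_ + X)]big_seq [X in _ + (_ + X)]big1 => [|n]; last first.
  rewrite mem_iota subnKC // => /andP[le_sn lt_n]; rewrite Q0 ?scale0r //.
  by rewrite [(n < _)%N]ltnNge le_sn andbF.
by rewrite add0r addr0 sum_iota.
Qed.

Lemma sqS (u w : 'I_2 -> K) :
  fcross (slice 32 u + slice 42 u) (slice 32 u + slice 42 u) (slice 32 w) =
  slice 32 (fun m => -2 * (u 0 * w 1 - u 1 * w 0) * u m).
Proof.
have := sq_S [:: u 0; u 1; w 0; w 1].
rewrite lcb_cat (lcb_vars _ 0 32) (lcb_vars _ 0 42) (lcb_vars _ 2 32) lcb_slice.
have h (v : 'I_2 -> K) (i : 'I_2) : [:: v 0; v 1]`_i = v i.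
  by case: i => [[|[|i]]] //= li; congr v; apply: val_inj.
have e s : slice s (fun i : 'I_2 => [:: u 0; u 1; w 0; w 1]`_(0 + i)) = slice s u.
  by apply: eq_slice => i; rewrite -[RHS]h; case: i => [[|[|i]]].
have e2 : slice 32 (fun i : 'I_2 => [:: u 0; u 1; w 0; w 1]`_(2 + i)) = slice 32 w.
  by apply: eq_slice => i; rewrite -[RHS]h; case: i => [[|[|i]]].
rewrite !e e2 => ->; apply: eq_slice => i.
rewrite /eps_poly /pneg !(peval_mul, peval_add) !(h_intc (peval_cst _)) !peval_var intcN1 intcE.
have [_ _ _ _ [_ -> _ _ _]] := zvalE K.
by rewrite mulN1r mulrA; case: i => [[|[|i]]] //= li; congr (_ * u _); apply: val_inj.
Qed.

Definition l4 (v : 'I_4 -> K) := [seq v i | i <- enum 'I_4].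
Lemma size_l4 v : size (l4 v) = 4. Proof. by rewrite size_map size_enum_ord. Qed.
Lemma nth_l4 v (i : 'I_4) : (l4 v)`_i = v i.
Proof. by rewrite (nth_map i) ?nth_ord_enum ?size_enum_ord. Qed.

Section FourVectors.
Variables (b c : 'I_4 -> K) (w : seq K).
Let env := l4 b ++ (l4 c ++ w).
Lemma env_b (i : 'I_4) : env`_(0 + i) = b i.
Proof. by rewrite nth_cat size_l4 ltn_ord nth_l4. Qed.
Lemma env_c (i : 'I_4) : env`_(4 + i) = c i.
Proof. by rewrite nth_cat size_l4 -ltn_subRL subnn /= addKn nth_cat size_l4 ltn_ord nth_l4. Qed.
Lemma env_w i : env`_(8 + i) = w`_i.
Proof.
by rewrite /env catA nth_cat size_cat !size_l4 -ltn_subRL subnn /= addKn.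
Qed.
Lemma slice_b s : slice s (fun i : 'I_4 => env`_(0 + i)) = slice s b.
Proof. by apply: eq_slice => i; rewrite env_b. Qed.
Lemma slice_c s : slice s (fun i : 'I_4 => env`_(4 + i)) = slice s c.
Proof. by apply: eq_slice => i; rewrite env_c. Qed.

Lemma peval_minor2 k l : (k < 4)%N -> (l < 4)%N ->
  peval env (minor2 0 4 (k, l)) = b (inord k) * c (inord l) - b (inord l) * c (inord k).
Proof.
move=> lk ll; have eb n : (n < 4)%N -> env`_(0 + n) = b (inord n).
  by move=> ln; rewrite -{1}(inordK ln) env_b.
have ec n : (n < 4)%N -> env`_(4 + n) = c (inord n).
  by move=> ln; rewrite -{1}(inordK ln) env_c.
rewrite /minor2 /pneg !(peval_add, peval_mul) (h_intc (peval_cst _)) !peval_var intcN1 mulN1r.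
by rewrite (eb k lk) (eb l ll) (ec k lk) (ec l ll).
Qed.
End FourVectors.

Definition dot4 (b c : 'I_4 -> K) := \sum_i b i * c i.
Lemma sqMN (b c : 'I_4 -> K) (u : 'I_2 -> K) :
  fcross (slice 0 b + slice 16 c) (slice 0 b + slice 16 c) (slice 32 u) =
  slice 32 (fun m => - dot4 b c * u m).
Proof.
pose w := [seq u i | i <- enum 'I_2].
have := sq_MN (l4 b ++ (l4 c ++ w)).
rewrite lcb_cat (lcb_vars _ 0 0) (lcb_vars _ 4 16) (lcb_vars _ 8 32) lcb_slice slice_b slice_c.
have wi (i : 'I_2) : w`_i = u i by rewrite (nth_map i) ?nth_ord_enum ?size_enum_ord.
have -> : slice 32 (fun i : 'I_2 => (l4 b ++ (l4 c ++ w))`_(8 + i)) = slice 32 u.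
  by apply: eq_slice => i; rewrite env_w wi.
move=> ->; apply: eq_slice => i.
rewrite /pneg !peval_mul (h_intc (peval_cst _)) peval_var env_w wi intcN1 mulN1r -mulNr.
congr (- _ * _); rewrite /dot_poly /dot4.
have -> (env : seq K) s : peval env (foldr padd (pcst gzero) s) = \sum_(p <- s) peval env p.
  elim: s => [|p s IH]; first by rewrite big_nil; exact: intc0.
  by rewrite big_cons -IH -peval_add.
rewrite big_map sum_iota; apply: eq_bigr => j _.
by rewrite peval_mul !peval_var env_c (env_b b c w j).
Qed.

Definition minorK (b c : 'I_4 -> K) (p : nat) : K :=
  b (inord (pl p).1) * c (inord (pl p).2) - b (inord (pl p).2) * c (inord (pl p).1).

Lemma sqMM (b c : 'I_4 -> K) (u : 'I_2 -> K) :
  fcross (slice 0 b + slice 4 c) (slice 0 b + slice 4 c) (slice 42 u) =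
  \sum_(p < 6) \sum_(m < 2) (-2 * (minorK b c p * u m)) *: bv (wT p m).
Proof.
pose w := [seq u i | i <- enum 'I_2].
have := sq_MM (l4 b ++ (l4 c ++ w)).
rewrite lcb_cat (lcb_vars _ 0 0) (lcb_vars _ 4 4) (lcb_vars _ 8 42) slice_b slice_c.
have wi (i : 'I_2) : w`_i = u i by rewrite (nth_map i) ?nth_ord_enum ?size_enum_ord.
have -> : slice 42 (fun i : 'I_2 => (l4 b ++ (l4 c ++ w))`_(8 + i)) = slice 42 u.
  by apply: eq_slice => i; rewrite env_w wi.
move=> ->; rewrite /lcb big_allpairs_dep sum_iota; apply: eq_bigr => p _.
rewrite sum_iota; apply: eq_bigr => m _; congr (_ *: _).
rewrite !peval_mul (h_intc (peval_cst _)) peval_var env_w wi intcE.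
have [_ _ _ _ [_ -> _ _ _]] := zvalE K; congr (_ * (_ * _)).
rewrite add0n /minorK; case: p => [[|[|[|[|[|[|p]]]]]] lp] //.
all: exact: peval_minor2.
Qed.

Definition minor3K (b c d : 'I_4 -> K) (k l m : nat) : K :=
  let b i := b (inord i) in let c i := c (inord i) in let d i := d (inord i) in
  b k * (c l * d m - c m * d l) - b l * (c k * d m - c m * d k) + b m * (c k * d l - c l * d k).

(** Signed minors, arranged so that pairing with a fourth vector x gives the determinant with
    columns b, c, d, x. *)
Definition wedge3 (b c d : 'I_4 -> K) (i : 'I_4) : K :=
  [:: - minor3K b c d 1 2 3; minor3K b c d 0 2 3; - minor3K b c d 0 1 3; minor3K b c d 0 1 2]`_i.

Lemma sqMMM (b c d : 'I_4 -> K) :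
  fcross (slice 0 b + slice 4 c) (slice 0 b + slice 4 c) (slice 8 d) =
  slice 28 (fun i => 2 * wedge3 b c d i).
Proof.
have := sq_MMM (l4 b ++ (l4 c ++ l4 d)).
rewrite lcb_cat (lcb_vars _ 0 0) (lcb_vars _ 4 4) (lcb_vars _ 8 8) slice_b slice_c.
have -> : slice 8 (fun i : 'I_4 => (l4 b ++ (l4 c ++ l4 d))`_(8 + i)) = slice 8 d.
  by apply: eq_slice => i; rewrite env_w nth_l4.
move=> ->; set env := l4 b ++ _.
have vb (k : nat) : (k < 4)%N -> peval env (pvar k) = b (inord k).
  by move=> lk; rewrite peval_var -[k in env`_k](inordK lk) (env_b b c (l4 d)).
have vc (k : nat) : (k < 4)%N -> peval env (pvar (4 + k)) = c (inord k).
  by move=> lk; rewrite peval_var -{1}(inordK lk) (env_c b c (l4 d)).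
have vd (k : nat) : (k < 4)%N -> peval env (pvar (8 + k)) = d (inord k).
  by move=> lk; rewrite peval_var -{1}(inordK lk) (env_w b c (l4 d)) nth_l4.
have e3 k l m : (k < 4)%N -> (l < 4)%N -> (m < 4)%N ->
    peval env (minor3 k l m) = minor3K b c d k l m.
  move=> lk ll lm; rewrite /minor3 /minor2 /pneg !(peval_add, peval_mul).
  rewrite !(h_intc (peval_cst env)) intcN1 !mulN1r /fst /snd.
  rewrite (vb k lk) (vb l ll) (vb m lm) (vc k lk) (vc l ll) (vc m lm).
  by rewrite (vd k lk) (vd l ll) (vd m lm) /minor3K -addrA.
have [_ e2 _ _ [_ em2 _ _ _]] := zvalE K.
have sum4 (V : nmodType) (F : 'I_4 -> V) : \sum_i F i =
    F (inord 0) + (F (inord 1) + (F (inord 2) + (F (inord 3) + 0))).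
  rewrite !big_ord_recl big_ord0; by congr (F _ + (F _ + (F _ + (F _ + _)))); apply: val_inj; rewrite /= inordK.
rewrite /lcb !big_cons big_nil /slice sum4 /wedge3 !inordK //.
rewrite !(peval_mul env) !(h_intc (peval_cst env)) !intcE e2 em2 !e3 //.
by rewrite -[wN 3 0]/(28 + 0)%N -[wN 3 1]/(28 + 1)%N -[wN 3 2]/(28 + 2)%N -[wN 3 3]/(28 + 3)%N
  /= !mulrN !mulNr.
Qed.
End Slices.

(** * Blocks of an element of the group *)

Section Reduction.
Variable K : numClosedFieldType.
Local Notation gv := (@gval K).
Local Notation bv := (@bv K).
Local Notation cf := (@cf K).
Local Notation slice := (@slice K).
Local Notation G := (E7_sigma'4_so6 K).
Local Notation ph d := (Phi (@Dd K d) 0 0 0).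

Lemma lf_sum (U V : lmodType K) (f : U -> V) (I : Type) (r : seq I) (F : I -> U) : linear f ->
  f (\sum_(i <- r) F i) = \sum_(i <- r) f (F i).
Proof.
move=> lin; elim: r => [|i r IH]; first by rewrite !big_nil (lf0 lin).
by rewrite !big_cons (lfD lin) IH.
Qed.

Lemma ph_linear d : (d < 4)%N -> linear (ph d).
Proof.
move=> ld c [[[X Y] xi] eta] [[[X' Y'] xi'] eta']; rewrite -[c *: _ + _]/(_, _, _, _).
rewrite !(Phi_so6 (so6_Dd K ld)) !(so6_linear (so6_Dd K ld)).
by congr (_, _, _, _); rewrite /= ?scaler0 ?addr0.
Qed.

Definition lams : seq (Z * Z) := [:: (Z0, 1%ZZ); (Z0, (-1)%ZZ); ((-1)%ZZ, Z0); gone].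
Definition lamk (n : nat) : nat :=
  if (n < 16)%N then 0 else if (n < 32)%N then 1 else if (n < 44)%N then 2 else 3.
Lemma lamE n : lam n = nth gone lams (lamk n).
Proof. by rewrite /lam /lamk; do 3! case: ifP => _ //. Qed.
Lemma lamk_lt n : (lamk n < 4)%N.
Proof. by rewrite /lamk; do 3! case: ifP => _ //. Qed.

(** The squared absolute value of the difference of two distinct numbers among i, -i, -1 and 1 is 2
    or 4, which is nonzero in [K]. *)
Lemma lam_neq n m : lamk n != lamk m -> gv (lam n) != gv (lam m).
Proof.
rewrite !lamE; move: (lamk_lt n) (lamk_lt m); move: (lamk n) (lamk m) => k l lk ll nkl.
pose nrm c d := let z := gadd c (gopp d) in gmul z (z.1, BinInt.Z.opp z.2).
have : all (fun k => all (fun l => let w := nrm (nth gone lams k) (nth gone lams l) in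
    (k == l) || geqb w (2%ZZ, Z0) || geqb w (4%ZZ, Z0)) (iota 0 4)) (iota 0 4).
  by vm_compute.
move=> /allP/(_ k); rewrite mem_iota => /(_ lk)/allP/(_ l); rewrite mem_iota => /(_ ll) /=.
rewrite (negPf nkl) /=; move: (nth _ _ k) (nth _ _ l) => c d ww; have gm := gmorph K.
have w0 : gv (nrm c d) != 0.
  have gr (c' : BinNums.Z) : gv (c', Z0) = zval K c' by rewrite /gval /= mulr0 addr0.
  case/orP: ww => /(Ring_theory.morph_eq gm) ->; rewrite gr.
    by have [_ -> _ _ _] := zvalE K; rewrite nat_unit.
  by rewrite -[4%ZZ]/(BinInt.Z.of_nat 4) zval_nat nat_unit.
apply: contra w0 => /eqP e.
rewrite /nrm (Ring_theory.morph_mul gm) (Ring_theory.morph_add gm) (Ring_theory.morph_opp gm).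
by rewrite e subrr mul0r.
Qed.

Definition blk (a : freudenthal K -> freudenthal K) (s l : nat) : 'M[K]_l :=
  \matrix_(i, j) cf (s + i) (a (bv (s + j))).

Section Element.
Variables (a : freudenthal K -> freudenthal K) (Ga : G a).
Let lin : linear a := G_linear Ga.

Lemma G_ph d P : (d < 4)%N -> a (ph d P) = ph d (a P).
Proof.
move=> ld; have [_ _ h] := Ga; have /(congr1 (fun f => f P)) := h _ (so6_Dd K ld).
by move=> /= ->.
Qed.

Lemma G_cross P S : a (fcross P P S) = fcross (a P) (a P) (a S).
Proof.
have [[_ [b [ab ba h]]] _ _] := Ga.
by rewrite -h /= ab.
Qed.

Lemma lam_kill n m : (n < 56)%N -> (m < 56)%N -> lamk n != lamk m -> cf m (a (bv n)) = 0.
Proof.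
move=> ln lm nm; have e : sigma'4 (a (bv n)) = a (sigma'4 (bv n)).
  by have [_ h _] := Ga; exact: (congr1 (fun f => f (bv n)) h).
have := congr1 (cf m) e; rewrite cf_sig // bv_sig // (lfZ lin) cfZ => /eqP.
rewrite -subr_eq0 -mulrBl mulf_eq0 subr_eq0 eq_sym (negPf (lam_neq nm)) /=.
by move/eqP.
Qed.

(** An operator of so(6) that kills v also kills a v; the certificate reads a coordinate of a v as a
    coordinate of the image of a v, up to sign. *)
Lemma ext_kill d n q e m : (d, n) \in kills -> (d, q, e, m) \in certs -> cf m (a (bv n)) = 0.
Proof.
move=> kdn cq; have ld : (d < 4)%N by apply: (@certs_lt d q e m); rewrite mem_cat cq.
have := cf_D (a (bv n)) cq; rewrite -(G_ph _ ld) (kill_D K kdn) (lf0 lin) cf0 => /esym/eqP.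
by rewrite mulf_eq0 signr_eq0 => /eqP.
Qed.

Definition ext_check := all (fun sl : nat * nat => all (fun n => all (fun m =>
    [|| (sl.1 <= m < sl.1 + sl.2)%N, lamk n != lamk m |
        has (fun q : nat * nat * bool * nat => ((q.1.1.1, n) \in kills) && (q.2 == m)) certs])
   (iota 0 56)) (iota sl.1 sl.2)) [:: (0, 4); (28, 4); (32, 2)]%N.

(** An extremal vector stays in its block: coordinates in other eigenspaces of [sigma'4] vanish by
    [lam_kill], those in other copies of the same kind by [ext_kill], and [ext_check] verifies that
    these cases are exhaustive. *)
Lemma ext_slice s l (j : 'I_l) : (s, l) \in [:: (0, 4); (28, 4); (32, 2)]%N ->
  a (bv (s + j)) = slice s (fun i => blk a s l i j).
Proof.
move=> sl; have le : (s + l <= 56)%N by move: sl; rewrite !inE => /or3P[] /eqP[-> ->].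
have lsj : (s + j < 56)%N by rewrite (leq_trans _ le) // ltn_add2l.
rewrite [LHS](sliceP le) => [|m lm nm]; first by apply: eq_slice => i; rewrite mxE.
have /allP/(_ _ sl)/allP/(_ (s + j)%N) : ext_check by vm_compute.
rewrite mem_iota leq_addr ltn_add2l ltn_ord => /(_ isT) /allP/(_ m).
rewrite mem_iota => /(_ lm) /or3P[|/(lam_kill lsj lm)|]; first 1 [by rewrite (negPf nm)|by []].
by case/hasP=> [[[[d q] e] m'] qc /andP[/= kd /eqP <-]]; apply: ext_kill kd qc.
Qed.

(** Since a commutes with the operator, its matrix on one copy is transported unchanged to the next;
    the sign enters twice and cancels. *)
Lemma move_slice d e s s' l (x : 'I_l -> K) (k : 'I_l) :
  (forall i : 'I_l, (d, s + i, e, s' + i)%N \in moves) ->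
  a (bv (s + k)) = slice s x -> a (bv (s' + k)) = slice s' x.
Proof.
move=> mv es; have ld : (d < 4)%N by apply: (@certs_lt d (s + k) e (s' + k)); rewrite mem_cat mv orbT.
have sg (v : freudenthal K) : (-1) ^+ e *: ((-1) ^+ e *: v) = v.
  by rewrite scalerA -signr_addb addbb scale1r.
rewrite -[LHS]sg -(lfZ lin) -(move_D K (mv k)) (G_ph _ ld) es (lf_sum _ _ (ph_linear ld)).
rewrite scaler_sumr; apply: eq_bigr => i _.
by rewrite (lfZ (ph_linear ld)) (move_D K (mv i)) scalerA mulrC -scalerA sg.
Qed.

Local Notation A := (blk a 32 2).
Local Notation B := (blk a 0 4).
Local Notation C := (blk a 28 4).

Definition moves_into (d : nat) (e : bool) (s s' l : nat) :=
  all (fun i => (d, s + i, e, s' + i)%N \in moves) (iota 0 l).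
Lemma moves_intoP d e s s' l : moves_into d e s s' l ->
  forall i : 'I_l, (d, s + i, e, s' + i)%N \in moves.
Proof. by move=> /allP h i; apply: h; rewrite mem_iota /=. Qed.

Lemma G_M p (k : 'I_4) : (p < 4)%N -> a (bv (4 * p + k)) = slice (4 * p) (fun i => B i k).
Proof.
have h0 : a (bv (0 + k)) = slice 0 (fun i => B i k) by exact: ext_slice.
have h3 : a (bv (12 + k)) = slice 12 (fun i => B i k).
  by apply: move_slice (@moves_intoP 3 false 0 12 4 _) h0; vm_compute.
have h2 : a (bv (8 + k)) = slice 8 (fun i => B i k).
  by apply: move_slice (@moves_intoP 2 false 12 8 4 _) h3; vm_compute.
have h1 : a (bv (4 + k)) = slice 4 (fun i => B i k).
  by apply: move_slice (@moves_intoP 1 false 8 4 4 _) h2; vm_compute.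
by case: p => [|[|[|[|]]]].
Qed.

Lemma G_N p (k : 'I_4) : (p < 4)%N ->
  a (bv (16 + 4 * p + k)) = slice (16 + 4 * p) (fun i => C i k).
Proof.
have h3 : a (bv (28 + k)) = slice 28 (fun i => C i k) by exact: ext_slice.
have h0 : a (bv (16 + k)) = slice 16 (fun i => C i k).
  by apply: move_slice (@moves_intoP 3 true 28 16 4 _) h3; vm_compute.
have h1 : a (bv (20 + k)) = slice 20 (fun i => C i k).
  by apply: move_slice (@moves_intoP 0 true 16 20 4 _) h0; vm_compute.
have h2 : a (bv (24 + k)) = slice 24 (fun i => C i k).
  by apply: move_slice (@moves_intoP 1 true 20 24 4 _) h1; vm_compute.
by case: p => [|[|[|[|]]]].
Qed.

Lemma G_S p (m : 'I_2) : (p < 6)%N ->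
  a (bv (32 + 2 * p + m)) = slice (32 + 2 * p) (fun i => A i m).
Proof.
have h0 : a (bv (32 + m)) = slice 32 (fun i => A i m) by exact: ext_slice.
have h4 : a (bv (40 + m)) = slice 40 (fun i => A i m).
  by apply: move_slice (@moves_intoP 3 false 32 40 2 _) h0; vm_compute.
have h3 : a (bv (38 + m)) = slice 38 (fun i => A i m).
  by apply: move_slice (@moves_intoP 2 true 40 38 2 _) h4; vm_compute.
have h1 : a (bv (34 + m)) = slice 34 (fun i => A i m).
  by apply: move_slice (@moves_intoP 0 false 38 34 2 _) h3; vm_compute.
have h2 : a (bv (36 + m)) = slice 36 (fun i => A i m).
  by apply: move_slice (@moves_intoP 0 false 40 36 2 _) h4; vm_compute.
have h5 : a (bv (42 + m)) = slice 42 (fun i => A i m).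
  by apply: move_slice (@moves_intoP 3 false 34 42 2 _) h1; vm_compute.
by case: p => [|[|[|[|[|[|]]]]]].
Qed.

Lemma slice_lin s l (D : 'M[K]_l) (x : 'I_l -> K) :
  (forall k : 'I_l, a (bv (s + k)) = slice s (fun i => D i k)) ->
  a (slice s x) = slice s (fun i => \sum_k D i k * x k).
Proof.
move=> h; rewrite (lf_sum _ _ lin).
under eq_bigr => k _ do rewrite (lfZ lin) h scaler_sumr.
rewrite exchange_big; apply: eq_bigr => i _; rewrite scaler_suml.
by apply: eq_bigr => k _; rewrite scalerA mulrC.
Qed.

Definition unitf l (k i : 'I_l) : K := (i == k)%:R.
Lemma slice_unit s l (k : 'I_l) : slice s (unitf k) = bv (s + k).
Proof.
rewrite sliceE (bigD1 k) //= /unitf eqxx scale1r big1 ?addr0 // => i /negPf ->.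
by rewrite scale0r.
Qed.

Lemma slice_inj s l (x y : 'I_l -> K) : (s + l <= 56)%N -> slice s x = slice s y -> x =1 y.
Proof. by move=> sl e i; rewrite -(cf_slice x i sl) e cf_slice. Qed.

End Element.
End Reduction.

(** * Relations between the blocks *)

Section Relations.
Variable K : numClosedFieldType.
Local Notation bv := (@bv K).
Local Notation cf := (@cf K).
Local Notation slice := (@slice K).
Local Notation G := (E7_sigma'4_so6 K).

Lemma sum4 (V : nmodType) (F : 'I_4 -> V) : \sum_i F i =
  F (inord 0) + (F (inord 1) + (F (inord 2) + (F (inord 3) + 0))).
Proof.
rewrite !big_ord_recl big_ord0.
by congr (F _ + (F _ + (F _ + (F _ + _)))); apply: val_inj; rewrite /= inordK.
Qed.

Lemma det_mx22 (A : 'M[K]_2) : \det A = A 0 0 * A 1 1 - A 0 1 * A 1 0.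
Proof.
rewrite (expand_det_row _ 0) !big_ord_recl big_ord0 /cofactor !det_mx11 !mxE /= addr0.
rewrite expr0 expr1 mul1r mulN1r mulrN.
by congr (A _ _ * A _ _ - A _ _ * A _ _); apply: val_inj.
Qed.

Lemma det_mx33 (F : nat -> nat -> K) :
  \det (\matrix_(i < 3, j < 3) F i j) =
  F 0%N 0%N * (F 1%N 1%N * F 2%N 2%N - F 1%N 2%N * F 2%N 1%N) - F 0%N 1%N * (F 1%N 0%N * F 2%N 2%N - F 1%N 2%N * F 2%N 0%N)
  + F 0%N 2%N * (F 1%N 0%N * F 2%N 1%N - F 1%N 1%N * F 2%N 0%N).
Proof.
rewrite (expand_det_row _ 0) !big_ord_recl big_ord0 /cofactor !det_mx22 !mxE /=.
by rewrite /bump /=; ring.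
Qed.

(** Expansion along the last column, in which the minors of [wedge3] appear. *)
Lemma det_mx44 (F : nat -> nat -> K) :
  let m k l m := F k 0%N * (F l 1%N * F m 2%N - F m 1%N * F l 2%N) - F l 0%N * (F k 1%N * F m 2%N - F m 1%N * F k 2%N)
     + F m 0%N * (F k 1%N * F l 2%N - F l 1%N * F k 2%N) in
  \det (\matrix_(i < 4, j < 4) F i j) =
  - F 0%N 3%N * m 1%N 2%N 3%N + F 1%N 3%N * m 0%N 2%N 3%N - F 2%N 3%N * m 0%N 1%N 3%N + F 3%N 3%N * m 0%N 1%N 2%N.
Proof.
have e (i j : 'I_4) : row' i (col' j (\matrix_(i < 4, j < 4) F i j)) =
    \matrix_(i' < 3, j' < 3) F (bump i i') (bump j j').
  by apply/matrixP => i' j'; rewrite !mxE.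
rewrite (expand_det_col _ (Ordinal (isT : 3 < 4)%N)) !big_ord_recl big_ord0 /cofactor !e.
rewrite !(det_mx33 (fun i j => F (bump _ i) (bump _ j))) !mxE /=.
by rewrite /bump /=; ring.
Qed.

Section Element.
Variables (a : freudenthal K -> freudenthal K) (Ga : G a).
Let lin : linear a := G_linear Ga.
Local Notation A := (blk a 32 2).
Local Notation B := (blk a 0 4).
Local Notation C := (blk a 28 4).

Lemma G_inj : injective a.
Proof. by have [[_ [b [ab _ _]]] _ _] := Ga; apply: can_inj ab. Qed.

(** Injectivity of a provides a nonzero entry in each column; dividing by it extracts scalar
    relations from vector identities. *)
Lemma G_col s l (D : 'M[K]_l) (k : 'I_l) : (s + l <= 56)%N ->
  a (bv (s + k)) = slice s (fun i => D i k) -> exists i, D i k != 0.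
Proof.
move=> sl e; apply/existsP; apply: contraT; rewrite negb_exists => /forallP D0.
have : a (bv (s + k)) = a 0.
  rewrite e (lf0 lin) sliceE big1 // => i _.
  by move: (D0 i); rewrite negbK => /eqP ->; rewrite scale0r.
move/G_inj => /(congr1 (cf (s + k))); rewrite cf0 cf_bv ?eqxx ?(leq_trans _ sl) ?ltn_add2l //.
by move/eqP; rewrite oner_eq0.
Qed.

Lemma S_unit p (m : 'I_2) : (p < 6)%N ->
  a (slice (32 + 2 * p) (unitf K m)) = slice (32 + 2 * p) (fun i => A i m).
Proof. by move=> lp; rewrite slice_unit G_S. Qed.
Lemma M_unit p (m : 'I_4) : (p < 4)%N ->
  a (slice (4 * p) (unitf K m)) = slice (4 * p) (fun i => B i m).
Proof. by move=> lp; rewrite slice_unit G_M. Qed.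
Lemma N_unit p (m : 'I_4) : (p < 4)%N ->
  a (slice (16 + 4 * p) (unitf K m)) = slice (16 + 4 * p) (fun i => C i m).
Proof. by move=> lp; rewrite slice_unit G_N. Qed.

Lemma G_detS : \det A = 1.
Proof.
have := sqS (unitf K ord0) (unitf K (ord_max : 'I_2)) => /(congr1 a).
rewrite G_cross // (lfD lin) (S_unit _ (isT : 0 < 6)%N) (S_unit _ (isT : 5 < 6)%N).
rewrite (S_unit _ (isT : 0 < 6)%N) sqS.
rewrite (slice_lin (s := 32) Ga (D := A)) => [|k]; last exact: (G_S Ga k (isT : 0 < 6)%N).
move/(slice_inj (s := 32) (l := 2) isT) => e.
have [i Ai] := G_col (isT : 32 + 2 <= 56)%N (G_S Ga ord0 (isT : 0 < 6)%N).
have := e i; rewrite /unitf (bigD1 ord0) //= big1 => [|k /negPf ->]; last by rewrite !mulr0.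
rewrite addr0 ?eqxx /= ?mulr1 ?mulr0 ?subr0 ?mulr1. rewrite [RHS]mulrC => /(mulIf Ai).
have n2 : -2 != 0 :> K by rewrite oppr_eq0 pnatr_eq0.
rewrite -[RHS]mulr1 => /(mulfI n2) <-.
rewrite det_mx22 [X in _ - X]mulrC.
have o1 : 1 = ord_max :> 'I_2 by apply: val_inj.
have o0 : 0 = ord0 :> 'I_2 by apply: val_inj.
by rewrite o1 o0.
Qed.

Lemma G_dot (k j : 'I_4) : dot4 (fun i => B i k) (fun i => C i j) = (k == j)%:R.
Proof.
have := sqMN (unitf K k) (unitf K j) (unitf K ord0) => /(congr1 a).
rewrite G_cross // (lfD lin) (M_unit _ (isT : 0 < 4)%N) (N_unit _ (isT : 0 < 4)%N).
rewrite (S_unit _ (isT : 0 < 6)%N) sqMN.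
rewrite (slice_lin (s := 32) Ga (D := A)) => [|m]; last exact: (G_S Ga m (isT : 0 < 6)%N).
move/(slice_inj (s := 32) (l := 2) isT) => e.
have [i Ai] := G_col (isT : 32 + 2 <= 56)%N (G_S Ga ord0 (isT : 0 < 6)%N).
have := e i; rewrite (bigD1 ord0) //= big1 => [|m /negPf h]; last first.
  by rewrite [unitf K ord0 m]/unitf h !mulr0.
rewrite [unitf K ord0 ord0]/unitf eqxx mulr1 addr0 [RHS]mulrC => /(mulIf Ai)/oppr_inj ->.
rewrite /dot4 (bigD1 k) //= /unitf eqxx mul1r big1 ?addr0 // => m /negPf ->.
by rewrite mul0r.
Qed.

Lemma G_BC : B^T *m C = 1.
Proof.
apply/matrixP => k j; rewrite !mxE -G_dot; apply: eq_bigr => i _.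
by rewrite mxE.
Qed.

Lemma wedge3_unit (i : 'I_4) :
  wedge3 (unitf K (inord 0)) (unitf K (inord 1)) (unitf K (inord 2)) i = (i == inord 3)%:R.
Proof.
have u k l : (k < 4)%N -> (l < 4)%N -> unitf K (inord k : 'I_4) (inord l) = (l == k)%:R.
  by move=> lk ll; rewrite /unitf -val_eqE /= !inordK.
rewrite /wedge3 /minor3K !u // /= -val_eqE /= inordK //.
by case: i => [[|[|[|[|i]]]] li] //=; rewrite !(mulr0, mulr1, subr0, addr0, oppr0).
Qed.

Lemma G_wedge i : C i (inord 3) = wedge3 (B^~ (inord 0)) (B^~ (inord 1)) (B^~ (inord 2)) i.
Proof.
have := sqMMM (unitf K (inord 0)) (unitf K (inord 1)) (unitf K (inord 2)) => /(congr1 a).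
rewrite G_cross // (lfD lin) (M_unit _ (isT : 0 < 4)%N) (M_unit _ (isT : 1 < 4)%N).
rewrite (M_unit _ (isT : 2 < 4)%N) sqMMM.
rewrite (slice_lin (s := 28) Ga (D := C)) => [|m]; last exact: (G_N Ga m (isT : 3 < 4)%N).
move/(slice_inj (s := 28) (l := 4) isT) => /(_ i).
rewrite (bigD1 (inord 3)) //= big1 => [|m /negPf h]; last by rewrite wedge3_unit h !mulr0.
rewrite wedge3_unit eqxx mulr1 addr0 mulrC => /mulIf -> //.
Qed.

(** The last column of C consists of the signed minors of the first three columns of B, so the
    expansion of det B along its last column is the last diagonal entry of B^T C. *)
Lemma G_detM : \det B = 1.
Proof.
rewrite -[RHS](_ : true%:R = _) // -(eqxx (inord 3 : 'I_4)) -G_dot.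
pose F i j := B (inord i) (inord j).
have -> : B = \matrix_(i < 4, j < 4) F i j by apply/matrixP => i j; rewrite [RHS]mxE /F !inord_val.
rewrite det_mx44 /dot4 sum4 !G_wedge /wedge3 !inordK // /minor3K /= -!/(F _ _).
by rewrite !mxE !inordK //; ring.
Qed.

End Element.
End Relations.

(** * Reconstruction of an element from its blocks *)

Section Gamma.
Variable K : numClosedFieldType.
Local Notation bv := (@bv K).
Local Notation cf := (@cf K).
Local Notation slice := (@slice K).
Local Notation G := (E7_sigma'4_so6 K).

Definition Tcol (A : 'M[K]_2) (B : 'M[K]_4) (p : nat) (m : 'I_2) : freudenthal K :=
  \sum_(p' < 6) \sum_(m' < 2)
    (minorK (B^~ (inord (pl p).1)) (B^~ (inord (pl p).2)) p' * A m' m) *: bv (wT p' m').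

(** Meaningful for arbitrary matrices and polynomial in their entries, so that the inverse of the
    isomorphism is continuous. Elements of the group satisfy it with C inverse to B^T. *)
Definition Gam (A : 'M[K]_2) (B C : 'M[K]_4) (P : freudenthal K) : freudenthal K :=
  \sum_(p < 4) \sum_(k < 4) cf (0 + 4 * p + k) P *: slice (4 * p) (B^~ k)
  + \sum_(p < 4) \sum_(k < 4) cf (16 + 4 * p + k) P *: slice (16 + 4 * p) (C^~ k)
  + \sum_(p < 6) \sum_(m < 2) cf (32 + 2 * p + m) P *: slice (32 + 2 * p) (A^~ m)
  + \sum_(p < 6) \sum_(m < 2) cf (44 + 2 * p + m) P *: Tcol A B p m.

Lemma minorK_unit (p q : nat) : (p < 6)%N -> (q < 6)%N ->
  minorK (unitf K (inord (pl p).1)) (unitf K (inord (pl p).2)) q = (q == p)%:R.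
Proof.
have u k l : (k < 4)%N -> (l < 4)%N -> unitf K (inord k : 'I_4) (inord l) = (l == k)%:R.
  by move=> lk ll; rewrite /unitf -val_eqE /= !inordK.
have pl4 r : (r < 6)%N -> ((pl r).1 < 4)%N /\ ((pl r).2 < 4)%N.
  by case: r => [|[|[|[|[|[|]]]]]].
move=> lp lq; have [p1 p2] := pl4 _ lp; have [q1 q2] := pl4 _ lq.
rewrite /minorK !u //.
by case: p lp {p1 p2} => [|[|[|[|[|[|p]]]]]] // _; case: q lq {q1 q2} => [|[|[|[|[|[|q]]]]]] // _;
  rewrite /= !(mulr0, mulr1, mul0r, subr0, subrr, sub0r, oppr0).
Qed.

Lemma big_iota_mul (V : nmodType) s l m (F : nat -> V) :
  \sum_(n <- iota s (l * m)) F n = \sum_(p < l) \sum_(k < m) F (s + m * p + k)%N.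
Proof.
elim: l s => [|l IH] s; first by rewrite big_nil big_ord0.
rewrite mulSn iotaD big_cat big_ord_recl IH sum_iota muln0 addn0; congr (_ + _).
by apply: eq_bigr => p _; apply: eq_bigr => k _; rewrite mulnS addnA.
Qed.

Section Element.
Variables (a : freudenthal K -> freudenthal K) (Ga : G a).
Let lin : linear a := G_linear Ga.
Local Notation A := (blk a 32 2).
Local Notation B := (blk a 0 4).
Local Notation C := (blk a 28 4).

(** By [sqMM], unit vectors k and l in two copies of V and a unit vector of U produce, up to the
    factor -2, the basis vector of U (x) Lambda^2 V numbered by the pair kl; equivariance then
    determines its image. *)
Lemma G_T p (m : 'I_2) : (p < 6)%N -> a (bv (44 + 2 * p + m)) = Tcol A B p m.
Proof.
move=> lp; pose k : 'I_4 := inord (pl p).1; pose l : 'I_4 := inord (pl p).2.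
have := sqMM (unitf K k) (unitf K l) (unitf K m) => /(congr1 a).
rewrite G_cross // (lfD lin) (M_unit Ga _ (isT : 0 < 4)%N) (M_unit Ga _ (isT : 1 < 4)%N).
rewrite (S_unit Ga _ (isT : 5 < 6)%N) sqMM.
have -> : \sum_(p' < 6) \sum_(m' < 2)
    (-2 * (minorK (unitf K k) (unitf K l) p' * unitf K m m')) *: bv (wT p' m')
    = (-2) *: bv (44 + 2 * p + m).
  rewrite (bigD1 (Ordinal lp)) //= [X in _ + X]big1 => [|q /negPf qp]; last first.
    rewrite big1 // => m' _; rewrite minorK_unit // [(_ == _)]qp.
    by rewrite mul0r mulr0 scale0r.
  rewrite (bigD1 m) //= [X in _ + X + _]big1 => [|m' /negPf mm]; last first.
    by rewrite /unitf mm !mulr0 scale0r.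
  by rewrite minorK_unit // /unitf !eqxx mulr1 mulr1 !addr0.
have n2 : -2 != 0 :> K by rewrite oppr_eq0 pnatr_eq0.
rewrite (lfZ lin) => e; apply: (scalerI n2); rewrite -e /Tcol scaler_sumr.
apply: eq_bigr => p' _; rewrite scaler_sumr; apply: eq_bigr => m' _.
by rewrite scalerA.
Qed.

Lemma G_Gam P : a P = Gam A B C P.
Proof.
rewrite {1}[P]cf_sum (lf_sum _ _ lin) /Gam.
under eq_bigr => n _ do rewrite (lfZ lin).
rewrite (iotaD 0 44 12) (iotaD 0 32 12) (iotaD 0 16 16) !big_cat /= !add0n.
rewrite (big_iota_mul 0 4 4) (big_iota_mul 16 4 4) (big_iota_mul 32 6 2) (big_iota_mul 44 6 2).
have cg (V : zmodType) (x y z t x' y' z' t' : V) : x = x' -> y = y' -> z = z' -> t = t' ->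
  x + y + z + t = x' + y' + z' + t' by move=> -> -> -> ->.
apply: cg; apply: eq_bigr => p _; apply: eq_bigr => k _.
- by rewrite -(G_M Ga k (ltn_ord p)).
- by rewrite -(G_N Ga k (ltn_ord p)).
- by rewrite -(G_S Ga k (ltn_ord p)).
- by rewrite -(G_T k (ltn_ord p)).
Qed.
End Element.

Lemma blk_comp (a b : freudenthal K -> freudenthal K) s l : G a -> G b ->
  (s, l) \in [:: (0, 4); (28, 4); (32, 2)]%N ->
  blk (a \o b) s l = blk a s l *m blk b s l.
Proof.
move=> Ga Gb sl; apply/matrixP => i j; rewrite !mxE /= (ext_slice Gb j sl).
have le : (s + l <= 56)%N by move: sl; rewrite !inE => /or3P[] /eqP[-> ->].
rewrite (slice_lin Ga (D := blk a s l)) => [|k]; last exact: ext_slice.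
by rewrite cf_slice.
Qed.
End Gamma.

(** * Generation by elementary matrices *)

Section ElementaryGeneration.
Variables (K : fieldType) (n : nat).

Definition elem (i j : 'I_n) (t : K) : 'M[K]_n := 1%:M + t *: delta_mx i j.

Lemma elem_mulE i j t m (A : 'M[K]_(n, m)) r c :
  (elem i j t *m A) r c = A r c + (r == i)%:R * (t * A j c).
Proof.
rewrite mulmxDl mul1mx -scalemxAl !mxE; congr (_ + _).
rewrite (bigD1 j) //= big1 => [|k /negPf kj]; last by rewrite mxE kj andbF mul0r.
by rewrite !mxE eqxx andbT addr0 mulrCA.
Qed.

Lemma elem_add i j t u : i != j -> elem i j t *m elem i j u = elem i j (t + u).
Proof.
move=> ij; rewrite /elem mulmxDl mul1mx -scalemxAl mulmxDr mulmx1 -scalemxAr.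
by rewrite mul_delta_mx_0 1?eq_sym // !scaler0 addr0 -addrA -scalerDl [u + t]addrC.
Qed.

Lemma elem0 i j : elem i j 0 = 1%:M. Proof. by rewrite /elem scale0r addr0. Qed.

Lemma elem_comm i j k t : i != j -> j != k -> i != k ->
  elem i j t *m (elem j k 1 *m (elem i j (- t) *m elem j k (-1))) = elem i k t.
Proof.
move=> ij jk ik; apply/matrixP => r c.
rewrite -[elem j k (-1)]mulmx1 -[elem i k t]mulmx1 !elem_mulE !mxE !eqxx.
rewrite !(eq_sym j i, eq_sym k j, eq_sym k i) (negPf ij) (negPf jk) (negPf ik).
have [-> ->] : true%:R = 1 :> K /\ false%:R = 0 :> K by [].
by move: (r == i)%:R (r == j)%:R (r == c)%:R (k == c)%:R (j == c)%:R => x y z u v; ring.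
Qed.

(** Two commuting root groups: opposite parameters in the second cancel, while the first doubles.
    This isolates E_ij when only products with E_kl are available. *)
Lemma elem_double i j k l t u : i != j -> k != l -> i != l -> k != j ->
  elem i j t *m elem k l u *m (elem i j t *m elem k l (- u)) = elem i j (t + t).
Proof.
move=> ij kl il kj; have kji : elem k l u *m elem i j t = elem i j t *m elem k l u.
  rewrite /elem !mulmxDl !mulmxDr !mul1mx !mulmx1 -!scalemxAl -!scalemxAr.
  by rewrite !mul_delta_mx_0 1?eq_sym // !scaler0 !addr0 -!addrA [X in _ + X]addrC.
rewrite mulmxA -(mulmxA _ (elem k l u)) kji mulmxA elem_add // -mulmxA elem_add //.
by rewrite subrr elem0 mulmx1.
Qed.

Lemma det_elem i j t : i != j -> \det (elem i j t) = 1.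
Proof.
have lower (k l : 'I_n) : (l < k)%N -> \det (elem k l t) = 1.
  move=> lk; rewrite det_trig => [|]; last first.
    apply/is_trig_mxP => r c rc; rewrite !mxE -val_eqE /= (ltn_eqF rc) add0r.
    case: eqP => [e|_]; last by rewrite mulr0.
    case: eqP => [e'|_]; last by rewrite mulr0.
    by move: rc; rewrite e e' ltnNge (ltnW lk).
  rewrite big1 // => r _; rewrite !mxE eqxx; case: eqP => [->|_]; last by rewrite mulr0 addr0.
  by rewrite -val_eqE /= gtn_eqF // mulr0 addr0.
rewrite neq_ltn => /orP[ij|]; last exact: lower.
by rewrite -det_tr /elem linearD linearZ /= trmx1 trmx_delta; apply: lower.
Qed.

Variable S : 'M[K]_n -> Prop.
Hypotheses (S1 : S 1%:M) (SM : forall A B, S A -> S B -> S (A *m B)).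
Hypothesis Selem : forall i j t, i != j -> S (elem i j t).

Lemma gen_row i j t A : i != j -> S (elem i j t *m A) -> S A.
Proof.
move=> ij SA; rewrite -[A]mul1mx -(elem0 i j) -(addNr t) -elem_add // -mulmxA.
by apply: SM SA; apply: Selem.
Qed.

(** With pivot 1, row i is cleared by adding -A i k times row k. Row k itself never changes, so the
    successive operations have a closed form. *)
Lemma gen_clear k (s : seq 'I_n) (A : 'M[K]_n) : k \notin s -> uniq s -> A k k = 1 ->
  (forall A' : 'M[K]_n, (forall r c, A' r c = A r c - (r \in s)%:R * (A r k * A k c)) ->
     \det A' = \det A -> S A') -> S A.
Proof.
elim: s A => [|i s IH] A.
  by move=> _ _ _; apply=> // r c; rewrite in_nil mul0r subr0.
rewrite inE negb_or => /andP[ki ks] /andP[nis us] A1 SA.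
have ik : i != k by rewrite eq_sym.
apply: (@gen_row i k (- A i k)) => //.
have ek c : (elem i k (- A i k) *m A) k c = A k c.
  by rewrite elem_mulE (negPf ki) mul0r addr0.
apply: IH => //; first by rewrite ek.
move=> A' eA' dA'; apply: SA => [r c|]; last by rewrite dA' det_mulmx det_elem // mul1r.
rewrite eA' !ek !elem_mulE inE.
have [->|ri] /= := eqVneq r i; first by rewrite (negPf nis) !mul0r !mul1r subr0 mulNr.
by rewrite !mul0r !addr0.
Qed.

Definition fixes (k : nat) (A : 'M[K]_n) := forall r c : 'I_n, (c < k)%N -> A r c = (r == c)%:R.

Lemma fixes_pivot (k : 'I_n) A : \det A = 1 -> fixes k A ->
  (forall i : 'I_n, (k < i)%N -> A i k = 0) -> A k k != 0.
Proof.
move=> dA fA A0; apply/eqP => Akk.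
have uA : A \in unitmx by rewrite unitmxE dA unitr1.
(* v is e_k minus the part of column k above the pivot. As the earlier columns are standard and
   nothing lies below, A v = A k k e_k, so a zero pivot would give a kernel vector. *)
pose v : 'cV[K]_n := \col_i ((i == k)%:R - (i < k)%N%:R * A i k).
have : A *m v = 0.
  apply/matrixP => r c; rewrite !mxE.
  under eq_bigr => i _ do rewrite mxE mulrBr.
  rewrite sumrB (bigD1 k) //= big1 => [|i /negPf ->]; last by rewrite mulr0.
  rewrite eqxx mulr1 addr0 (bigD1 r) //= big1 => [|i ir]; last first.
    case: ltnP => [ik|]; last by rewrite mul0r mulr0.
    by rewrite fA // eq_sym (negPf ir) mul0r.
  case: (ltngtP r k) => [rk|rk|/val_inj ->].
  - by rewrite (fA r r rk) eqxx !mul1r addr0 subrr.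
  - by rewrite A0 // !mul0r mulr0 addr0 subrr.
  - by rewrite Akk !mul0r addr0 subrr.
move/(congr1 (mulmx (invmx A))); rewrite mulKmx // mulmx0 => /matrixP/(_ k 0).
by rewrite !mxE eqxx ltnn mul0r subr0 => /eqP; rewrite oner_eq0.
Qed.

Lemma fixes_elem k (i j : 'I_n) t A : (k <= j)%N -> fixes k A -> fixes k (elem i j t *m A).
Proof.
move=> kj fA r c ck; have jc : (j == c) = false by rewrite -val_eqE /= gtn_eqF ?(leq_trans ck).
by rewrite elem_mulE (fA j c ck) jc !mulr0 addr0 fA.
Qed.

Lemma elementary_generation A : \det A = 1 -> S A.
Proof.
move=> dA; suff H m k B : (k + m = n)%N -> \det B = 1 -> fixes k B -> S B.
  by apply: (H n 0%N).
elim: m k B => [|m IH] k B; first rewrite addn0 => -> _ fB.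
  suff -> : B = 1%:M by [].
  by apply/matrixP => r c; rewrite fB // mxE.
move=> km dB fB; have ltk : (k < n)%N by rewrite -km addnS ltnS leq_addr.
pose kk := Ordinal ltk.
have pivot1 C : \det C = 1 -> fixes k C -> C kk kk = 1 -> S C.
  move=> dC fC C1; pose s := rem kk (enum 'I_n).
  have us : uniq (enum 'I_n) := enum_uniq _.
  have ms i : (i \in s) = (i != kk) by rewrite mem_rem_uniq // inE mem_enum andbT.
  apply: (@gen_clear kk s) => //; [by rewrite ms eqxx|exact: rem_uniq|].
  move=> C' eC' dC'; apply: (IH k.+1); [by rewrite -km addSnnS|by rewrite dC'|].
  move=> r c; rewrite ltnS leq_eqVlt => /orP[/eqP ck|ck]; rewrite eC' ms.
    have -> : c = kk by apply: val_inj.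
    by rewrite C1 mulr1; have [->|_] /= := eqVneq r kk; rewrite ?C1 ?mul0r ?subr0 // mul1r subrr.
  have kc : (kk == c) = false by rewrite -val_eqE /= gtn_eqF.
  by rewrite (fC r c ck) (fC kk c ck) kc !mulr0 subr0.
have pivot2 C : \det C = 1 -> fixes k C -> (exists2 i : 'I_n, (k < i)%N & C i kk != 0) -> S C.
  move=> dC fC [i ki Ci]; have ik : kk != i by rewrite -val_eqE /= ltn_eqF.
  apply: (@gen_row kk i ((1 - C kk kk) / C i kk)) => //; apply: pivot1.
  - by rewrite det_mulmx det_elem // mul1r.
  - by apply: fixes_elem => //; apply: ltnW.
  - by rewrite elem_mulE eqxx mul1r mulfVK // addrC subrK.
case: (pselect (exists2 i : 'I_n, (k < i)%N & B i kk != 0)) => [|B0]; first exact: pivot2.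
have {}B0 (i : 'I_n) : (k < i)%N -> B i kk = 0.
  by move=> ki; apply/eqP; apply: contraT => Bi; case: B0; exists i.
have Bkk : B kk kk != 0 := @fixes_pivot kk B dB fB B0.
(* Below the nonzero pivot the column vanishes. If there is a next row, adding row k to it supplies
   the entry required by [pivot2]. *)
case: (ltnP k.+1 n) => [k1|k1].
  have ne : Ordinal k1 != kk by rewrite -val_eqE /= gtn_eqF.
  apply: (@gen_row (Ordinal k1) kk 1) => //; apply: pivot2.
  - by rewrite det_mulmx det_elem // mul1r.
  - exact: fixes_elem.
  - by exists (Ordinal k1) => //; rewrite elem_mulE eqxx mul1r B0 ?add0r ?mul1r.
apply: pivot1 => //.
(* Now k is the last index: B is upper triangular with 1 at the earlier diagonal places, so the
   pivot equals det B. *)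
have : \det B^T = 1 by rewrite det_tr.
rewrite det_trig => [|]; last first.
  apply/is_trig_mxP => r c rc; rewrite mxE fB ?(leq_trans rc) //.
    by rewrite -val_eqE /= gtn_eqF.
  by rewrite -ltnS (leq_trans (ltn_ord c)).
rewrite (bigD1 kk) //= big1 => [|i ik]; first by rewrite mulr1 mxE.
have ik' : (i < k)%N.
  by rewrite ltn_neqAle -ltnS (leq_trans (ltn_ord i)) // andbT -(inj_eq val_inj) in ik *.
by rewrite mxE fB // eqxx.
Qed.
End ElementaryGeneration.

(** * Realizing SL(2) x SL(4) by exponentials *)

Section Generation.
Variable K : numClosedFieldType.
Local Notation onK f := (f _ (@gval K) (fun x y : K => x + y) (fun x y : K => x * y)).
Local Notation gv := (@gval K).
Local Notation hPK lem env :=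
  (lem _ _ _ _ _ _ _ _ (peval env) (@peval_cst K env) (@peval_add K env) (@peval_mul K env)).
Local Notation bv := (@bv K).
Local Notation cf := (@cf K).
Local Notation slice := (@slice K).

(** Sparse coordinates of the five root elements, in the numbering used by [gen_check]. *)
Definition rootl : seq (seq (nat * (Z * Z))) :=
  [:: [:: (0, gone)]; [:: (1, gone)]; [:: (2, gone)]; [:: (3, gone); (4, (Z0, 1%ZZ))];
      [:: (3, gone); (4, (Z0, (-1)%ZZ))]]%N.

Lemma rootlP r : (r < 5)%N -> exists2 A : jordan K, root_elt A &
  jco A = [seq gv (gcoef (nth [::] rootl r) k) | k <- iota 0 27].
Proof.
case: r => [|[|[|[|[|//]]]]] _.
- by exists (jordanE K ord0); [exact: root_E|rewrite jco_E].
- by exists (jordanE K (Ordinal (isT : 1 < 3)%N)); [exact: root_E|rewrite jco_E].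
- by exists (jordanE K (Ordinal (isT : 2 < 3)%N)); [exact: root_E|rewrite jco_E].
- by exists (e1F 'i); [exact: root_Fi|rewrite -gval_i jco_e1F].
- by exists (e1F (- 'i)); [exact: root_FNi|rewrite -gval_Ni jco_e1F].
Qed.

Definition gen_img (r : nat) (fl : bool) (n : nat) : seq gpol :=
  let A := pvec (nth [::] rootl r) in let v := map pcst (wvec n) in
  if fl then flam pcst pmul (onP fexp A (scli pcst pmul (-1)%ZZ (flam pcst pmul v)))
  else onP fexp A v.

(* (r, fl, s, i, j, c): on the block at offset s the r-th root element with
   parameter t, conjugated by flip if fl, is 1 + c t E_ij. *)
Definition gen_check (q : nat * bool * nat * nat * nat * Z) :=
  let: (r, fl, s, i0, j0, c) := q in
  (r < 5)%N && all (fun sl : nat * nat => all (fun i => all (fun j =>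
    Ring_polynom.Peq geqb (pform (sl.1 + i) (gen_img r fl (sl.1 + j)))
      (pmul (intc pcst 2%ZZ) (padd (pcst (if i == j then gone else gzero))
        (pmul (intc pcst (if [&& sl.1 == s, i == i0 & j == j0] then c else Z0)) (pvar 112)))))
   (iota 0 sl.2)) (iota 0 sl.2)) [:: (0, 4); (32, 2)]%N.

Lemma gen_cf r fl s i0 j0 c t : gen_check (r, fl, s, i0, j0, c) ->
  exists2 a, word a & forall s' l (i j : 'I_l), (s', l) \in [:: (0, 4); (32, 2)]%N ->
    cf (s' + i) (a (bv (s' + j))) =
    (i == j)%:R + [&& s' == s, i == i0 :> nat & j == j0 :> nat]%:R * (zval K c * t).
Proof.
move=> /andP[r5 chk]; have [A rA eA] := rootlP r5.
exists (if fl then @flip K \o (expA (t *: A) \o @unflip K) else expA (t *: A)).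
  by case: {chk} fl; [exact: word_flip|exact: word_exp].
move=> s' l i j sl.
move: chk => /allP/(_ _ sl)/allP/(_ i); rewrite mem_iota ltn_ord => /(_ isT).
move=> /allP/(_ j); rewrite mem_iota ltn_ord => /(_ isT) chk.
set a := if fl then _ else _.
pose env : seq K := fco (0 : freudenthal K) ++ (fco (0 : freudenthal K) ++ [:: t]).
have [_ _ et] := env56 (0 : freudenthal K) 0 t; rewrite -/env in et.
have ei n : fco (a (bv n)) = map (peval env) (gen_img r fl n).
  have ep := peval_pvec 0 0 t (nth [::] rootl r); rewrite -/env in ep.
  rewrite /a /gen_img; case: (fl); rewrite /comp ?fco_flip fco_expA jcoZ eA -ep.
    rewrite /unflip -scaleN1r fcoZ fco_flip fco_bv (map_gval env).
    rewrite (h_flam (peval_cst env) (peval_mul env)) (hPK h_fexp env).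
    rewrite (h_scli (peval_cst env) (peval_mul env)) (h_flam (peval_cst env) (peval_mul env)).
    by rewrite /scli intcN1.
  by rewrite fco_bv (map_gval env) (hPK h_fexp env).
apply: (mulfI (nat_unit K 1)); rewrite -[cf (s' + i) _]/(2^-1 * onK dotv (map gv (wform (s' + i))) (fco _)) mulVKf ?nat_unit //.
rewrite ei (map_gval env) -(h_dotv (peval_cst _) (peval_add _) (peval_mul _)) -/(pform _ _).
rewrite (peq1_eval _ chk) !(peval_mul, peval_add) !(h_intc (peval_cst env)) et peval_cst !intcE.
have [_ -> _ _ _] := zvalE K; rewrite /=; congr (_ * (_ + _)).
  by rewrite -val_eqE /=; case: eqP => _; [rewrite -[LHS]/(intc gv 1%ZZ) intcE|exact: intc0].
by case: and3P => _; rewrite ?mul1r ?mul0r.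
Qed.

(** Blocks A and B are enough: the third one is determined by B^T C = 1. *)
Definition realized (A : 'M[K]_2) (B : 'M[K]_4) :=
  exists2 a, word a & blk a 32 2 = A /\ blk a 0 4 = B.

Lemma realized_mul A B A' B' : realized A B -> realized A' B' -> realized (A *m A') (B *m B').
Proof.
move=> [a wa [<- <-]] [b wb [<- <-]]; exists (a \o b); first exact: word_comp.
by rewrite !(blk_comp (word_G wa) (word_G wb)).
Qed.

(** E_1 and its conjugate by [flip] give the two root groups of SL(2) and act trivially on V;
    dividing t by the constant of [gen_check] normalizes the parameter. *)
Lemma realized_S (i j : 'I_2) t : i != j -> realized (elem i j t) 1%:M.
Proof.
have [c1 _ _ _ [cm1 _ _ _ _]] := zvalE K.
have gen (fl : bool) (i0 j0 : 'I_2) c : zval K c != 0 -> gen_check (0, fl, 32, i0 : nat, j0 : nat, c)%N ->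
    realized (elem i0 j0 t) 1%:M.
  move=> c0 /(gen_cf (t / zval K c)) [a wa ea]; exists a => //; split; apply/matrixP => k l.
    by rewrite !mxE ea // (mulrC (zval K c)) mulfVK // (mulrC t).
  by rewrite !mxE ea // mul0r addr0.
case: i j => [[|[|i]]] // li [[|[|j]]] // lj _.
- by apply: (gen true _ _ (-1)%ZZ); [rewrite cm1 oppr_eq0 oner_eq0|vm_compute].
- by apply: (gen false _ _ 1%ZZ); [rewrite c1 oner_eq0|vm_compute].
Qed.

(** The four other root elements and their conjugates by [flip] give the eight root groups of SL(4)
    that mix the halves {0, 1} and {2, 3} of the basis of V. *)
Lemma realized_half (i j : 'I_4) t : (i < 2)%N != (j < 2)%N -> realized 1%:M (elem i j t).
Proof.
have [c1 c2 _ _ [cm1 cm2 _ _ _]] := zvalE K.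
have gen r (fl : bool) (i0 j0 : 'I_4) c : zval K c != 0 ->
    gen_check (r, fl, 0, i0 : nat, j0 : nat, c)%N -> realized 1%:M (elem i0 j0 t).
  move=> c0 /(gen_cf (t / zval K c)) [a wa ea]; exists a => //; split; apply/matrixP => k l.
    by rewrite !mxE ea // mul0r addr0.
  by rewrite !mxE ea // (mulrC (zval K c)) mulfVK // (mulrC t).
have n1 : zval K 1%ZZ != 0 by rewrite c1 oner_eq0.
have nm1 : zval K (-1)%ZZ != 0 by rewrite cm1 oppr_eq0 oner_eq0.
have n2 : zval K 2%ZZ != 0 by rewrite c2 pnatr_eq0.
have nm2 : zval K (-2)%ZZ != 0 by rewrite cm2 oppr_eq0 pnatr_eq0.
case: i j => [[|[|[|[|i]]]]] // li [[|[|[|[|j]]]]] // lj _.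
- by apply: (gen 1%N true _ _ _ nm1); vm_compute.
- by apply: (gen 3%N true _ _ _ n2); vm_compute.
- by apply: (gen 4%N true _ _ _ n2); vm_compute.
- by apply: (gen 2%N true _ _ _ nm1); vm_compute.
- by apply: (gen 1%N false _ _ _ n1); vm_compute.
- by apply: (gen 3%N false _ _ _ nm2); vm_compute.
- by apply: (gen 4%N false _ _ _ nm2); vm_compute.
- by apply: (gen 2%N false _ _ _ n1); vm_compute.
Qed.

Lemma realized_1mul B B' : realized 1%:M B -> realized 1%:M B' -> realized 1%:M (B *m B').
Proof. by move=> h /(realized_mul h); rewrite mulmx1. Qed.

(** Inside one half of the basis, the elementary matrix is a commutator through an index k of the
    other half. *)
Lemma realized_M (i j : 'I_4) t : i != j -> realized 1%:M (elem i j t).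
Proof.
move=> ij; have [e|] := eqVneq (i < 2)%N (j < 2)%N; last exact: realized_half.
pose k : 'I_4 := if (i < 2)%N then ord_max else ord0.
have ki : (i < 2)%N != (k < 2)%N by rewrite /k; case: ifP.
have kj : (k < 2)%N != (j < 2)%N by rewrite -e eq_sym.
have ik : i != k by apply: contraNneq ki => ->.
have jk : k != j by apply: contraNneq kj => ->.
by rewrite -(elem_comm t ik jk ij); do 3! (apply: realized_1mul; first exact: realized_half);
  exact: realized_half.
Qed.

Lemma realizedP A B : \det A = 1 -> \det B = 1 -> realized A B.
Proof.
move=> dA dB; rewrite -[A]mulmx1 -[B]mul1mx; apply: realized_mul.
  apply: (elementary_generation (S := realized^~ 1%:M)) dA => [|A1 A2 h1 h2|i j t].
  - by rewrite -(elem0 K ord0 (ord_max : 'I_2)); exact: realized_S.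
  - by rewrite -[1%:M]mulmx1; exact: realized_mul.
  - exact: realized_S.
apply: (elementary_generation (S := realized 1%:M)) dB => [|B1 B2|i j t].
- by rewrite -[X in realized _ X](elem0 K ord0 (ord_max : 'I_4)); exact: realized_M.
- exact: realized_1mul.
- exact: realized_M.
Qed.

End Generation.

(** * Matrices for the Clifford algebra *)

Section CliffordRepresentation.
Variables (K : numClosedFieldType) (n m : nat) (g : 'I_n -> 'M[K]_m).
Hypotheses (g_sq : forall i, g i *m g i = 1%:M)
  (g_anti : forall i j, i != j -> g i *m g j = - (g j *m g i)).

Definition gam (s : seq 'I_n) (A : {set 'I_n}) : 'M[K]_m :=
  foldr (fun i M => if i \in A then g i *m M else M) 1%:M s.

Lemma gam_comm s (A : {set 'I_n}) k :
  gam s A *m g k = (-1) ^+ count (fun i => (i \in A) && (i != k)) s *: (g k *m gam s A).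
Proof.
elim: s => [|i s IH] /=; first by rewrite mul1mx mulmx1 scale1r.
case: (i \in A) => /=; last by rewrite IH.
rewrite -mulmxA IH -scalemxAr !mulmxA; have [->|ik] := eqVneq i k; first by [].
by rewrite (g_anti ik) exprD expr1 mulN1r scaleNr mulNmx scalerN.
Qed.

Definition symdiff (A B : {set 'I_n}) := ((A :\: B) :|: (B :\: A))%SET.

Definition inversions (s : seq 'I_n) (A B : {set 'I_n}) :=
  (\sum_(i <- s | i \in A) \sum_(j <- s | j \in B) (j < i))%N.

Lemma inversions_cons (k : 'I_n) s (A B : {set 'I_n}) : all (fun i : 'I_n => k < i)%N s ->
  inversions (k :: s) A B = ((k \in B) * count (fun i => i \in A) s + inversions s A B)%N.
Proof.
move=> /allP ks; rewrite /inversions big_cons.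
have -> : (\sum_(j <- k :: s | j \in B) (j < k))%N = 0%N.
  rewrite big_cons ltnn big_seq_cond big1 => [|i /andP[si _]]; first by case: ifP.
  by rewrite ltnNge ltnW // ks.
have -> : (\sum_(i <- s | i \in A) \sum_(j <- k :: s | j \in B) (j < i))%N =
    (\sum_(i <- s | i \in A) ((k \in B) + \sum_(j <- s | j \in B) (j < i)))%N.
  rewrite big_seq_cond [RHS]big_seq_cond; apply: eq_bigr => i /andP[si _].
  by rewrite big_cons ks //; case: (k \in B).
rewrite big_split /= add0n if_same; congr (_ + _)%N.
by rewrite big_const_seq iter_addn_0.
Qed.

(** The head k is the least index, so bringing the factor g_k of the second product to the front
    crosses each factor of the first tail once: these are the inversions due to k. Then g_k^2 = 1
    merges equal factors. *)
Lemma gam_mul s (A B : {set 'I_n}) : pairwise (fun i j : 'I_n => i < j)%N s ->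
  gam s A *m gam s B = (-1) ^+ inversions s A B *: gam s (symdiff A B).
Proof.
elim: s => [_|k s IH]; first by rewrite /inversions big_nil mulmx1 scale1r.
rewrite pairwise_cons => /andP[ks sk]; rewrite inversions_cons //.
have {}IH := IH sk.
have cs : count (fun i => (i \in A) && (i != k)) s = count (fun i => i \in A) s.
  apply: eq_in_count => i si; have /allP/(_ i si) := ks; case: eqP => [->|_]; last by rewrite andbT.
  by rewrite ltnn.
have swap : gam s A *m (g k *m gam s B) =
    (-1) ^+ (count (fun i => i \in A) s + inversions s A B) *: (g k *m gam s (symdiff A B)).
  by rewrite mulmxA gam_comm cs -scalemxAl -mulmxA IH -scalemxAr scalerA -exprD.
rewrite /= !inE; case: (k \in A); case: (k \in B) => /=.
- by rewrite mul1n -[LHS]mulmxA swap -scalemxAr mulmxA g_sq mul1mx.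
- by rewrite mul0n add0n -[LHS]mulmxA IH -scalemxAr.
- by rewrite mul1n swap.
- by rewrite mul0n add0n IH.
Qed.

Definition gamma (A : {set 'I_n}) := gam (enum 'I_n) A.

Lemma cliff_signE (A B : {set 'I_n}) : cliff_sign K A B = (-1) ^+ inversions (enum 'I_n) A B.
Proof.
rewrite /cliff_sign; congr (_ ^+ _); rewrite /inversions big_enum_cond /= -sum1_card.
under [in RHS]eq_bigr => i _ do rewrite big_enum_cond /=.
rewrite pair_big_dep /= [LHS]big_mkcond [RHS]big_mkcond; apply: eq_bigr => -[i j] _ /=.
rewrite unfold_in /=.
by case: (i \in A); case: (j \in B); case: (j < i)%N.
Qed.

Lemma enum_pairwise : pairwise (fun i j : 'I_n => i < j)%N (enum 'I_n).
Proof.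
have := pairwise_map (@nat_of_ord n) ltn (enum 'I_n); rewrite val_enum_ord => e.
by apply: etrans (esym e) _; rewrite -sorted_pairwise ?iota_ltn_sorted //; exact: ltn_trans.
Qed.

Lemma gamma_mul A B : gamma A *m gamma B = cliff_sign K A B *: gamma (symdiff A B).
Proof. by rewrite cliff_signE gam_mul // enum_pairwise. Qed.

Lemma gamma0 : gamma finset.set0 = 1%:M.
Proof. by rewrite /gamma; elim: (enum 'I_n) => //= i s ->; rewrite finset.in_set0. Qed.

Lemma gamma1 i : gamma [set i]%SET = g i.
Proof.
rewrite /gamma; have : uniq (enum 'I_n) := enum_uniq _; have : i \in enum 'I_n by rewrite mem_enum.
elim: (enum 'I_n) => //= j s IH; rewrite inE !finset.in_set1 => ji /andP[js us].
have [e|ne] := eqVneq j i; last first.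
  by apply: IH => //; move: ji; rewrite eq_sym (negPf ne).
suff -> : gam s [set i]%SET = 1%:M by rewrite mulmx1 e.
rewrite e in js; elim: s js {IH ji us} => //= k s IH; rewrite inE negb_or => /andP[ik si].
by rewrite finset.in_set1 eq_sym (negPf ik) IH.
Qed.

Definition cliff_mx (x : clifford K n) : 'M[K]_m := \sum_A x A *: gamma A.

Lemma cliff_mx_mul x y : cliff_mx (cliff_mul x y) = cliff_mx x *m cliff_mx y.
Proof.
rewrite /cliff_mx mulmx_suml.
under [RHS]eq_bigr => A _ do rewrite mulmx_sumr.
under [LHS]eq_bigr => C _ do rewrite /cliff_mul scaler_suml.
rewrite exchange_big; apply: eq_bigr => A _.
under [LHS]eq_bigr => C _ do rewrite scaler_suml.
rewrite (exchange_big_dep xpredT) //=; apply: eq_bigr => B _.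
rewrite (big_pred1 (symdiff A B)) //.
by rewrite -scalemxAl -scalemxAr gamma_mul !scalerA; congr (_ *: _); ring.
Qed.

Lemma cliff_mx1 : cliff_mx (@cliff_one K n) = 1%:M.
Proof.
rewrite /cliff_mx (bigD1 finset.set0) //= /cliff_one eqxx scale1r gamma0 big1 ?addr0 //.
by move=> A /negPf ->; rewrite scale0r.
Qed.

Lemma cliff_mx_vec (v : 'rV[K]_n) : cliff_mx (cliff_vec v) = \sum_i v 0 i *: g i.
Proof.
rewrite /cliff_mx /cliff_vec; under eq_bigr => A _ do rewrite scaler_suml.
rewrite exchange_big; apply: eq_bigr => i _.
rewrite (bigD1 [set i]%SET) //= eqxx mulr1 gamma1 big1 ?addr0 // => A /negPf ->.
by rewrite mulr0 scale0r.
Qed.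

Hypothesis n_even : ~~ odd n.

(** Some g_k anticommutes with gamma A: take k in A if |A| is even, and k outside A if |A| is odd,
    which is possible because n is even. Cyclicity of the trace then gives tr = - tr. *)
Lemma mxtrace_gamma (A : {set 'I_n}) : A != finset.set0 -> \tr (gamma A) = 0.
Proof.
move=> A0; have [k ko] : exists k, odd #|(A :\ k)%SET|.
  case oA : (odd #|A|).
    have /subsetPn[k _ kA] : ~~ ([set: 'I_n] \subset A)%SET.
      apply: contraNN n_even => /subset_leq_card; rewrite cardsT card_ord => le.
      by have -> : n = #|A| by apply/eqP; rewrite eqn_leq le -[X in (_ <= X)%N]card_ord max_card.
    by exists k; move: oA; rewrite (cardsD1 k A) (negPf kA).
  have /set0Pn[k kA] := A0; exists k.
  by move: oA; rewrite (cardsD1 k A) kA /= => /negbFE.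
have e : count (fun i => (i \in A) && (i != k)) (enum 'I_n) = #|(A :\ k)%SET|.
  by rewrite -sum1_count big_enum_cond /= sum1_card; apply: eq_card => i; rewrite !inE andbC.
have : \tr (gamma A) = - \tr (gamma A).
  rewrite -{1}[gamma A]mulmx1 -(g_sq k) mulmxA gam_comm e -signr_odd ko expr1 scaleN1r.
  by rewrite mulNmx linearN /= mxtrace_mulC mulmxA g_sq mul1mx.
by move/eqP; rewrite -addr_eq0 -mulr2n mulrn_eq0 => /eqP.
Qed.

(** The matrices gamma A are orthogonal for the form tr (M N), so traces read off coefficients; the
    sign is that of the square of gamma A. *)
Definition mx_cliff (M : 'M[K]_m) : clifford K n :=
  fun A : {set 'I_n} => m%:R^-1 * (cliff_sign K A A * \tr (gamma A *m M)).

Lemma cliff_mxK (m_gt0 : (0 < m)%N) : cancel cliff_mx mx_cliff.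
Proof.
move=> x; apply/funext => A; rewrite /mx_cliff /cliff_mx mulmx_sumr linear_sum /=.
have ss : symdiff A A = finset.set0 by rewrite /symdiff finset.setDv finset.setU0.
have AA : gamma A *m gamma A = cliff_sign K A A *: 1%:M by rewrite gamma_mul ss gamma0.
rewrite (bigD1 A) //= big1 => [|B BA]; last first.
  rewrite -scalemxAr gamma_mul !linearZ /= mxtrace_gamma ?mulr0 //.
  apply: contraNneq BA => /setP AB; apply/eqP/setP => i.
  by have := AB i; rewrite !inE; case: (i \in A); case: (i \in B).
rewrite addr0 -scalemxAr AA scalerA linearZ /= mxtrace1 /cliff_sign -signr_odd.
have m0 : m%:R != 0 :> K by rewrite pnatr_eq0 -lt0n.
by move: (x A) => c; case: odd; rewrite ?expr0 ?expr1; field.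
Qed.
End CliffordRepresentation.

(** * Spin(6) as SL(4) *)

Section SpinSix.
Variable K : numClosedFieldType.

(* Entries of a skew matrix in the order 01, 02, 03, 12, 13, 23. *)
Definition skew_coef (p : seq K) (i j : nat) : K :=
  nth 0 (nth [::] [:: [:: 0; p`_0; p`_1; p`_2]; [:: - p`_0; 0; p`_3; p`_4];
    [:: - p`_1; - p`_3; 0; p`_5]; [:: - p`_2; - p`_4; - p`_5; 0]] i) j.
Definition skewmx (p : seq K) : 'M[K]_4 := \matrix_(i < 4, j < 4) skew_coef p i j.
Definition pfaffian (p : seq K) : K := p`_0 * p`_5 - p`_1 * p`_4 + p`_2 * p`_3.
(** Coordinates of the Pfaffian adjoint, which is the inverse when the Pfaffian is 1. *)
Definition skew_adj (p : seq K) : seq K :=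
  [:: - p`_5; p`_4; - p`_3; - p`_2; p`_1; - p`_0].

Lemma skew_adjK p : skewmx (skew_adj p) *m skewmx p = (pfaffian p)%:M.
Proof.
apply/matrixP => i j; rewrite !mxE !big_ord_recl big_ord0 !mxE /pfaffian.
case: i j => [[|[|[|[|i]]]] // li] [[|[|[|[|j]]]] // lj];
  rewrite /skew_coef /= ?mulr1n ?mulr0n; ring.
Qed.

Lemma skewK p : skewmx p *m skewmx (skew_adj p) = (pfaffian p)%:M.
Proof.
apply/matrixP => i j; rewrite !mxE !big_ord_recl big_ord0 !mxE /pfaffian.
case: i j => [[|[|[|[|i]]]] // li] [[|[|[|[|j]]]] // lj];
  rewrite /skew_coef /= ?mulr1n ?mulr0n; ring.
Qed.

Lemma det_skewmx p : \det (skewmx p) = pfaffian p ^+ 2.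
Proof. by rewrite det_mx44 /skew_coef /= /pfaffian; ring. Qed.

Lemma pfaffian_adj p : pfaffian (skew_adj p) = pfaffian p.
Proof. by rewrite /pfaffian /=; ring. Qed.

Lemma tr_skewmx p : (skewmx p)^T = - skewmx p.
Proof.
apply/matrixP => i j; rewrite !mxE.
by case: i j => [[|[|[|[|i]]]] // li] [[|[|[|[|j]]]] // lj]; rewrite /skew_coef /= ?oppr0 ?opprK.
Qed.

(** Each x^2 + y^2 = (x + i y)(x - i y) is matched with one of the three products in the Pfaffian,
    which thereby becomes the sum of six squares. *)
Definition plucker (v : 'rV[K]_6) : seq K :=
  let x k := v 0 (inord k) in
  [:: x 0%N + 'i * x 1%N; x 2%N + 'i * x 3%N; x 4%N + 'i * x 5%N;
      x 4%N - 'i * x 5%N; - (x 2%N - 'i * x 3%N); x 0%N - 'i * x 1%N].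

Lemma sum6 (V : nmodType) (F : 'I_6 -> V) : \sum_i F i =
  F (inord 0) + (F (inord 1) + (F (inord 2) + (F (inord 3) + (F (inord 4) + F (inord 5))))).
Proof.
rewrite !big_ord_recl big_ord0 addr0.
by congr (F _ + (F _ + (F _ + (F _ + (F _ + F _))))); apply: val_inj; rewrite /= inordK.
Qed.

Lemma pfaffian_plucker v : pfaffian (plucker v) = \sum_i v 0 i ^+ 2.
Proof.
rewrite sum6 /pfaffian /=; have := sqrCi K => h; ring: h.
Qed.

Definition gamma_mx (v : 'rV[K]_6) : 'M[K]_(4 + 4) :=
  block_mx 0 (skewmx (skew_adj (plucker v))) (skewmx (plucker v)) 0.

Lemma gamma_mx_mul v w : gamma_mx v *m gamma_mx w =
  block_mx (skewmx (skew_adj (plucker v)) *m skewmx (plucker w)) 0 0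
           (skewmx (plucker v) *m skewmx (skew_adj (plucker w))).
Proof. by rewrite mulmx_block !(mul0mx, mulmx0, addr0, add0r). Qed.

Lemma gamma_mx_sq v : gamma_mx v *m gamma_mx v = (\sum_i v 0 i ^+ 2)%:M.
Proof. by rewrite gamma_mx_mul skew_adjK skewK pfaffian_plucker -scalar_mx_block. Qed.

Lemma gamma_mx_linear : linear gamma_mx.
Proof.
move=> c u v; rewrite /gamma_mx scale_block_mx add_block_mx !scaler0 !addr0.
congr block_mx; apply/matrixP => i j; rewrite !mxE;
  case: i j => [[|[|[|[|i]]]] // li] [[|[|[|[|j]]]] // lj];
  rewrite /skew_coef /= ?mxE; ring.
Qed.

Definition gen6 (i : 'I_6) := gamma_mx (delta_mx 0 i).

Lemma gamma_mxE v : gamma_mx v = \sum_i v 0 i *: gen6 i.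
Proof.
rewrite {1}[v]row_sum_delta (lf_sum _ _ gamma_mx_linear).
by apply: eq_bigr => i _; rewrite (lfZ gamma_mx_linear).
Qed.

Lemma gen6_sq i : gen6 i *m gen6 i = 1%:M.
Proof.
rewrite gamma_mx_sq; congr _%:M; rewrite (bigD1 i) //= big1 => [|j /negPf ji].
  by rewrite mxE !eqxx expr1n addr0.
by rewrite mxE ji andbF expr0n.
Qed.

Lemma gen6_anti i j : i != j -> gen6 i *m gen6 j = - (gen6 j *m gen6 i).
Proof.
move=> ij; have := gamma_mx_sq (delta_mx 0 i + delta_mx 0 j).
rewrite (lfD gamma_mx_linear) mulmxDl !mulmxDr -!/(gen6 _) !gen6_sq.
have -> : \sum_k (delta_mx 0 i + delta_mx 0 j : 'rV[K]_6) 0 k ^+ 2 = 1 + 1.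
  rewrite (bigD1 i) //= (bigD1 j) 1?eq_sym //= big1 => [|k /andP[/negPf ki /negPf kj]].
    by rewrite !mxE !eqxx (negPf ij) eq_sym (negPf ij) /= !(addr0, add0r) expr1n.
  by rewrite !mxE ki kj !andbF addr0 expr0n.
rewrite raddfD /= -addrA => /addrI; rewrite addrA -[RHS]add0r => /addIr /eqP.
by rewrite addr_eq0 => /eqP.
Qed.

Definition spin_mx : clifford K 6 -> 'M[K]_(4 + 4) := cliff_mx gen6.
Definition mx_spin : 'M[K]_(4 + 4) -> clifford K 6 := mx_cliff gen6.

Lemma spin_mxK : cancel spin_mx mx_spin.
Proof. exact: (cliff_mxK gen6_sq gen6_anti). Qed.

Lemma spin_mx_mul x y : spin_mx (cliff_mul x y) = spin_mx x *m spin_mx y.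
Proof. exact: (cliff_mx_mul gen6_sq gen6_anti). Qed.

Definition gamma_prod (s : seq 'rV[K]_6) := foldr (fun v M => gamma_mx v *m M) 1%:M s.

Lemma spin_mx_prod s :
  spin_mx (foldr (@cliff_mul K 6) (@cliff_one K 6) [seq cliff_vec v | v <- s]) = gamma_prod s.
Proof.
elim: s => [|v s IH] /=; first exact: cliff_mx1.
by rewrite spin_mx_mul IH gamma_mxE /spin_mx cliff_mx_vec.
Qed.

Lemma gamma_prod_cat s t : gamma_prod (s ++ t) = gamma_prod s *m gamma_prod t.
Proof. by elim: s => [|v s IH] /=; rewrite ?mul1mx // IH mulmxA. Qed.

Definition unit_vec (v : 'rV[K]_6) := \sum_i v 0 i ^+ 2 = 1.

Lemma gamma_prod_even s : ~~ odd (size s) -> (forall v, v \in s -> unit_vec v) ->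
  exists B C, [/\ gamma_prod s = block_mx B 0 0 C, \det B = 1 & B^T *m C = 1%:M].
Proof.
have [k] := ubnP (size s); elim: k s => // k IH [|v [|w s]] //=.
  by move=> _ _ _; exists 1%:M, 1%:M; rewrite det1 trmx1 mulmx1 -scalar_mx_block.
rewrite negbK ltnS => ks os us.
have [|x xs|B [C [eBC dB BC]]] := IH s _ os; first exact: leq_trans (leqnSn _) ks.
  by apply: us; rewrite !inE xs !orbT.
have uv : unit_vec v by apply: us; rewrite mem_head.
have uw : unit_vec w by apply: us; rewrite !inE eqxx orbT.
rewrite eBC mulmxA gamma_mx_mul mulmx_block !(mul0mx, mulmx0, addr0, add0r).
set p := plucker v; set q := plucker w.
have fp : pfaffian p = 1 by rewrite pfaffian_plucker.
have fq : pfaffian q = 1 by rewrite pfaffian_plucker.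
do 2! eexists; split; first reflexivity.
  by rewrite !det_mulmx dB !det_skewmx pfaffian_adj fp fq !expr1n !mulr1.
rewrite !trmx_mul !tr_skewmx !(mulNmx, mulmxN) opprK -!mulmxA (mulmxA _ (skewmx p)).
rewrite skew_adjK fp mul1mx (mulmxA _ (skewmx (skew_adj q))).
by rewrite skewK fq mul1mx.
Qed.

Definition spinnable (B : 'M[K]_4) := exists (s : seq 'rV[K]_6) C,
  [/\ ~~ odd (size s), forall v, v \in s -> unit_vec v,
      gamma_prod s = block_mx B 0 0 C & B^T *m C = 1%:M].

Lemma spinnable_mul B B' : spinnable B -> spinnable B' -> spinnable (B *m B').
Proof.
move=> [s [C [os us es BC]]] [s' [C' [os' us' es' BC']]]; exists (s ++ s'), (C *m C'); split.
- by rewrite size_cat oddD (negPf os) (negPf os').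
- by move=> v; rewrite mem_cat => /orP[/us|/us'].
- by rewrite gamma_prod_cat es es' mulmx_block !(mul0mx, mulmx0, addr0, add0r).
- by rewrite trmx_mul -mulmxA (mulmxA B^T) BC mul1mx.
Qed.

Lemma spinnable1 : spinnable 1%:M.
Proof. by exists [::], 1%:M; split=> //=; rewrite ?trmx1 ?mulmx1 // -scalar_mx_block. Qed.

Lemma pluckerP (p : seq K) : size p = 6 -> pfaffian p = 1 ->
  exists2 v, unit_vec v & plucker v = p.
Proof.
case: p => [|a [|b [|c [|d [|e [|f [|]]]]]]] // _ fp.
(* The inverse of the linear map [plucker], with 1 / i = - i. *)
pose v : 'rV[K]_6 := \row_k [:: 2^-1 * (a + f); 2^-1 * 'i * (f - a); 2^-1 * (b - e);
   - (2^-1 * 'i * (b + e)); 2^-1 * (c + d); 2^-1 * 'i * (d - c)]`_k.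
have ev : plucker v = [:: a; b; c; d; e; f].
  have n2 : 2 != 0 :> K by rewrite pnatr_eq0.
  have h := sqrCi K; rewrite /plucker !mxE !inordK //=.
  by do 6! (congr cons; first by field: h).
by exists v => //; rewrite /unit_vec -pfaffian_plucker ev.
Qed.

Lemma spinnable_skew p q : size p = 6 -> size q = 6 -> pfaffian p = 1 -> pfaffian q = 1 ->
  spinnable (skewmx (skew_adj p) *m skewmx q).
Proof.
move=> sp sq fp fq; have [v uv ev] := pluckerP sp fp; have [w uw ew] := pluckerP sq fq.
exists [:: v; w], (skewmx p *m skewmx (skew_adj q)); split=> //=.
- by move=> x; rewrite !inE => /orP[] /eqP ->.
- by rewrite mulmx1 gamma_mx_mul ev ew.
- rewrite trmx_mul !tr_skewmx !(mulNmx, mulmxN) opprK -!mulmxA (mulmxA _ (skewmx p)).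
  by rewrite skew_adjK fp mul1mx skewK fq.
Qed.

(** A product of two skew matrices yields E_ij(t) only together with a second elementary matrix, of
    parameter e x^2. The values x = 1 and x = i give opposite parameters, which [elem_double]
    cancels. *)
Lemma spinnable_double (i j k l : 'I_4) (e t : K) (p q : K -> K -> seq K) :
  i != j -> k != l -> i != l -> k != j ->
  (forall x y, x * y = 1 -> [/\ size (p x y) = 6, size (q x y) = 6,
     pfaffian (p x y) = 1, pfaffian (q x y) = 1 &
     skewmx (skew_adj (p x y)) *m skewmx (q x y) = elem i j t *m elem k l (e * x ^+ 2)]) ->
  spinnable (elem i j (t + t)).
Proof.
move=> ij kl il kj pq; rewrite -(elem_double t e ij kl il kj).
have h x y : x * y = 1 -> spinnable (elem i j t *m elem k l (e * x ^+ 2)).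
  by move=> /pq[sp sq fp fq <-]; apply: spinnable_skew.
apply: spinnable_mul.
  by have := h 1 1 (mulr1 1); rewrite expr1n mulr1.
by have := h 'i (- 'i); rewrite mulrN -expr2 sqrCi opprK mulrN1; apply.
Qed.

(** In each case p and q agree except in one coordinate, and M_p^-1 M_q is a product of two
    commuting elementary matrices; the condition x y = 1 makes both Pfaffians 1. *)
Lemma spinnable_cycle (i j : 'I_4) t :
  (i, j) \in [:: (inord 0, inord 1); (inord 1, inord 2); (inord 2, inord 3); (inord 3, inord 0)] ->
  spinnable (elem i j t).
Proof.
have ne (m n : nat) : (m < 4)%N -> (n < 4)%N -> (inord m == inord n :> 'I_4) = (m == n).
  by move=> lm ln; rewrite -val_eqE /= !inordK.
have nat4 (k : 'I_4) n : (n < 4)%N -> (k == inord n) = (k == n :> nat).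
  by move=> ln; rewrite -val_eqE /= inordK.
have nat4' (k : 'I_4) n : (n < 4)%N -> (inord n == k) = (n == k :> nat).
  by move=> ln; rewrite -val_eqE /= inordK.
(* [spinnable_double] yields twice its parameter. *)
have -> : t = t / 2 + t / 2 by field.
move: (t / 2) => {}t; rewrite !inE !xpair_eqE => /or4P[] /andP[/eqP -> /eqP ->].
- apply: (@spinnable_double _ _ (inord 2) (inord 3) t t (fun x y => [:: 0; 0; x; y; 0; 0])
    (fun x y => [:: 0; 0; x; y; t * x; 0])); rewrite ?ne //.
  move=> x y xy; split=> //; rewrite /pfaffian /=; try by ring: xy.
  apply/matrixP => r c; rewrite elem_mulE !mxE !big_ord_recl big_ord0 !mxE !nat4 // !nat4' // !inordK //.
  by case: r c => [[|[|[|[|r]]]] // lr] [[|[|[|[|c]]]] // lc]; rewrite /skew_coef /=; ring: xy.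
- apply: (@spinnable_double _ _ (inord 0) (inord 3) t t (fun x y => [:: 0; - y; 0; 0; x; 0])
    (fun x y => [:: 0; - y; 0; 0; x; t * x])); rewrite ?ne //.
  move=> x y xy; split=> //; rewrite /pfaffian /=; try by ring: xy.
  apply/matrixP => r c; rewrite elem_mulE !mxE !big_ord_recl big_ord0 !mxE !nat4 // !nat4' // !inordK //.
  by case: r c => [[|[|[|[|r]]]] // lr] [[|[|[|[|c]]]] // lc]; rewrite /skew_coef /=; ring: xy.
- apply: (@spinnable_double _ _ (inord 0) (inord 1) t t (fun x y => [:: 0; 0; - y; - x; 0; 0])
    (fun x y => [:: 0; 0; - y; - x; - (t * x); 0])); rewrite ?ne //.
  move=> x y xy; split=> //; rewrite /pfaffian /=; try by ring: xy.
  apply/matrixP => r c; rewrite elem_mulE !mxE !big_ord_recl big_ord0 !mxE !nat4 // !nat4' // !inordK //.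
  by case: r c => [[|[|[|[|r]]]] // lr] [[|[|[|[|c]]]] // lc]; rewrite /skew_coef /=; ring: xy.
- apply: (@spinnable_double _ _ (inord 1) (inord 2) (- t) t (fun x y => [:: - y; 0; 0; 0; 0; - x])
    (fun x y => [:: - y; t * x; 0; 0; 0; - x])); rewrite ?ne //.
  move=> x y xy; split=> //; rewrite /pfaffian /=; try by ring: xy.
  apply/matrixP => r c; rewrite elem_mulE !mxE !big_ord_recl big_ord0 !mxE !nat4 // !nat4' // !inordK //.
  by case: r c => [[|[|[|[|r]]]] // lr] [[|[|[|[|c]]]] // lc]; rewrite /skew_coef /=; ring: xy.
Qed.
Lemma spinnable_elem (i j : 'I_4) t : i != j -> spinnable (elem i j t).
Proof.
pose S m n := forall t, spinnable (elem (inord m : 'I_4) (inord n) t).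
have ne (m n : nat) : (m < 4)%N -> (n < 4)%N -> (inord m == inord n :> 'I_4) = (m == n).
  by move=> lm ln; rewrite -val_eqE /= !inordK.
have step (k l m : nat) : [&& (k < 4)%N, (l < 4)%N, (m < 4)%N & uniq [:: k; l; m]] ->
    S k l -> S l m -> S k m.
  rewrite /= !inE => /and4P[lk ll lm /andP[/norP[kl km] /andP[lm' _]]] Skl Slm u.
  rewrite -(elem_comm (j := inord l)) ?ne //.
  by do 2! (apply: spinnable_mul; first by [exact: Skl|exact: Slm]); apply: spinnable_mul.
(* The four roots of the cycle 0, 1, 2, 3, 0 reach the other eight by commutators. *)
have [s01 s12 s23 s30] : [/\ S 0%N 1%N, S 1%N 2%N, S 2%N 3%N & S 3%N 0%N].
  by split=> u; apply: spinnable_cycle; rewrite !inE eqxx ?orbT.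
have s02 : S 0%N 2%N by apply: (step 0%N 1%N 2%N).
have s13 : S 1%N 3%N by apply: (step 1%N 2%N 3%N).
have s20 : S 2%N 0%N by apply: (step 2%N 3%N 0%N).
have s31 : S 3%N 1%N by apply: (step 3%N 0%N 1%N).
have s03 : S 0%N 3%N by apply: (step 0%N 1%N 3%N).
have s10 : S 1%N 0%N by apply: (step 1%N 2%N 0%N).
have s21 : S 2%N 1%N by apply: (step 2%N 3%N 1%N).
have s32 : S 3%N 2%N by apply: (step 3%N 0%N 2%N).
rewrite -(inord_val i) -(inord_val j) ne //.
by case: i j => [[|[|[|[|i]]]] // li] [[|[|[|[|j]]]] // lj].
Qed.

Lemma spinnableP B : \det B = 1 -> spinnable B.
Proof.
apply: elementary_generation; [exact: spinnable1|exact: spinnable_mul|exact: spinnable_elem].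
Qed.
End SpinSix.

(** * Continuity and connectedness *)

Section Continuity.
Variable K : numClosedFieldType.
Local Notation bv := (@bv K).
Local Notation cf := (@cf K).

Lemma ctsC (T U V : topologicalType) (f : T -> U) (g : U -> V) :
  continuous f -> continuous g -> continuous (fun t => g (f t)).
Proof. by move=> cf cg t; apply: continuous_comp; [exact: cf|exact: cg]. Qed.
Lemma cts_cst (T U : topologicalType) (c : U) : continuous (fun _ : T => c).
Proof. by move=> t; exact: cvg_cst. Qed.
Lemma cts_fst (A B : topologicalType) : continuous (@fst A B).
Proof. by move=> x; exact: cvg_fst. Qed.
Lemma cts_snd (A B : topologicalType) : continuous (@snd A B).
Proof. by move=> x; exact: cvg_snd. Qed.
Lemma cts_entry m n (i : 'I_m.+1) (j : 'I_n.+1) : continuous (fun M : 'M[K]_(m.+1, n.+1) => M i j).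
Proof. exact: coord_continuous. Qed.

Section FromT.
Variable T : topologicalType.

Lemma ctsD (V : normedModType K) (f g : T -> V) :
  continuous f -> continuous g -> continuous (fun t => f t + g t).
Proof. by move=> cf cg t; apply: cvgD; [exact: cf|exact: cg]. Qed.

Lemma ctsM (f g : T -> K) : continuous f -> continuous g -> continuous (fun t => f t * g t).
Proof. by move=> cf cg t; apply: cvgM; [exact: cf|exact: cg]. Qed.

Lemma ctsZ (V : normedModType K) (f : T -> K) (v : V) :
  continuous f -> continuous (fun t => f t *: v).
Proof. by move=> cf t; apply: cvgZr_tmp; exact: cf. Qed.

Lemma ctsZl (V : normedModType K) (c : K) (f : T -> V) :
  continuous f -> continuous (fun t => c *: f t).
Proof. by move=> cf t; apply: cvgZl_tmp; exact: cf. Qed.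

Lemma cts_sum (V : normedModType K) (I : Type) (r : seq I) (F : I -> T -> V) :
  (forall i, continuous (F i)) -> continuous (fun t => \sum_(i <- r) F i t).
Proof.
move=> cF; elim: r => [|i r IH].
  by under eq_fun do rewrite big_nil; move=> t; exact: cvg_cst.
by under eq_fun do rewrite big_cons; apply: ctsD; [exact: cF|exact: IH].
Qed.

Lemma cts_mx m n (F : T -> 'M[K]_(m.+1, n.+1)) :
  (forall i j, continuous (fun t => F t i j)) -> continuous F.
Proof.
move=> cF; have -> : F = fun t => \sum_i \sum_j F t i j *: delta_mx i j.
  by apply/funext => t; exact: matrix_sum_delta.
by apply: cts_sum => i; apply: cts_sum => j; exact: ctsZ.
Qed.

Lemma cts_block m n (B C : T -> 'M[K]_(m, n)) :
  (forall i j, continuous (fun t => B t i j)) -> (forall i j, continuous (fun t => C t i j)) ->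
  forall i j, continuous (fun t => block_mx (B t) 0 0 (C t) i j).
Proof.
move=> cB cC i j; case: (split_ordP i) => i' ->; case: (split_ordP j) => j' ->.
- by under eq_fun do rewrite block_mxEul; exact: cB.
- by under eq_fun do rewrite block_mxEur mxE; exact: cts_cst.
- by under eq_fun do rewrite block_mxEdl mxE; exact: cts_cst.
- by under eq_fun do rewrite block_mxEdr; exact: cC.
Qed.

Lemma cts_trace_mul n (M : 'M[K]_n) (F : T -> 'M[K]_n) :
  (forall i j, continuous (fun t => F t i j)) -> continuous (fun t => \tr (M *m F t)).
Proof.
move=> cF; rewrite /mxtrace; apply: cts_sum => i.
under eq_fun do rewrite mxE; apply: cts_sum => j.
by apply: ctsM => //; exact: cts_cst.
Qed.

Lemma cts_ptws (U : Type) (V : topologicalType) (f : T -> {ptws U -> V}) :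
  (forall u, continuous (fun t => f t u)) -> continuous f.
Proof.
move=> cf t; apply/cvg_sup => u A [V' [[W oW <-] /= Wft] WA].
rewrite nbhs_simpl; apply: (filterS WA).
exact: (cf u t W (open_nbhs_nbhs (conj oW Wft))).
Qed.

Fixpoint all_cts (L : seq (T -> K)) : Prop :=
  if L is f :: L' then continuous f /\ all_cts L' else True.
(** Continuity of a list-valued map: its coordinates form a fixed list of continuous functions, so
    the length is constant. *)
Definition cts_seq (F : T -> seq K) :=
  exists2 L, all_cts L & forall t, F t = [seq f t | f <- L].

Lemma cts_seq_cat F G : cts_seq F -> cts_seq G -> cts_seq (fun t => F t ++ G t).
Proof.
move=> [L cL eL] [M cM eM]; exists (L ++ M); last by move=> t; rewrite eL eM map_cat.
by elim: L cL {eL} => //= f L IH [cf /IH cL].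
Qed.

Lemma cts_seq_map (I : Type) (s : seq I) (F : I -> T -> K) :
  (forall i, continuous (F i)) -> cts_seq (fun t => [seq F i t | i <- s]).
Proof.
move=> cF; exists [seq F i | i <- s]; last by move=> t; rewrite -map_comp.
by elim: s => //= i s IH; split.
Qed.

Lemma cts_dotv (w : seq K) F : cts_seq F ->
  continuous (fun t => dotv (@gval K) (fun x y => x + y) (fun x y => x * y) w (F t)).
Proof.
move=> [L cL eL]; have -> : F = fun t => [seq f t | f <- L] by apply/funext.
have c0 : continuous (fun _ : T => intc (@gval K) Z0) by move=> t; exact: cvg_cst.
elim: w L cL {eL} => [|x w IH] [|f L] //= [cf cL].
apply: ctsD; last exact: IH.
by apply: ctsM => // t; exact: cvg_cst.
Qed.
End FromT.

Lemma cts_jco (T : topologicalType) (h : T -> jordan K) : continuous h -> cts_seq (fun t => jco (h t)).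
Proof.
move=> ch; have c1 := ctsC ch (@cts_fst _ _); have c2 := ctsC ch (@cts_snd _ _).
have e1 k : continuous (fun t => (h t).1 0 k) by exact: (ctsC c1 (@cts_entry 0 2 0 k)).
have e2 i k : continuous (fun t => row i (h t).2 0 k).
  have -> : (fun t => row i (h t).2 0 k) = fun t => (h t).2 i k by apply/funext => t; rewrite mxE.
  exact: (ctsC c2 (@cts_entry 2 7 i k)).
by rewrite /jco /oco; do 3! (apply: cts_seq_cat; first by apply: cts_seq_map);
  apply: cts_seq_map.
Qed.

Lemma cts_cf n : continuous (cf n).
Proof.
pose p1 (P : freudenthal K) := P.1.1.1; pose p2 (P : freudenthal K) := P.1.1.2.
pose p3 (P : freudenthal K) : K := P.1.2; pose p4 (P : freudenthal K) : K := P.2.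
have c1 : continuous (fun P : freudenthal K => P.1) by exact: cts_fst.
have c11 : continuous (fun P : freudenthal K => P.1.1) by exact: ctsC c1 (@cts_fst _ _).
have cp1 : continuous p1 by exact: ctsC c11 (@cts_fst _ _).
have cp2 : continuous p2 by exact: ctsC c11 (@cts_snd _ _).
have cp3 : continuous p3 by exact: ctsC c1 (@cts_snd _ _).
have cp4 : continuous p4 by exact: cts_snd.
have c : cts_seq (fun P : freudenthal K => fco P).
  have -> : (fun P : freudenthal K => fco P) =
      fun P => jco (p1 P) ++ (jco (p2 P) ++ [seq f P | f <- [:: p3; p4]]).
    by apply/funext => -[[[X Y] xi] eta].
  have c34 : cts_seq (fun P => [seq f P | f <- [:: p3; p4]]) by exists [:: p3; p4].
  exact: (cts_seq_cat (cts_jco cp1) (cts_seq_cat (cts_jco cp2) c34)).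
have h := cts_dotv (w := map (@gval K) (wform n)) c.
have c2 : continuous (fun _ : freudenthal K => 2^-1 : K) by move=> P; exact: cvg_cst.
exact: (ctsM c2 h).
Qed.

Lemma cts_eval (U : eqType) (V : topologicalType) (u : U) : continuous (fun f : {ptws U -> V} => f u).
Proof. exact: (@proj_continuous U (fun=> V) u). Qed.

End Continuity.

(** * The isomorphism of topological groups *)

Section Isomorphism.
Variable K : numClosedFieldType.
Local Notation bv := (@bv K).
Local Notation cf := (@cf K).
Local Notation G := (E7_sigma'4_so6 K).

Definition to_pair (a : freudenthal_maps K) : 'M[K]_2 * clifford K 6 :=
  (blk a 32 2, mx_spin (block_mx (blk a 0 4) 0 0 (blk a 28 4))).

Definition of_pair (p : 'M[K]_2 * clifford K 6) : freudenthal_maps K :=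
  Gam p.1 (ulsubmx (spin_mx p.2)) (drsubmx (spin_mx p.2)).

Lemma inverse_unique (B C C' : 'M[K]_4) : B^T *m C = 1%:M -> B^T *m C' = 1%:M -> C = C'.
Proof.
by move=> h h'; rewrite -[C]mulmx1 -h' mulmxA (mulmx1C h) mul1mx.
Qed.

(** [spinnableP] produces some lower block; it is the given C, since both are inverse to B^T. *)
Lemma spin_lift (B C : 'M[K]_4) : \det B = 1 -> B^T *m C = 1%:M ->
  exists2 x, Spin K 6 x & spin_mx x = block_mx B 0 0 C.
Proof.
move=> /spinnableP [s [C' [os us es BC']]] BC; rewrite (inverse_unique BC BC').
by exists (foldr (@cliff_mul K 6) (@cliff_one K 6) [seq cliff_vec v | v <- s]);
  [exists s|rewrite spin_mx_prod].
Qed.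

Lemma spin_blocks x : Spin K 6 x ->
  exists B C, [/\ spin_mx x = block_mx B 0 0 C, \det B = 1 & B^T *m C = 1%:M].
Proof. by move=> [s [os us ->]]; rewrite spin_mx_prod; exact: gamma_prod_even. Qed.

Lemma to_pairP a : G a -> Spin K 6 (to_pair a).2 /\
  spin_mx (to_pair a).2 = block_mx (blk a 0 4) 0 0 (blk a 28 4).
Proof.
move=> Ga; have [x sx ex] := spin_lift (G_detM Ga) (G_BC Ga).
by rewrite /to_pair /= -ex spin_mxK.
Qed.

Lemma to_pairK a : G a -> of_pair (to_pair a) = a.
Proof.
move=> Ga; have [_ e] := to_pairP Ga; apply/funext => P.
by rewrite /of_pair e block_mxKul block_mxKdr -(G_Gam Ga).
Qed.

Lemma of_pairP p : (SL2 K `*` Spin K 6) p -> exists2 a, word a & of_pair p = a /\ to_pair a = p.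
Proof.
case: p => A x [/= dA sx]; have [B [C [ex dB BC]]] := spin_blocks sx.
have [a wa [eA eB]] := realizedP dA dB; have Ga := word_G wa.
have eC : blk a 28 4 = C.
  by apply: inverse_unique BC; rewrite -eB; exact: G_BC Ga.
have ta : to_pair a = (A, x) by rewrite /to_pair eA eB eC -ex spin_mxK.
by exists a => //; split=> //; rewrite -ta to_pairK.
Qed.

(** A word realizing the blocks of a has the same pair as a, and [of_pair] recovers both from it.
    Thus generation by exponentials is a by-product of the isomorphism. *)
Lemma word_of_G a : G a -> word a.
Proof.
move=> Ga; have [sx _] := to_pairP Ga.
have [|b wb [eb _]] := @of_pairP (to_pair a); first by split=> //; exact: G_detS.
by move: eb; rewrite to_pairK // => ->.
Qed.

Lemma to_pair_mul a b : G a -> G b ->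
  to_pair (a \o b) = ((to_pair a).1 *m (to_pair b).1, cliff_mul (to_pair a).2 (to_pair b).2).
Proof.
move=> Ga Gb; have [_ ea] := to_pairP Ga; have [_ eb] := to_pairP Gb.
rewrite -[cliff_mul _ _]spin_mxK spin_mx_mul ea eb /to_pair !(blk_comp Ga Gb) //.
by rewrite mulmx_block !(mul0mx, mulmx0, addr0, add0r).
Qed.

Lemma cts_blk s l : forall i j, continuous (fun a : freudenthal_maps K => blk a s l i j).
Proof.
move=> i j; have -> : (fun a : freudenthal_maps K => blk a s l i j) =
    fun a => cf (s + i) (a (bv (s + j))) by apply/funext => a; rewrite mxE.
exact: (ctsC (@cts_eval _ (freudenthal K) (bv (s + j))) (@cts_cf K (s + i))).
Qed.

Lemma cts_to_pair : continuous to_pair.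
Proof.
have c1 : continuous (fun a => (to_pair a).1).
  by apply: cts_mx => i j; exact: cts_blk.
have c2 : continuous (fun a => (to_pair a).2).
  apply: cts_ptws => A; rewrite /to_pair /mx_spin /mx_cliff /=.
  do 2! (apply: ctsM; first exact: cts_cst).
  by apply: cts_trace_mul; apply: cts_block; exact: cts_blk.
by move=> a; apply: (cvg_pair (c1 a) (c2 a)).
Qed.

Lemma cts_Gam (T : topologicalType) (A : T -> 'M[K]_2) (B C : T -> 'M[K]_4) P :
  (forall i j, continuous (fun t => A t i j)) -> (forall i j, continuous (fun t => B t i j)) ->
  (forall i j, continuous (fun t => C t i j)) -> continuous (fun t => Gam (A t) (B t) (C t) P).
Proof.
move=> cA cB cC; have cm (i j k l : 'I_4) : continuous (fun t => B t i j * B t k l).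
  by apply: ctsM.
have cmin (i j k l : 'I_4) : continuous (fun t => B t i j * B t k l - B t k j * B t i l).
  apply: ctsD; first exact: cm.
  by under eq_fun do rewrite -mulN1r; apply: ctsM; [exact: cts_cst|exact: cm].
have double l m (c : 'I_l -> 'I_m -> K) (F : 'I_l -> 'I_m -> T -> freudenthal K) :
    (forall p k, continuous (F p k)) ->
    continuous (fun t => \sum_(p < l) \sum_(k < m) c p k *: F p k t).
  by move=> cF; apply: cts_sum => p; apply: cts_sum => k; apply: ctsZl.
have cslice s l (x : 'I_l -> T -> K) : (forall i, continuous (x i)) ->
    continuous (fun t => slice s (x^~ t)).
  by move=> cx; apply: cts_sum => i; apply: ctsZ.
apply: (ctsD (ctsD (ctsD _ _) _) _); apply: double => p k.
- by apply: (cslice _ _ (fun i t => B t i k)).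
- by apply: (cslice _ _ (fun i t => C t i k)).
- by apply: (cslice _ _ (fun i t => A t i k)).
- apply: cts_sum => i; apply: cts_sum => m; apply: ctsZ; apply: ctsM => //; exact: cmin.
Qed.

Lemma cts_of_pair : continuous of_pair.
Proof.
have c1 := @cts_fst 'M[K]_2 (clifford K 6); have c2 := @cts_snd 'M[K]_2 (clifford K 6).
have cs i j : continuous (fun p : 'M[K]_2 * clifford K 6 => spin_mx p.2 i j).
  have -> : (fun p : 'M[K]_2 * clifford K 6 => spin_mx p.2 i j) =
      fun p => \sum_(A : {set 'I_6}) p.2 A * gamma (@gen6 K) A i j.
    by apply/funext => p; rewrite summxE; apply: eq_bigr => A _; rewrite mxE.
  apply: cts_sum => A; apply: ctsM; last exact: cts_cst.
  exact: (ctsC c2 (@cts_eval _ _ A)).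
apply: cts_ptws => P; apply: cts_Gam => i j.
- exact: (ctsC c1 (@cts_entry K 1 1 i j)).
- have -> : (fun p : 'M[K]_2 * clifford K 6 => ulsubmx (spin_mx p.2) i j) =
      fun p => spin_mx p.2 (lshift 4 i) (lshift 4 j) by apply/funext => p; rewrite !mxE.
  exact: cs.
- have -> : (fun p : 'M[K]_2 * clifford K 6 => drsubmx (spin_mx p.2) i j) =
      fun p => spin_mx p.2 (rshift 4 i) (rshift 4 j) by apply/funext => p; rewrite !mxE.
  exact: cs.
Qed.

Lemma E7_topgroup_iso : topgroup_iso G (fun a b => a \o b)
  (SL2 K `*` Spin K 6) (fun p q => (p.1 *m q.1, cliff_mul p.2 q.2)).
Proof.
exists to_pair, of_pair; split.
- split=> [a Ga|p /of_pairP[a wa [-> _]]]; last exact: word_G.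
  by split; [exact: G_detS|have [] := to_pairP Ga].
- by split=> [a /to_pairK|p /of_pairP[a _ [-> ->]]].
- exact: to_pair_mul.
- exact: continuous_subspaceT cts_to_pair.
- exact: continuous_subspaceT cts_of_pair.
Qed.

End Isomorphism.

(** * Connectedness *)

Section Connected.
Variable R : realType.
Local Notation K := (Cplx R).
Local Notation G := (E7_sigma'4_so6 K).

(** The image of each vector moves on a straight line, which makes the paths pointwise
    continuous. *)
Lemma expA_affine (F : numClosedFieldType) (A : jordan F) t P :
  expA (t *: A) P = P + t *: (expA A P - P).
Proof.
case: P => [[[X Y] xi] eta].
have e (V : lmodType F) (x y : V) : x + t *: (x + y - x) = x + t *: y by rewrite addrAC subrr add0r.
rewrite -[RHS]/(X + t *: (X + eta *: A - X), Y + t *: (Y + 2 *: jcross A X - Y),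
  xi + t * (xi + jform A Y - xi), eta + t * (eta - eta)).
rewrite !e subrr mulr0 addr0 /expA jcrossZl (jformZl t).
by rewrite !scalerA [eta * t]mulrC [2 * t]mulrC.
Qed.

Lemma cts_real_complex : continuous (fun s : R => (s%:C)%C : K).
Proof.
move=> x; apply/cvgrPdist_lt => e e0.
(* A positive element of the complex numbers is real. *)
have [e' e'0 ->] : exists2 e', 0 < e' & e = (e'%:C)%C.
  move: e0; rewrite ltcE => /andP[/eqP i0 r0]; exists (complex.Re e) => //.
  by case: e i0 r0 => a b /= ->.
have : \forall s \near x, `|x - s| < e' by exact: (nbhsx_ballx x e' e'0).
apply: filterS => s; rewrite -rmorphB normc_def /= expr0n addr0 sqrtr_sqr.
by rewrite ltcR.
Qed.

Definition joined (a b : freudenthal_maps K) :=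
  exists E : set (freudenthal_maps K), [/\ connected E, E `<=` G, E a & E b].

Lemma joined_path (phi : R -> freudenthal_maps K) : continuous phi ->
  (forall s, G (phi s)) -> joined (phi 0) (phi 1).
Proof.
move=> cphi Gphi; exists [set phi s | s in `[0, 1]]; split.
- by apply: connected_continuous_connected; [exact: segment_connected|exact: continuous_subspaceT].
- by move=> _ [s _ <-].
- by exists 0 => //=; rewrite in_itv /= lexx ler01.
- by exists 1 => //=; rewrite in_itv /= lexx ler01.
Qed.

(** The factor b on the right makes the induction close: the connected sets for b to c b and for c b
    to a c b share the point c b. *)
Lemma word_joined a : word a -> forall b, G b -> joined b (a \o b).
Proof.
elim=> {a} [A t rA|A t rA|a c _ IHa wc IHc] b Gb.
- pose phi s : freudenthal_maps K := expA (((s%:C)%C * t : K) *: A) \o b.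
  have <- : phi 0 = b.
    by apply/funext => P; rewrite /phi /= rmorph0 mul0r expA_affine scale0r addr0.
  have -> : expA (t *: A) \o phi 0 = phi 1.
    apply/funext => P; rewrite /phi /= rmorph1 mul1r; congr expA.
    by rewrite rmorph0 mul0r expA_affine scale0r addr0.
  apply: joined_path => [|s]; last by apply: G_comp Gb; exact: G_expA.
  apply: cts_ptws => P; rewrite /phi /=; under eq_fun do rewrite expA_affine.
  apply: ctsD; first exact: cts_cst.
  by apply: ctsZ; apply: ctsM; [exact: cts_real_complex|exact: cts_cst].
- have lf := @flip_linear K.
  pose phi s : freudenthal_maps K := @flip K \o (expA (((s%:C)%C * t : K) *: A) \o (@unflip K \o b)).
  have phiE s P : phi s P = b P + ((s%:C)%C * t : K) *: flip (expA A (unflip (b P)) - unflip (b P)).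
    rewrite -[LHS]/(flip (expA (((s%:C)%C * t : K) *: A) (unflip (b P)))).
    by rewrite expA_affine (lfD lf) (lfZ lf) unflipK.
  have phi0 : phi 0 = b by apply/funext => P; rewrite phiE rmorph0 mul0r scale0r addr0.
  have phi1 : (@flip K \o (expA (t *: A) \o @unflip K)) \o b = phi 1.
    by rewrite /phi rmorph1 mul1r.
  rewrite phi1 -phi0; apply: joined_path => [|s].
    apply: cts_ptws => P; under eq_fun do rewrite phiE.
    apply: ctsD; first exact: cts_cst.
    by apply: ctsZ; apply: ctsM; [exact: cts_real_complex|exact: cts_cst].
  have := G_comp (word_G (word_flip ((s%:C)%C * t : K) rA)) Gb.
  by [].
- have Gc := word_G wc; have [E [cE EG Eb Ec]] := IHc b Gb.
  have [E' [cE' EG' Eb' Ec']] := IHa _ (G_comp Gc Gb).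
  exists (E `|` E'); split; [|by move=> x [/EG|/EG']|by left|by right].
  by apply: connectedU => //; exists (c \o b).
Qed.

Lemma connected_G : connected G.
Proof.
have -> : G = \bigcup_(E in [set E : set (freudenthal_maps K) | [/\ connected E, E `<=` G & E id]]) E.
  apply/seteqP; split=> [a Ga|a [E [_ EG _]] Ea]; last exact: EG.
  have [E [cE EG E1 Ea]] := word_joined (word_of_G Ga) (@G_id K).
  by exists E.
by apply: bigcup_connected => [|E []//]; exists id => E [].
Qed.
End Connected.

Theorem theorem4p22 (R : realType) :
  topgroup_iso
    (E7_sigma'4_so6 (Cplx R)) (fun a b => a \o b)
    (SL2 (Cplx R) `*` Spin (Cplx R) 6)
    (fun p q => (p.1 *m q.1, cliff_mul p.2 q.2))
  /\ connected (E7_sigma'4_so6 (Cplx R)).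
Proof. by split; [exact: E7_topgroup_iso|exact: connected_G]. Qed.
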